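(* Let $m\ge2$ and $d\ge2$ be integers. If the pair $(m,d)$ is compatible, then there exist a polynomial $\mathbf{K}$ on $\mathbb{H}_{m,d}$, with $r=\deg\mathbf{K}$, and a constant $C>0$ such that for all $\pi\in\mathbb{H}_{m,d}$ $$\frac1C\sqrt[r]{\mathbf{K}(\pi)}\le K_{m,d}(\pi)\le C\sqrt[r]{\mathbf{K}(\pi)}.$$ If the pair $(m,d)$ is not compatible, then there does not exist such a polynomial $\mathbf{K}$.
   Context: $\mathbb{H}_{m,d}$ is the space of real homogeneous polynomials of degree $m$ in $d$ variables (including $0$), and $\mathbb{P}_{m-1,d}$ the space of real polynomials of total degree at most $m-1$ in $d$ variables. For a nondegenerate $d$-dimensional simplex $T\subset\mathbb{R}^d$ of volume $|T|$, $I_{m,T}:C^0(T)\to\mathbb{P}_{m-1,d}$ is the Lagrange interpolation operator: $I_{m,T}v(\gamma)=v(\gamma)$ for all $\gamma\in T$ whose barycentric coordinates all belong to $\{0,\frac1{m-1},\frac2{m-1},\dots,1\}$. The shape function is $$K_{m,d}(\pi):=\inf_{|T|=1}\|\pi-I_{m,T}\pi\|_{L^\infty(T)},\quad\pi\in\mathbb{H}_{m,d},$$ the infimum being over all $d$-dimensional simplices of volume $1$. A polynomial on $\mathbb{H}_{m,d}$ is a real-valued function which is a real polynomial in the coefficients of $\pi\in\mathbb{H}_{m,d}$; its degree is the degree of that polynomial. That the $r$-th root is well defined (i.e. $r\geq 1$ and $\mathbf{K}\ge0$) is part of the assertion. The pair $(m,d)$ is called compatible if the following holds: for every $\pi\in\mathbb{H}_{m,d}$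 such that there exists a sequence $(\phi_n)_{n\ge0}$ of $d\times d$ matrices with complex coefficients with $\det\phi_n=1$ and $\lim_{n\to\infty}\pi\circ\phi_n=0$, there also exists a sequence $(\psi_n)$ of $d\times d$ matrices with real coefficients with $\det\psi_n=1$ and $\lim_{n\to\infty}\pi\circ\psi_n=0$. (Convergence is in the finite-dimensional space of polynomials, i.e. coefficientwise.) *)

(* Defs.v *)
From HB Require Import structures.
From mathcomp Require Import all_boot all_order all_algebra.
(* mpoly must be imported before topology: in the other order their notation
   levels clash. *)
From mathcomp Require Import mpoly complex.
From mathcomp Require Import boolp classical_sets reals topology normedtype.
From mathcomp Require Import sequences exp.

Set Implicit Arguments.
Unset Strict Implicit.
Unset Printing Implicit Defensive.

Import Order.TTheory GRing.Theory Num.Theory.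
Import numFieldNormedType.Exports.

Local Open Scope classical_set_scope.
Local Open Scope ring_scope.

Section ShapeFunction.
Context {R : realType} {d : nat}.
Implicit Types (T : 'I_d.+1 -> 'rV[R]_d) (* the vertices of a simplex *)
  (v : 'rV[R]_d -> R) (q : {mpoly R[d]}).

Definition peval q (x : 'rV[R]_d) : R := q.@[fun i => x ord0 i].

Definition simplex_volume T : R :=
  `|\det (\matrix_(i < d) (T (lift ord0 i) - T ord0))| / d`!%:R.

Definition barycentric T (l : 'I_d.+1 -> R) (x : 'rV[R]_d) : Prop :=
  \sum_i l i = 1 /\ x = \sum_i l i *: T i.

Definition simplex_set T : set 'rV[R]_d :=
  [set x | exists2 l, barycentric T l x & forall i, 0 <= l i].

Definition lagrange_nodes (m : nat) T : set 'rV[R]_d :=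
  [set x | exists2 l, barycentric T l x &
     forall i, exists2 k : nat, (k <= m.-1)%N & l i = k%:R / m.-1%:R].

(* [msize q] is the total degree of q plus one, and 0 for q = 0. *)
Definition is_interpolant (m : nat) T v q : Prop :=
  (msize q <= m)%N /\ forall x, lagrange_nodes m T x -> peval q x = v x.

(* For a nondegenerate T and m >= 2 the interpolant exists and is unique, so
   that the default value 0 is not used. *)
Definition lagrange_interp (m : nat) T v : {mpoly R[d]} :=
  xget 0 [set q | is_interpolant m T v q].

(* For a continuous function on a nondegenerate simplex, the essential supremum
   of the absolute value is its (finite) supremum. *)
Definition Linfty_norm (S : set 'rV[R]_d) v : R := sup [set `|v x| | x in S].

Definition interp_error (m : nat) T v : R :=
  Linfty_norm (simplex_set T)
    (fun x => v x - peval (lagrange_interp m T v) x).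

(* [dhomog d R m] is the space of forms of degree m in d variables. *)
Definition shape_function (m : nat) (p : dhomog d R m) : R :=
  inf [set interp_error m T (peval p) | T in [set T | simplex_volume T = 1]].

End ShapeFunction.

Section PolynomialsOnForms.
Context {R : realType} {m d : nat}.

Definition exponent : finType := {a : 'X_{1..d < m.+1} | mdeg a == m}.

(* Polynomials in the coefficients of a form: one indeterminate for each
   exponent of total degree m. *)
Definition form_poly : Type := {mpoly R[#|exponent|]}.

Definition form_eval (K : form_poly) (p : dhomog d R m) : R :=
  K.@[fun k => p@_(val (val (enum_val k)))].

Definition form_degree (K : form_poly) : nat := (msize K).-1.

Definition equivalent_to_shape (K : form_poly) : Prop :=
  let r := form_degree K in
  [/\ (1 <= r)%N,
      forall p, 0 <= form_eval K p &
      exists2 C : R, 0 < C & forall p : dhomog d R m,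
        C^-1 * form_eval K p `^ r%:R^-1 <= shape_function p /\
        shape_function p <= C * form_eval K p `^ r%:R^-1].

End PolynomialsOnForms.
Arguments form_poly : clear implicits.

Section Compatibility.

(* (p o phi)(z) = p (phi z), z being a column vector. *)
Definition comp_linear (F : numFieldType) (d : nat)
    (p : {mpoly F[d]}) (phi : 'M[F]_d) : {mpoly F[d]} :=
  p \mPo [tuple \sum_j phi i j *: 'X_j | i < d].

Definition cvg_to_zero (F : numFieldType) (d : nat)
    (p : nat -> {mpoly F[d]}) : Prop :=
  forall a : 'X_{1..d}, (p n)@_a @[n --> \oo] --> (0 : F).

Definition sl_degenerates (F : numFieldType) (d : nat) (p : {mpoly F[d]}) :=
  exists2 phi : nat -> 'M[F]_d,
    forall n, \det (phi n) = 1 & cvg_to_zero (fun n => comp_linear p (phi n)).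

Definition compatible (R : realType) (m d : nat) : Prop :=
  forall p : dhomog d R m,
    sl_degenerates (map_mpoly (real_complex R) p : {mpoly R[i][d]}) ->
    sl_degenerates (p : {mpoly R[d]}).

End Compatibility.

(* Main.v *)
(** Interpolation commutes with affine maps, so [K_{m,d}] is comparable to the
    infimum [N] of a norm of the coefficients over the orbit of a form under
    SL_d(R), and a continuous SL_d(R)-invariant homogeneous K comparable to [N]
    is determined by its values on forms with [N = 1].

    If (m,d) is compatible, each form [p] with [N p > 0] fails to degenerate
    over C, and some homogeneous SL_d(C)-invariant does not vanish at [p].  To
    see this, take a unit vector [v] of minimal norm in the limit of the orbit
    of [p], and let [z k = <k v, v>] on SU(d).  If all invariants of positive
    degree vanish at [v], then the averages of [z ^ n] over [k = l^-1 k'], with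
    [k'], [l] in suitable finite subsets of SU(d), are arbitrarily small.  The
    averages of [|z| ^ 2j] are however at least [(j + 1) ^ -D], as the vectors
    [k v] live in dimension [D].  Where [|z| = 1], [z] is a root of unity of
    bounded order q; since [v] is minimal, the moment map vanishes at [v], so
    that close to such points [z ^ q] is positive up to an error negligible
    against [1 - |z|].  Averages of [z ^ n] and of [|z| ^ n] are thus close when q
    divides n, a contradiction.  By compactness finitely many invariants suffice,
    and K is the sum of their even powers of a common degree.

    Conversely, if K is comparable to [K_{m,d}], it is bounded on the orbits of
    SL_d(R), hence constant along each transvection subgroup, and therefore, as a
    polynomial identity, invariant under SL_d(C).  It then vanishes at the forms
    that degenerate over C, and these degenerate over R because [N] vanishes. *)

Require Import Defs.
From mathcomp Require Import all_boot all_order all_algebra.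
From mathcomp Require Import mpoly complex polyrcf finmap.
From mathcomp Require Import boolp classical_sets reals topology normedtype.
From mathcomp Require Import sequences exp derive trigo.
From mathcomp Require Import lra ring.

Set Implicit Arguments.
Unset Strict Implicit.
Unset Printing Implicit Defensive.

Import Order.TTheory GRing.Theory Num.Theory.
Import numFieldNormedType.Exports.
Local Open Scope ring_scope.
Local Open Scope sesquilinear_scope.

(** * Tensor powers and the unitary trick *)

Section TensorPower.
Context {F : comNzRingType}.
Implicit Types (X : finType).

(** Symmetric tensors replace forms because their Euclidean norm is invariant under unitary
    matrices, which the norm of the coefficients of a form is not. An invariant of degree N is a
    fixed vector [u] in the N-th tensor power of the space of tensors, evaluated at [t] as
    [inner (tpow t) u]. Finite averages can be made small only for finitely many exponents at once.
    The exponents [q * 2 ^ j] therefore run over a range whose length is known before the finite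
    subset of SU(d) is chosen. In the long run the rank bound lets the moments of [|z|] fall by no
    more than about [2 ^ -D] at each doubling, whereas cancellation in the powers of [z] would make
    them fall by [2 ^ -(D + 1)]. No Haar integral and no finite generation of the invariants enters.
    A form with positive orbit norm has to be known too, since otherwise K might be zero and its
    degree wrong. The Fermat form serves, its tensor being of minimal norm in its orbit by a
    converse of the moment condition. *)

Definition act X (A : X -> X -> F) (x : X -> F) : X -> F :=
  fun i => \sum_j A i j * x j.

Definition kmul X (A B : X -> X -> F) : X -> X -> F :=
  fun i k => \sum_j A i j * B j k.

Definition kid X : X -> X -> F := fun i j => (i == j)%:R.

(** Indices range over arbitrary finite types, so that the power can be taken twice: tensors of
    order m are indexed by functions into ['I_d], and their N-th tensor power by functions into
    those functions. *)
Definition kron N X (A : X -> X -> F) (I J : {ffun 'I_N -> X}) : F :=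
  \prod_k A (I k) (J k).

Definition tpow N X (x : X -> F) (I : {ffun 'I_N -> X}) : F := \prod_k x (I k).

Lemma act_kmul X (A B : X -> X -> F) x : act (kmul A B) x = act A (act B x).
Proof.
apply/funext => i; rewrite /act /kmul.
under eq_bigr do rewrite mulr_suml.
rewrite exchange_big /=; apply: eq_bigr => j _.
by rewrite mulr_sumr; apply: eq_bigr => k _; rewrite mulrA.
Qed.

Lemma act_kid X (x : X -> F) : act (@kid X) x = x.
Proof.
apply/funext => i; rewrite /act /kid (bigD1 i) //= eqxx mul1r big1 ?addr0 //.
by move=> j /negPf ji; rewrite eq_sym ji mul0r.
Qed.

Lemma kron_kmul N X (A B : X -> X -> F) :
  kron (N:=N) (kmul A B) = kmul (kron A) (kron B).
Proof.
apply/funext => I; apply/funext => J; rewrite /kron /kmul bigA_distr_bigA /=.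
by apply: eq_bigr => f _; rewrite big_split.
Qed.

Lemma prod_eq_ffun N X (I J : {ffun 'I_N -> X}) :
  \prod_k ((I k == J k)%:R : F) = (I == J)%:R.
Proof.
have [->|neq] := eqVneq I J; first by rewrite big1 // => k _; rewrite eqxx.
have [k Ik] : exists k, I k != J k.
  apply/existsP; rewrite -negb_forall; apply: contra neq => /forallP h.
  by apply/eqP/ffunP => k; apply/eqP.
by rewrite (bigD1 k) //= (negPf Ik) mul0r.
Qed.

Lemma kron_kid N X : kron (N:=N) (@kid X) = @kid _.
Proof. by apply/funext => I; apply/funext => J; rewrite /kron prod_eq_ffun. Qed.

Lemma act_kron_tpow N X (A : X -> X -> F) x :
  act (kron (N:=N) A) (tpow x) = tpow (act A x).
Proof.
apply/funext => I; rewrite /act /kron /tpow bigA_distr_bigA /=.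
by apply: eq_bigr => f _; rewrite big_split.
Qed.

Lemma kmul_mx d (a b : 'M[F]_d) : kmul a b = (a *m b)%R.
Proof. by apply/funext => i; apply/funext => j; rewrite /kmul mxE. Qed.

Lemma kid_mx d : @kid 'I_d = (1%:M : 'M[F]_d).
Proof. by apply/funext => i; apply/funext => j; rewrite /kid mxE. Qed.

Definition tens m d (a : 'M[F]_d) := kron (N:=m) a.

Lemma tensM m d (a b : 'M[F]_d) : tens (m:=m) (a *m b) = kmul (tens a) (tens b).
Proof. by rewrite /tens -kmul_mx kron_kmul. Qed.

Lemma tens1 m d : tens (m:=m) (1%:M : 'M[F]_d) = @kid _.
Proof. by rewrite /tens -kid_mx kron_kid. Qed.

Lemma tens_diag m d (s : 'rV[F]_d) I J :
  tens (m:=m) (diag_mx s) I J = (I == J)%:R * \prod_k s ord0 (I k).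
Proof.
rewrite /tens /kron; under eq_bigr do rewrite mxE -mulr_natl.
by rewrite big_split /= prod_eq_ffun.
Qed.

Definition tens2 N m d (a : 'M[F]_d) := kron (N:=N) (tens (m:=m) a).

Lemma tens2M N m d (a b : 'M[F]_d) :
  tens2 (N:=N) (m:=m) (a *m b) = kmul (tens2 a) (tens2 b).
Proof. by rewrite /tens2 tensM kron_kmul. Qed.

Lemma tens2_1 N m d : tens2 (N:=N) (m:=m) (1%:M : 'M[F]_d) = @kid _.
Proof. by rewrite /tens2 tens1 kron_kid. Qed.

Lemma tens2_diag N m d (s : 'rV[F]_d) I J :
  tens2 (N:=N) (m:=m) (diag_mx s) I J =
  (I == J)%:R * \prod_k \prod_l s ord0 (I k l).
Proof.
rewrite /tens2 /kron; under eq_bigr do rewrite tens_diag.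
by rewrite big_split /= prod_eq_ffun.
Qed.

Lemma act_diag X (A : X -> X -> F) (c : X -> F) x :
  (forall I J, A I J = (I == J)%:R * c I) -> act A x = fun I => c I * x I.
Proof.
move=> h; apply/funext => I; rewrite /act (bigD1 I) //= h eqxx mul1r big1 ?addr0 //.
by move=> j /negPf ji; rewrite h eq_sym ji mul0r mul0r.
Qed.

End TensorPower.

(** * Hermitian inner products, polar decomposition, and fixed vectors of SU(d) *)

Section Hermitian.
Context {C : numClosedFieldType}.
Implicit Types (X : finType).

Definition inner X (x y : X -> C) : C := \sum_i x i * (y i)^*.

Definition kadj X (A : X -> X -> C) : X -> X -> C := fun i j => (A j i)^*.

Lemma inner_act X (A : X -> X -> C) x y : inner (act A x) y = inner x (act (kadj A) y).
Proof.
rewrite /inner /act /kadj; under eq_bigr do rewrite mulr_suml.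
rewrite exchange_big /=; apply: eq_bigr => j _.
rewrite rmorph_sum mulr_sumr; apply: eq_bigr => i _.
by rewrite rmorphM /= conjCK mulrCA mulrA.
Qed.

Lemma kadj_kron N X (A : X -> X -> C) : kadj (kron (N:=N) A) = kron (kadj A).
Proof. by apply/funext => I; apply/funext => J; rewrite /kadj /kron rmorph_prod. Qed.

Lemma kadj_mx d (a : 'M[C]_d) : kadj a = a^t*.
Proof. by apply/funext => i; apply/funext => j; rewrite /kadj !mxE. Qed.

Lemma kadj_tens m d (a : 'M[C]_d) : kadj (tens (m:=m) a) = tens (a^t*).
Proof. by rewrite /tens kadj_kron kadj_mx. Qed.

Lemma kadj_tens2 N m d (a : 'M[C]_d) :
  kadj (tens2 (N:=N) (m:=m) a) = tens2 (a^t*).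
Proof. by rewrite /tens2 kadj_kron kadj_tens. Qed.

Lemma inner_tpow N X (x y : X -> C) : inner (tpow (N:=N) x) (tpow y) = inner x y ^+ N.
Proof.
rewrite /inner /tpow -[in RHS](card_ord N) -prodr_const bigA_distr_bigA /=.
by apply: eq_bigr => f _; rewrite rmorph_prod big_split.
Qed.

Definition SU d : {pred 'M[C]_d} := [pred k | (k \is unitarymx) && (\det k == 1)].
Arguments SU d : clear implicits.

Lemma SU_mul d (a b : 'M[C]_d) : a \in SU d -> b \in SU d -> a *m b \in SU d.
Proof.
rewrite !inE => /andP[ua /eqP da] /andP[ub /eqP db].
by rewrite mul_unitarymx //= det_mulmx da db mulr1.
Qed.

Lemma det_adj d (a : 'M[C]_d) : \det (a^t*) = (\det a)^*.
Proof. by rewrite det_map_mx det_tr. Qed.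

Lemma SU_adj d (a : 'M[C]_d) : a \in SU d -> a^t* \in SU d.
Proof.
rewrite !inE trmxC_unitary => /andP[-> /eqP da].
by rewrite det_adj da rmorph1 eqxx.
Qed.

Lemma unitary_adjK d (a : 'M[C]_d) : a \is unitarymx -> a^t* *m a = 1%:M.
Proof. by move=> /unitarymxP h; apply: mulmx1C. Qed.

Lemma SU_conj_diag d (P : 'M[C]_d) (t : 'rV[C]_d) :
  P \is unitarymx -> (forall j, `|t ord0 j| = 1) -> \prod_j t ord0 j = 1 ->
  P^t* *m diag_mx t *m P \in SU d.
Proof.
move=> uP t1 pt; rewrite inE; apply/andP; split.
  rewrite !mul_unitarymx ?trmxC_unitary //.
  apply/unitarymxP/matrixP => i j.
  rewrite tr_diag_mx map_diag_mx mulmx_diag !mxE -normCK t1 expr1n.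
  by [].
rewrite !det_mulmx det_diag pt mulr1 -det_mulmx unitary_adjK //.
by rewrite det1.
Qed.

(** The positive factor is the square root of [g^t* *m g], taken on the eigenvalues; its determinant
    is positive with square 1, hence 1. *)
Lemma polar d (g : 'M[C]_d) : \det g = 1 ->
  exists k P, exists s : 'rV[C]_d,
    [/\ k \in SU d, P \is unitarymx, forall j, 0 < s ord0 j,
        \prod_j s ord0 j = 1 & g = k *m (P^t* *m diag_mx s *m P)].
Proof.
move=> dg; pose H := g^t* *m g.
have dH : \det H = 1 by rewrite det_mulmx det_adj dg rmorph1 mulr1.
have HH : H \is normalmx.
  apply/normalmxP; suff -> : H ^t* = H by [].
  by rewrite /H trmx_mul map_mxM /= trmxCK.
have /orthomx_spectralP := HH.
set P := spectralmx H; set D := spectral_diag H => HE.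
have uP : P \is unitarymx by exact: spectral_unitarymx.
rewrite invmx_unitary // in HE.
pose B := g *m P^t*.
have DE : diag_mx D = B^t* *m B.
  rewrite /B trmx_mul map_mxM /= trmxCK -mulmxA (mulmxA _ g) -/H HE.
  by rewrite !mulmxA (unitarymxP uP) mul1mx -mulmxA (unitarymxP uP) mulmx1.
have D0 j : 0 <= D ord0 j.
  have := congr1 (fun M : 'M_d => M j j) DE; rewrite !mxE eqxx mulr1n => ->.
  by apply: sumr_ge0 => i _; rewrite !mxE mulrC mul_conjC_ge0.
have pD : \prod_j D ord0 j = 1.
  rewrite -det_diag -[RHS]dH HE !det_mulmx mulrAC -det_mulmx unitary_adjK //.
  by rewrite det1 mul1r.
have D1 j : 0 < D ord0 j.
  rewrite lt_def D0 andbT; apply: contra_eq_neq pD => /= Dj.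
  by rewrite (bigD1 j) //= Dj mul0r eq_sym oner_eq0.
pose s : 'rV[C]_d := \row_j sqrtC (D ord0 j).
have s0 j : 0 < s ord0 j by rewrite mxE sqrtC_gt0.
have ps : \prod_j s ord0 j = 1.
  apply/eqP; rewrite -(@eqrXn2 _ 2) ?ler01 //; last first.
    by apply: prodr_ge0 => j _; apply: ltW.
  rewrite expr1n -prodrXl -[X in _ == X]pD; apply/eqP; apply: eq_bigr => j _.
  by rewrite mxE sqrtCK.
pose h := P^t* *m diag_mx s *m P.
pose h' := P^t* *m diag_mx (\row_j (s ord0 j)^-1) *m P.
have hh' : h *m h' = 1%:M.
  rewrite /h /h' !mulmxA -(mulmxA _ P) (unitarymxP uP) mulmx1.
  rewrite -(mulmxA _ (diag_mx s)) mulmx_diag.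
  have diag1 (v : 'rV[C]_d) : (forall j, v ord0 j = 1) -> diag_mx v = 1%:M.
    by move=> v1; apply/matrixP => i j; rewrite !mxE v1.
  rewrite diag1 ?mulmx1 ?unitary_adjK // => j.
  by rewrite !mxE mulfV // gt_eqF // sqrtC_gt0.
have h2 : h *m h = H.
  rewrite HE /h !mulmxA -(mulmxA _ P) (unitarymxP uP) mulmx1.
  rewrite -(mulmxA _ (diag_mx s) (diag_mx s)) mulmx_diag.
  congr (_ *m diag_mx _ *m _).
  by apply/rowP => j; rewrite !mxE -expr2 sqrtCK.
have hadj : h'^t* = h'.
  rewrite /h' !trmx_mul !map_mxM /= trmxCK mulmxA tr_diag_mx map_diag_mx.
  congr (_ *m diag_mx _ *m _).
  apply/rowP => j; rewrite !mxE; apply: CrealP.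
  by rewrite rpredV ger0_real // sqrtC_ge0.
have hh'2 := mulmx1C hh'.
have dh : \det h = 1.
  by rewrite !det_mulmx det_diag ps mulr1 -det_mulmx unitary_adjK // det1.
have dh' : \det h' = 1.
  by have := congr1 determinant hh'; rewrite det_mulmx dh mul1r det1.
exists (g *m h'), P, s; split=> //; last first.
  by rewrite -mulmxA -/h hh'2 mulmx1.
rewrite inE det_mulmx dg dh' mulr1 eqxx andbT -trmxC_unitary.
apply/unitarymxP; rewrite trmxCK trmx_mul map_mxM /= hadj.
by rewrite mulmxA -(mulmxA h') -/H -h2 mulmxA hh'2 mul1mx.
Qed.

Section SUfixed.
Variables (N m d : nat) (u : {ffun 'I_N -> {ffun 'I_m -> 'I_d}} -> C).
Hypothesis ufix : forall k, k \in SU d -> act (tens2 k) u = u.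

(** The basis vector [I] is a weight vector of the diagonal torus, and [wt I j] is the exponent of
    the j-th coordinate in its weight. *)
Let wt (I : {ffun 'I_N -> {ffun 'I_m -> 'I_d}}) (j : 'I_d) :=
  #|[set p : 'I_N * 'I_m | I p.1 p.2 == j]|.

Let chiE (s : 'rV[C]_d) (I : {ffun 'I_N -> {ffun 'I_m -> 'I_d}}) :
  \prod_k \prod_l s ord0 (I k l) = \prod_j s ord0 j ^+ wt I j.
Proof.
rewrite pair_big /= (partition_big (fun p : 'I_N * 'I_m => I p.1 p.2) xpredT) //=.
apply: eq_bigr => j _.
rewrite (eq_bigr (fun _ => s ord0 j)); last by move=> p /eqP ->.
by rewrite prodr_const; congr (_ ^+ _); apply: eq_card => p; rewrite !inE.
Qed.

(* Weyl's unitary trick, by the polar decomposition: a weight of the diagonal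
   torus trivial on SU(d) is a power of the determinant. *)
Lemma SU_fixed_SL_fixed g : \det g = 1 -> act (tens2 g) u = u.
Proof.
move=> /polar [k [P [s [kSU uP s0 ps ->]]]].
rewrite tens2M act_kmul.
suff -> : act (tens2 (P^t* *m diag_mx s *m P)) u = u by exact: ufix.
have conjD t : act (tens2 (P^t* *m diag_mx t *m P)) u =
    act (tens2 (P^t* )) (fun I => (\prod_j t ord0 j ^+ wt I j) * act (tens2 P) u I).
  rewrite !tens2M !act_kmul; congr act.
  under eq_fun do rewrite -chiE.
  by apply: act_diag => I J; exact: tens2_diag.
have PK : act (tens2 (P^t* )) (act (tens2 P) u) = u.
  by rewrite -act_kmul -tens2M unitary_adjK // tens2_1 act_kid.
have PK' x : act (tens2 P) (act (tens2 (P^t* )) x) = x :> ({ffun 'I_N -> {ffun 'I_m -> 'I_d}} -> C).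
  by rewrite -act_kmul -tens2M (unitarymxP uP) tens2_1 act_kid.
rewrite conjD -[RHS]PK; congr act; apply/funext => I.
have [->|uI] := eqVneq (act (tens2 P) u I) 0; first by rewrite mulr0.
rewrite -[RHS]mul1r; congr (_ * _).
have tor (t : 'rV[C]_d) : (forall j, `|t ord0 j| = 1) -> \prod_j t ord0 j = 1 ->
    \prod_j t ord0 j ^+ wt I j = 1.
  move=> t1 pt; have := ufix (SU_conj_diag uP t1 pt); rewrite conjD.
  move=> /(congr1 (act (tens2 P))); rewrite PK' => /(congr1 (fun f => f I)) /=.
  by rewrite -[RHS]mul1r => /(mulIf uI).
suff wtE i j : (wt I i <= wt I j)%N.
  case: (pickP 'I_d) => [i0 _|no]; last by rewrite big_pred0.
  rewrite (eq_bigr (fun j => s ord0 j ^+ wt I i0)); last first.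
    by move=> j _; congr (_ ^+ _); apply/eqP; rewrite eqn_leq !wtE.
  by rewrite prodrXl ps expr1n.
rewrite leqNgt; apply/negP => lt_ji.
have neq : i != j by apply: contraL lt_ji => /eqP ->; rewrite ltnn.
have n0 : (0 < wt I i - wt I j)%N by rewrite subn_gt0.
(* The torus element [t] below has entries [z] and [z^-1] at [i] and [j]. Its value under the weight
   is [z ^+ (wt I i - wt I j) = -1], contrary to [tor]. *)
pose z := (wt I i - wt I j).-root (-1 : C).
have zE : z ^+ (wt I i - wt I j) = -1 by rewrite rootCK.
have z1 : `|z| = 1.
  apply/eqP; rewrite -(@pexpr_eq1 _ _ _ n0) //.
  by rewrite -normrX zE normrN1.
have zn0 : z != 0 by rewrite -normr_gt0 z1 ltr01.
pose t : 'rV[C]_d := \row_l (if l == i then z else if l == j then z^-1 else 1).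
have tp (e : 'I_d -> nat) : \prod_l t ord0 l ^+ e l = z ^+ e i * z^-1 ^+ e j.
  rewrite (bigD1 i) //= (bigD1 j) 1?eq_sym //= !mxE eqxx eq_sym (negPf neq) eqxx.
  rewrite big1 ?mulr1 // => l /andP[/negPf li /negPf lj].
  by rewrite mxE li lj expr1n.
have t1 l : `|t ord0 l| = 1.
  by rewrite mxE; case: ifP => // _; case: ifP => // _; rewrite ?normfV ?z1 ?invr1 ?normr1.
have pt : \prod_l t ord0 l = 1.
  by have := tp (fun=> 1%N); under eq_bigr do rewrite expr1; rewrite !expr1 mulfV.
have := tor t t1 pt; rewrite tp -(subnK (ltnW lt_ji)) exprD zE.
rewrite -mulrA exprVn mulfV ?expf_neq0 // mulr1 => /eqP.
by rewrite -subr_eq0 -opprD oppr_eq0 (_ : 1 + 1 = 2%:R) // pnatr_eq0.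
Qed.

End SUfixed.
End Hermitian.
Arguments SU {C} d _ : assert.

(** * Minimal vectors *)

Section Limits.
Context {F : numFieldType}.
Implicit Types (u v : nat -> F) (l : F).

(** An explicit threshold serves real and complex sequences alike; [cvgsP] gives the filter form. *)
Definition cvgs u l :=
  forall e : F, 0 < e -> exists N, forall n, (N <= n)%N -> `|u n - l| < e.

Lemma cvgsP u l : cvgs u l <-> (u n @[n --> \oo] --> l)%classic.
Proof.
split=> [h|/cvgrPdist_lt h e e0].
  apply/cvgrPdist_lt => e /h [N hN]; exists N => // n /= /hN.
  by rewrite distrC.
have [N _ hN] := h e e0; exists N => n /hN /=.
by rewrite distrC.
Qed.

Lemma cvgs_cst l : cvgs (fun=> l) l.
Proof. by move=> e e0; exists 0 => n _; rewrite subrr normr0. Qed.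

Lemma cvgsD u v a b : cvgs u a -> cvgs v b -> cvgs (fun n => u n + v n) (a + b).
Proof. by move=> /cvgsP ua /cvgsP vb; apply/cvgsP; exact: cvgD. Qed.

Lemma cvgsM u v a b : cvgs u a -> cvgs v b -> cvgs (fun n => u n * v n) (a * b).
Proof. by move=> /cvgsP ua /cvgsP vb; apply/cvgsP; exact: cvgM. Qed.

Lemma cvgs_sum I (r : seq I) (f : I -> nat -> F) (a : I -> F) :
  (forall i, cvgs (f i) (a i)) ->
  cvgs (fun n => \sum_(i <- r) f i n) (\sum_(i <- r) a i).
Proof.
move=> h; elim: r => [|i r IH].
  rewrite big_nil (_ : (fun _ => _) = fun=> 0); first exact: cvgs_cst.
  by apply/funext => n; rewrite big_nil.
rewrite big_cons (_ : (fun _ => _) = fun n => f i n + \sum_(j <- r) f j n).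
  exact: cvgsD.
by apply/funext => n; rewrite big_cons.
Qed.

Lemma cvgs_prod I (r : seq I) (f : I -> nat -> F) (a : I -> F) :
  (forall i, cvgs (f i) (a i)) ->
  cvgs (fun n => \prod_(i <- r) f i n) (\prod_(i <- r) a i).
Proof.
move=> h; elim: r => [|i r IH].
  rewrite big_nil (_ : (fun _ => _) = fun=> 1); first exact: cvgs_cst.
  by apply/funext => n; rewrite big_nil.
rewrite big_cons (_ : (fun _ => _) = fun n => f i n * \prod_(j <- r) f j n).
  exact: cvgsM.
by apply/funext => n; rewrite big_cons.
Qed.

Lemma cvgs_unique u a b : cvgs u a -> cvgs u b -> a = b.
Proof. by move=> /cvgsP ua /cvgsP vb; apply: (cvg_unique _ ua vb). Qed.

Lemma cvgs_sub u a (s : nat -> nat) : (forall n, (n <= s n)%N) ->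
  cvgs u a -> cvgs (fun n => u (s n)) a.
Proof.
move=> hs h e /h [N hN]; exists N => n nN; apply: hN.
exact: leq_trans nN (hs n).
Qed.

Lemma cvgs_act (X : finType) (A : nat -> X -> X -> F) (x : nat -> X -> F) B y :
  (forall i j, cvgs (fun n => A n i j) (B i j)) ->
  (forall i, cvgs (x ^~ i) (y i)) ->
  forall i, cvgs (fun n => act (A n) (x n) i) (act B y i).
Proof. by move=> hA hx i; apply: cvgs_sum => j; apply: cvgsM. Qed.

End Limits.

Section RealLimits.
Context {R : realType}.

Lemma cvgs_ge (u : nat -> R) l b : cvgs u l -> (forall n, b <= u n) -> b <= l.
Proof.
move=> h ub; rewrite leNgt; apply/negP => lb.
have [N /(_ N (leqnn _))] := h (b - l) ltac:(by rewrite subr_gt0).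
have := ub N; rewrite ltr_norml => h1 /andP[_]; lra.
Qed.

Lemma cvgs_inv (c : R) : cvgs (fun n => c / n.+1%:R) 0.
Proof.
apply/cvgsP; rewrite -(mulr0 c); apply: cvgM; first exact: cvg_cst.
exact: cvg_harmonic.
Qed.

Lemma inv_small (e : R) : 0 < e -> exists n : nat, n.+1%:R^-1 < e.
Proof.
move=> /(cvgs_inv 1) [N /(_ N (leqnn _))].
rewrite subr0 mul1r ger0_norm ?invr_ge0 // => h; by exists N.
Qed.

(** Of the selected indices only [n <= s n] is required, not monotonicity: this is all that passing
    to limits along [s] uses. *)
Lemma compact_seq (X : finType) (u : nat -> X -> R) (B : R) :
  (forall n x, `|u n x| <= B) ->
  exists2 s : nat -> nat, (forall n, (n <= s n)%N) &
  exists l : X -> R, forall x, cvgs (fun n => u (s n) x) (l x).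
Proof.
move=> ub.
pose U n : 'rV[R]_#|X| := \row_i u n (enum_val i).
have cA := @rV_compact R #|X| (fun=> `[- B, B]%classic)
  (fun _ => @segment_compact _ _ _).
have FA : (U n @[n --> \oo])%classic
    [set v : 'rV[R]_#|X| | forall i, `[- B, B]%classic (v ord0 i)]%classic.
  exists 0 => // n _ i /=; rewrite mxE in_itv /=.
  by rewrite -ler_norml.
have [l [_ cl]] := cA _ _ FA.
have hs n : {k | (n <= k)%N /\ forall x, `|u k x - l ord0 (enum_rank x)| < n.+1%:R^-1}.
  apply: cid.
  have e0 : (0 : R) < n.+1%:R^-1 by rewrite invr_gt0.
  have FU : (U n @[n --> \oo])%classic [set U k | k in [set k | (n <= k)%N]]%classic.
    by exists n => // k /= nk; exists k.
  have [_ [[k /= nk <-] hk]] := cl _ _ FU (nbhsx_ballx l _ e0).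
  exists k; split=> // x.
  by have := hk.2 ord0 (enum_rank x); rewrite mxE enum_rankK distrC.
exists (fun n => sval (hs n)).
  by move=> n; have [] := svalP (hs n).
exists (fun x => l ord0 (enum_rank x)) => x e /inv_small [N hN]; exists N => n Nn.
have [_ /(_ x)] := svalP (hs n); move/lt_le_trans; apply.
apply: le_trans (ltW hN).
by rewrite lef_pV2 ?posrE ?ler_nat ?ltr0n.
Qed.

End RealLimits.

Section Complex.
Context {R : realType}.
Local Notation C := R[i].
Local Notation normc := Normc.normc.
Local Open Scope complex_scope.
Implicit Types (z : C) (X : finType).

Lemma normcE z : `|z| = (normc z)%:C. Proof. by []. Qed.

Lemma normc_ge0 z : 0 <= normc z.
Proof. by case: z => a b; exact: sqrtr_ge0. Qed.

Lemma normcX z n : normc (z ^+ n) = normc z ^+ n.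
Proof. by apply: complexI; rewrite -normcE normrX normcE rmorphXn. Qed.

Lemma normcJ z : normc (Num.conj z) = normc z.
Proof. by apply: complexI; rewrite -!normcE norm_conjC. Qed.

Lemma normc_real (x : R) : normc x%:C = `|x|.
Proof. by rewrite /normc /= expr0n /= addr0 sqrtr_sqr. Qed.

Lemma normc_Re z : `|complex.Re z| <= normc z.
Proof. by have := normc_ge_Re z; rewrite normcE lecR. Qed.

Lemma normc_Im z : `|complex.Im z| <= normc z.
Proof.
case: z => a b; rewrite /normc /= -[X in X <= _]sqrtr_sqr ler_wsqrtr //.
by rewrite lerDr sqr_ge0.
Qed.

Lemma normc_le z : normc z <= `|complex.Re z| + `|complex.Im z|.
Proof.
case: z => a b /=.
rewrite -(@ler_pXn2r _ 2) ?nnegrE ?sqrtr_ge0 ?addr_ge0 //.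
rewrite sqr_sqrtr ?addr_ge0 ?sqr_ge0 // sqrrD !real_normK ?num_real //.
rewrite addrAC lerDl mulrn_wge0 ?mulr_ge0 //.
Qed.

Lemma normc_sqr z : (normc z ^+ 2)%:C = z * Num.conj z.
Proof. by rewrite rmorphXn /= -normcE normCK. Qed.

Lemma cvgscP (u : nat -> C) l : cvgs u l <-> cvgs (fun n => normc (u n - l)) 0.
Proof.
split=> h e e0.
  have [|N hN] := h e%:C; first by rewrite ltcR.
  exists N => n /hN; rewrite normcE ltcR subr0 ger0_norm ?normc_ge0 //.
have eE : e = (complex.Re e)%:C by rewrite RRe_real // ger0_real // ltW.
have [|N hN] := h (complex.Re e); first by rewrite -ltcR -eE.
by exists N => n /hN; rewrite eE normcE ltcR subr0 ger0_norm ?normc_ge0.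
Qed.

Lemma cvgsc (u : nat -> C) (v : nat -> R) l :
  (forall n, normc (u n - l) <= v n) -> cvgs v 0 -> cvgs u l.
Proof.
move=> h hv; apply/cvgscP => e /hv [N hN]; exists N => n /hN.
rewrite !subr0 (ger0_norm (normc_ge0 _)) ltr_norml => /andP[_].
exact: le_lt_trans.
Qed.

Lemma cvgs_conj (u : nat -> C) l : cvgs u l -> cvgs (fun n => Num.conj (u n)) (Num.conj l).
Proof.
move=> /cvgscP h; apply: cvgsc h => n.
by rewrite -rmorphB normcJ.
Qed.

Lemma cvgs_dist (u : nat -> C) (v : nat -> R) l m :
  (forall n, `|v n - m| <= normc (u n - l)) -> cvgs u l -> cvgs v m.
Proof.
move=> h /cvgscP hv e /hv [N hN]; exists N => n /hN.
rewrite subr0 ger0_norm ?normc_ge0 //; exact: le_lt_trans.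
Qed.

Lemma cvgs_normc (u : nat -> C) l : cvgs u l -> cvgs (fun n => normc (u n)) (normc l).
Proof.
apply: cvgs_dist => n.
have := le_normcD (u n - l) l; have := le_normcD (l - u n) (u n).
rewrite !subrK -[normc (l - _)]normcN opprB ler_norml; lra.
Qed.

Lemma compact_seqc (X : finType) (u : nat -> X -> C) (B : R) :
  (forall n x, normc (u n x) <= B) ->
  exists2 s : nat -> nat, (forall n, (n <= s n)%N) &
  exists l : X -> C, forall x, cvgs (fun n => u (s n) x) (l x).
Proof.
move=> ub.
pose w n (p : X * bool) := if p.2 then complex.Re (u n p.1) else complex.Im (u n p.1).
have wb n p : `|w n p| <= B.
  apply: le_trans (ub n p.1); rewrite /w; case: ifP => _.
    exact: normc_Re.
  exact: normc_Im.
have [s sn [l hl]] := compact_seq wb.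
exists s => //; exists (fun x => l (x, true) +i* l (x, false)) => x.
have hc : cvgs (fun n => `|w (s n) (x, true) - l (x, true)| +
   `|w (s n) (x, false) - l (x, false)|) 0.
  have c b : cvgs (fun n => `|w (s n) (x, b) - l (x, b)|) 0.
    by move=> e /(hl (x, b)) [N hN]; exists N => n /hN; rewrite subr0 normr_id.
  by have := cvgsD (c true) (c false); rewrite addr0.
apply: cvgsc hc => n; apply: le_trans (normc_le _) _; rewrite /w /=.
by case: (u (s n) x).
Qed.

Definition sqnorm (X : finType) (x : X -> C) : R := \sum_i normc (x i) ^+ 2.

Lemma sqnormE X (x : X -> C) : (@sqnorm X x)%:C = inner x x.
Proof. by rewrite /sqnorm /inner rmorph_sum; apply: eq_bigr => i _; exact: normc_sqr. Qed.

Lemma sqnorm_ge0 X (x : X -> C) : 0 <= @sqnorm X x.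
Proof. by apply: sumr_ge0 => i _; rewrite exprn_ge0 // normc_ge0. Qed.

Lemma sqnorm_coord X (x : X -> C) i : normc (x i) ^+ 2 <= @sqnorm X x.
Proof.
rewrite /sqnorm (bigD1 i) //= lerDl; apply: sumr_ge0 => j _.
by rewrite exprn_ge0 // normc_ge0.
Qed.

Lemma sqnorm_eq0 X (x : X -> C) : @sqnorm X x = 0 -> x = fun=> 0.
Proof.
move=> h; apply/funext => i; apply: Normc.eq0_normc.
have := sqnorm_coord x i; rewrite h => h1; apply/eqP.
by rewrite -sqrf_eq0 eq_le h1 exprn_ge0 ?normc_ge0.
Qed.

(** By [a <= a ^+ 2 + 1]; the bound only serves to extract convergent subsequences. *)
Lemma sqnorm_bound X (x : X -> C) (b : R) i : @sqnorm X x <= b -> normc (x i) <= b + 1.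
Proof.
move=> h; have := le_trans (sqnorm_coord x i) h; have := normc_ge0 (x i).
set a := normc _; nra.
Qed.

Lemma cvgs_sqnorm X (x : nat -> X -> C) l : (forall i, cvgs (x ^~ i) (l i)) ->
  cvgs (fun n => @sqnorm X (x n)) (sqnorm l).
Proof. by move=> h; apply: cvgs_sum => i; apply: cvgsM; apply: cvgs_normc. Qed.

Lemma cvgs_inner (X : finType) (x y : nat -> X -> C) l k :
  (forall i, cvgs (x ^~ i) (l i)) -> (forall i, cvgs (y ^~ i) (k i)) ->
  cvgs (fun n => inner (x n) (y n)) (inner l k).
Proof. by move=> hx hy; apply: cvgs_sum => i; apply: cvgsM => //; apply: cvgs_conj. Qed.

Lemma sqnorm_SU N m d (k : 'M[C]_d) x : k \in SU d ->
  sqnorm (act (tens2 (N:=N) (m:=m) k) x) = sqnorm x.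
Proof.
rewrite inE => /andP[uk _]; apply: complexI; rewrite !sqnormE inner_act kadj_tens2.
by rewrite -act_kmul -tens2M unitary_adjK // tens2_1 act_kid.
Qed.

(* The minimal vectors of Kempf and Ness. *)
Lemma minimal_vector m d (t : {ffun 'I_m -> 'I_d} -> C) (e : R) : 0 < e ->
  (forall g : 'M[C]_d, \det g = 1 -> e <= sqnorm (act (tens g) t)) ->
  exists v, exists g : nat -> 'M[C]_d,
    [/\ forall n, \det (g n) = 1,
        forall I, cvgs (fun n => act (tens (g n)) t I) (v I),
        0 < sqnorm v &
        forall h : 'M[C]_d, \det h = 1 -> sqnorm v <= sqnorm (act (tens h) v)].
Proof.
move=> e0 te.
pose S := [set sqnorm (act (tens g) t) | g in [set g : 'M[C]_d | \det g = 1]]%classic.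
have Sne : (S !=set0)%classic.
  by exists (sqnorm (act (tens 1%:M) t)), 1%:M => //=; rewrite det1.
have Slb : lbound S e by move=> _ [g /= dg <-]; exact: te.
have Si : has_inf S by split=> //; exists e.
have iS g : \det g = 1 -> inf S <= sqnorm (act (tens g) t).
  by move=> dg; apply: ge_inf; [exists e | exists g].
have hg n : {g : 'M[C]_d | \det g = 1 /\ sqnorm (act (tens g) t) < inf S + n.+1%:R^-1}.
  apply: cid; have [|_ [g /= dg <-] lt] := @inf_adherent _ S n.+1%:R^-1 _ Si; first by rewrite invr_gt0.
  by exists g.
pose g n := sval (hg n).
have dg n : \det (g n) = 1 by case: (svalP (hg n)).
have gl n : sqnorm (act (tens (g n)) t) < inf S + n.+1%:R^-1 by case: (svalP (hg n)).
have [|s sn [v hv]] := @compact_seqc _ (fun n => act (tens (g n)) t) (inf S + 1 + 1).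
  move=> n x; apply: sqnorm_bound; apply: le_trans (ltW (gl n)) _.
  by rewrite lerD2l invf_le1 // ler1n.
have nv : sqnorm v <= inf S.
  rewrite -[X in _ <= X]addr0.
  have c1 : cvgs (fun n => inf S + 1 / n.+1%:R) (inf S + 0).
    by apply: cvgsD; [exact: cvgs_cst | exact: cvgs_inv].
  have c2 := cvgs_sub sn c1; have c3 := cvgs_sqnorm hv.
  rewrite -subr_ge0; apply: (@cvgs_ge _ (fun n => (inf S + 1 / (s n).+1%:R) + (-1) * sqnorm (act (tens (g (s n))) t))).
    rewrite -(mulN1r (sqnorm v)); apply: cvgsD => //; apply: cvgsM => //; exact: cvgs_cst.
  by move=> n; rewrite mulN1r subr_ge0 div1r ltW.
(* [act (tens h) v] is again a limit of points of the orbit of [t]. *)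
have hmin h : \det h = 1 -> inf S <= sqnorm (act (tens h) v).
  move=> dh; apply: (@cvgs_ge _ (fun n => sqnorm (act (tens h) (act (tens (g (s n))) t)))).
    by apply: cvgs_sqnorm; apply: cvgs_act => // *; exact: cvgs_cst.
  by move=> n; rewrite -act_kmul -tensM; apply: iS; rewrite det_mulmx dh dg mulr1.
exists v, (g \o s); split=> //.
- by move=> n; exact: dg.
- apply: lt_le_trans e0 _; apply: le_trans (lb_le_inf Sne Slb) _.
  by have := hmin 1%:M (det1 _ _); rewrite tens1 act_kid.
- by move=> h dh; apply: le_trans nv (hmin h dh).
Qed.

End Complex.

(** * Averages over finite subsets of SU(d) *)

Section Averages.
Context {R : realType}.
Local Notation C := R[i].
Local Notation normc := Normc.normc.
Local Open Scope complex_scope.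
Implicit Types (X : finType).

Lemma normc2E (z : C) : normc z ^+ 2 = complex.Re z ^+ 2 + complex.Im z ^+ 2.
Proof. by case: z => a b; rewrite /normc sqr_sqrtr ?addr_ge0 ?sqr_ge0. Qed.

Lemma inner_sumr X I (r : seq I) (x : X -> C) (y : I -> X -> C) :
  inner x (fun i => \sum_(k <- r) y k i) = \sum_(k <- r) inner x (y k).
Proof.
rewrite /inner exchange_big /=; apply: eq_bigr => i _.
by rewrite rmorph_sum mulr_sumr.
Qed.

Lemma inner_suml X I (r : seq I) (x : I -> X -> C) (y : X -> C) :
  inner (fun i => \sum_(k <- r) x k i) y = \sum_(k <- r) inner (x k) y.
Proof.
rewrite /inner exchange_big /=; apply: eq_bigr => i _.
by rewrite mulr_suml.
Qed.

Lemma innerZl X c (x y : X -> C) : inner (fun i => c * x i) y = c * inner x y.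
Proof. by rewrite /inner mulr_sumr; apply: eq_bigr => i _; rewrite mulrA. Qed.

Lemma innerZr X c (x y : X -> C) : inner x (fun i => c * y i) = Num.conj c * inner x y.
Proof.
rewrite /inner mulr_sumr; apply: eq_bigr => i _.
by rewrite rmorphM /= mulrCA.
Qed.

Lemma sqnormZ X c (x : X -> C) : sqnorm (fun i => c * x i) = normc c ^+ 2 * sqnorm x.
Proof.
rewrite /sqnorm mulr_sumr; apply: eq_bigr => i _.
by rewrite Normc.normcM exprMn.
Qed.

Lemma parallelogram X (x y : X -> C) :
  sqnorm (fun i => x i - y i) + sqnorm (fun i => x i + y i) = 2 * sqnorm x + 2 * sqnorm y.
Proof.
rewrite /sqnorm !mulr_sumr -!big_split /=; apply: eq_bigr => i _.
by case: (x i) (y i) => [a b] [c e]; rewrite !normc2E /=; ring.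
Qed.

(** The difference of the two sides is the sum of the squared deviations from the mean [w]. *)
Lemma jensen_sqr I (r : seq I) (x : I -> R) (w : R) :
  (size r)%:R * w = \sum_(k <- r) x k ->
  (size r)%:R * w ^+ 2 <= \sum_(k <- r) x k ^+ 2.
Proof.
move=> h; rewrite -subr_ge0.
suff -> : \sum_(k <- r) x k ^+ 2 - (size r)%:R * w ^+ 2 =
    \sum_(k <- r) (x k - w) ^+ 2 by apply: sumr_ge0 => k _; exact: sqr_ge0.
rewrite [RHS](eq_bigr (fun k => x k ^+ 2 + (- (2 * w)) * x k + w ^+ 2)); last first.
  by move=> k _; ring.
rewrite !big_split /= -mulr_sumr -h big_const_seq count_predT iter_addr_0.
by rewrite -mulr_natl; ring.
Qed.

Lemma jensen_normc I (r : seq I) (x : I -> C) (w : C) :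
  (size r)%:R * w = \sum_(k <- r) x k ->
  (size r)%:R * normc w ^+ 2 <= \sum_(k <- r) normc (x k) ^+ 2.
Proof.
move=> h; under eq_bigr do rewrite normc2E.
have hn : (size r)%:R = ((size r)%:R : R)%:C :> C by rewrite rmorph_nat.
rewrite big_split normc2E mulrDr /=; apply: lerD; apply: jensen_sqr.
  rewrite -(raddf_sum (@complex.Re R)) -h hn.
  by case: w {h} => a b /=; rewrite mul0r subr0.
rewrite -(raddf_sum (@complex.Im R)) -h hn.
by case: w {h} => a b /=; rewrite mul0r addr0.
Qed.

Section Rep.
Variables (N m d : nat).
Local Notation V := ({ffun 'I_N -> {ffun 'I_m -> 'I_d}} -> C).
Implicit Types (x y u : V) (s : seq 'M[C]_d).

Definition average s x : V :=
  fun I => (size s)%:R^-1 * \sum_(k <- s) act (tens2 k) x I.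

Lemma act_average k s x :
  act (tens2 k) (average s x) = average [seq k *m l | l <- s] x.
Proof.
apply/funext => I; rewrite /average size_map big_map.
under [in RHS]eq_bigr => l _ do rewrite tens2M act_kmul.
transitivity ((size s)%:R^-1 *
    \sum_J \sum_(l <- s) tens2 k I J * act (tens2 l) x J); last first.
  by rewrite exchange_big.
rewrite mulr_sumr; apply: eq_bigr => J _.
by rewrite /average mulrCA mulr_sumr.
Qed.

Lemma average_cat s s' x : size s = size s' -> average (s ++ s') x =
  fun I => 2^-1 * (average s x I + average s' x I).
Proof.
move=> ss; apply/funext => I; rewrite /average size_cat big_cat /= -ss.
by rewrite -mulrDr mulrA -invfM -natrM mul2n addnn.
Qed.

Lemma average_allpairs s s' x :
  average [seq k *m l | k <- s, l <- s'] x = average s (average s' x).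
Proof.
apply/funext => I; rewrite {1 2}/average size_allpairs natrM invfM -mulrA.
congr (_ * _); rewrite big_allpairs_dep mulr_sumr /=; apply: eq_bigr => k _.
by rewrite act_average /average size_map big_map.
Qed.

Lemma sqnorm_average_le s x : (0 < size s)%N -> all (mem (SU d)) s ->
  sqnorm (average s x) <= sqnorm x.
Proof.
move=> s0 sSU; pose n := (size s)%:R : R.
have n0 : 0 < n by rewrite ltr0n.
rewrite -(ler_pM2l n0).
have -> : n * sqnorm x = \sum_(k <- s) sqnorm (act (tens2 k) x).
  rewrite (eq_big_seq (fun=> sqnorm x)); last first.
    by move=> k /(allP sSU) kS; rewrite sqnorm_SU.
  by rewrite big_const_seq count_predT iter_addr_0 mulr_natl.
rewrite exchange_big /= mulr_sumr; apply: ler_sum => I _.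
apply: jensen_normc.
by rewrite /average mulrA mulfV ?mul1r // pnatr_eq0 -lt0n.
Qed.

Lemma inner_average_fixed s x u : (0 < size s)%N -> all (mem (SU d)) s ->
  (forall k, k \in SU d -> act (tens2 k) u = u) -> inner (average s x) u = inner x u.
Proof.
move=> s0 sSU ufix; rewrite innerZl inner_suml (eq_big_seq (fun=> inner x u)); last first.
  move=> k /(allP sSU) kS; rewrite inner_act kadj_tens2 ufix //; exact: SU_adj.
rewrite big_const_seq count_predT iter_addr_0 -(mulr_natl (inner x u)) mulrA mulVf ?mul1r //.
by rewrite pnatr_eq0 -lt0n.
Qed.

Lemma SU1 : (1%:M : 'M[C]_d) \in SU d.
Proof.
by rewrite inE det1 eqxx andbT; apply/unitarymxP; rewrite trmx1 map_mx1 mulmx1.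
Qed.

(* The average of least norm over finite subsets of SU(d) is almost fixed, so
   that its limit is the invariant [u]: no Haar measure is needed. *)
Lemma mean_ergodic x :
  (exists2 u, forall k, k \in SU d -> act (tens2 k) u = u & inner x u != 0) \/
  (forall e, 0 < e -> exists s,
    [/\ (0 < size s)%N, all (mem (SU d)) s & sqnorm (average s x) < e]).
Proof.
pose S := [set r | exists s, [/\ (0 < size s)%N, all (mem (SU d)) s &
  r = sqnorm (average s x)]]%classic.
have Si : has_inf S.
  split; last by exists 0 => _ [s [_ _ ->]]; exact: sqnorm_ge0.
  by exists (sqnorm (average [:: 1%:M] x)), [:: 1%:M]; split=> //=; rewrite andbT SU1.
have iS s : (0 < size s)%N -> all (mem (SU d)) s -> inf S <= sqnorm (average s x).
  move=> s0 sS; apply: ge_inf; last by exists s.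
  by exists 0 => _ [s' [_ _ ->]]; exact: sqnorm_ge0.
have hs e : 0 < e -> {s | [/\ (0 < size s)%N, all (mem (SU d)) s &
    sqnorm (average s x) < inf S + e]}.
  move=> e0; apply: cid; have [_ [s [s0 sS ->]] lt] := @inf_adherent _ S e e0 Si.
  by exists s.
have [iS0|i0] := leP (inf S) 0.
  right=> e /hs [s [s0 sS lt]]; exists s; split=> //.
  by apply: lt_le_trans lt _; rewrite gerDr.
left.
have e0 n : (0 : R) < n.+1%:R^-1 by rewrite invr_gt0.
pose s n := sval (hs _ (e0 n)).
have s0 n : (0 < size (s n))%N by case: (svalP (hs _ (e0 n))).
have sS n : all (mem (SU d)) (s n) by case: (svalP (hs _ (e0 n))).
have lt n : sqnorm (average (s n) x) < inf S + n.+1%:R^-1 by case: (svalP (hs _ (e0 n))).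
have [|r rn [u hu]] := @compact_seqc _ _ (fun n => average (s n) x) (sqnorm x + 1).
  by move=> n I; apply: sqnorm_bound; apply: sqnorm_average_le.
(* The list [s n] together with its translate by [k] is again a competitor. Its average is the
   midpoint of the two averages and has squared norm at least [inf S], so the parallelogram law
   bounds the squared distance by [4 * (inf S + e) - 4 * inf S], where [e] is [n.+1%:R^-1]. *)
have near k n : k \in SU d -> sqnorm (fun I => act (tens2 k) (average (s n) x) I - average (s n) x I)
    <= 4 / n.+1%:R.
  move=> kS; have P := parallelogram (act (tens2 k) (average (s n) x)) (average (s n) x).
  rewrite sqnorm_SU // in P.
  have := iS ([seq k *m l | l <- s n] ++ s n).
  rewrite size_cat all_cat sS andbT addn_gt0 s0 orbT average_cat ?size_map //.
  rewrite sqnormZ -act_average => /(_ isT) Q.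
  have {}Q : inf S <= normc (2^-1) ^+ 2 *
    sqnorm (fun i => act (tens2 k) (average (s n) x) i + average (s n) x i).
    by apply: Q; apply/allP => _ /mapP [l ls ->]; apply: SU_mul => //; exact: (allP (sS n)).
  have nE : normc (2^-1 : C) ^+ 2 = 4^-1.
    rewrite (_ : 2^-1 = (2^-1)%:C); last by rewrite fmorphV rmorph_nat.
    by rewrite normc_real ger0_norm ?invr_ge0 //; field.
  rewrite nE in Q.
  have := lt n; move: P Q.
  set e := n.+1%:R^-1; lra.
have fixu k : k \in SU d -> act (tens2 k) u = u.
  move=> kS; suff : sqnorm (fun I => act (tens2 k) u I - u I) = 0.
    move=> /sqnorm_eq0 h; apply/funext => I.
    by apply/eqP; rewrite -subr_eq0; apply/eqP; exact: (congr1 (fun f => f I) h).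
  apply/eqP; rewrite eq_le sqnorm_ge0 andbT.
  have c1 := cvgs_sub rn (cvgs_inv 4).
  have c2 : cvgs (fun n => sqnorm (fun I => act (tens2 k) (average (s (r n)) x) I - average (s (r n)) x I))
      (sqnorm (fun I => act (tens2 k) u I - u I)).
    apply: cvgs_sqnorm => I; apply: cvgsD.
      by apply: cvgs_act => // *; exact: cvgs_cst.
    rewrite -mulN1r (_ : (fun _ => _) = fun n => (-1) * average (s (r n)) x I).
      by apply: cvgsM => //; exact: cvgs_cst.
    by apply/funext => n; rewrite mulN1r.
  rewrite -subr_ge0 sub0r -mulN1r -[X in _ <= X]add0r.
  apply: (@cvgs_ge _ (fun n => 4 / (r n).+1%:R + (-1) *
     sqnorm (fun I => act (tens2 k) (average (s (r n)) x) I - average (s (r n)) x I))).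
    by apply: cvgsD => //; apply: cvgsM => //; exact: cvgs_cst.
  by move=> n; rewrite mulN1r subr_ge0; exact: near.
exists u => //.
(* Averaging does not change the pairing with the fixed vector [u], and the averages tend to [u]. *)
have -> : inner x u = inner u u.
  have c1 : cvgs (fun n => inner (average (s (r n)) x) u) (inner u u).
    by apply: cvgs_inner => // *; exact: cvgs_cst.
  apply: cvgs_unique c1.
  rewrite (_ : (fun _ => _) = fun=> inner x u); first exact: cvgs_cst.
  by apply/funext => n; apply: inner_average_fixed.
rewrite -sqnormE -(rmorph0 (real_complex R)) (inj_eq (@complexI _)) gt_eqF //.
apply: lt_le_trans i0 _.
apply: (@cvgs_ge _ (fun n => sqnorm (average (s (r n)) x))); first exact: cvgs_sqnorm.
by move=> n; exact: iS.
Qed.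

End Rep.

(** A second average, applied to the first, makes one more exponent small. The earlier ones stay
    small, since averaging does not increase the norm. *)
Lemma mean_ergodic_upto m d (v : {ffun 'I_m -> 'I_d} -> C) J :
  (forall N u, (0 < N)%N -> (forall k, k \in SU d -> act (tens2 k) u = u) ->
     inner (tpow (N:=N) v) u = 0) ->
  forall e, 0 < e -> exists s, [/\ (0 < size s)%N, all (mem (SU d)) s &
    forall N, (0 < N <= J)%N -> sqnorm (average s (tpow (N:=N) v)) < e].
Proof.
move=> h; elim: J => [|J IH] e e0.
  by exists [:: 1%:M]; split=> //=; [rewrite SU1 | case].
have [s [s0 sS hs]] := IH _ e0.
have [[u ufix]|/(_ e e0) [s' [s'0 s'S hs']]] := mean_ergodic (average s (tpow (N:=J.+1) v)).
  by rewrite inner_average_fixed // h // eqxx.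
exists [seq k *m l | k <- s', l <- s]; split.
- by rewrite size_allpairs muln_gt0 s'0.
- apply/allP => _ /allpairsP [[k l] /= [ks ls ->]].
  by apply: SU_mul; [exact: (allP s'S) | exact: (allP sS)].
move=> N /andP[N0]; rewrite leq_eqVlt ltnS average_allpairs => /predU1P[->|NJ] //.
by apply: le_lt_trans (sqnorm_average_le _ _ _) (hs N _) => //; rewrite N0.
Qed.

End Averages.

(** * Moments of matrix coefficients over finite subsets *)

Section Gram.
Context {R : realType}.
Local Notation C := R[i].
Local Notation normc := Normc.normc.
Local Open Scope complex_scope.

Lemma sum_sqr_le (T : finType) (x : T -> R) :
  (\sum_t x t) ^+ 2 <= #|T|%:R * \sum_t x t ^+ 2.
Proof.
have [T0|T0] := posnP #|T|.
  rewrite T0 mul0r big1 ?expr0n // => t _.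
  by have := max_card (pred1 t); rewrite T0 card1.
have n0 : (#|T|%:R : R) != 0 by rewrite pnatr_eq0 -lt0n.
have := @jensen_sqr R T (index_enum T) x (#|T|%:R^-1 * \sum_t x t).
have -> : size (index_enum T) = #|T| by rewrite cardE enumT.
rewrite mulrA mulfV // mul1r => /(_ erefl) h.
rewrite -(ler_pM2l (_ : 0 < #|T|%:R^-1)) ?invr_gt0 ?ltr0n //.
rewrite [X in _ <= X]mulrA mulVf // mul1r; apply: le_trans h; rewrite exprMn.
by rewrite expr2 !mulrA mulfV // mul1r.
Qed.

Section PowerSums.
Variables (X : finType) (j : nat).
Implicit Types (w : X -> C).

(** The multiplicities of the indices in [I]. The entry [tpow w I] depends only on them, so the
    powers of inner products live on at most [j.+1 ^ #|X|] coordinates rather than [#|X| ^ j]. *)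
Let type (I : {ffun 'I_j -> X}) : {ffun X -> 'I_j.+1} :=
  [ffun x => inord #|[set k | I k == x]|].

Let mon w (e : {ffun X -> 'I_j.+1}) := \prod_x w x ^+ e x.

Let mult e := #|[set I | type I == e]|.

Let tpow_mon w I : tpow w I = mon w (type I).
Proof.
rewrite /tpow /mon (partition_big I xpredT) //=; apply: eq_bigr => x _.
rewrite (eq_bigr (fun _ => w x)); last by move=> k /eqP ->.
rewrite prodr_const ffunE inordK.
  by congr (_ ^+ _); apply: eq_card => k; rewrite !inE.
by rewrite ltnS -[X in (_ <= X)%N](card_ord j) max_card.
Qed.

Let ipX w w' : inner w w' ^+ j = \sum_e (mult e)%:R * (mon w e * Num.conj (mon w' e)).
Proof.
rewrite -inner_tpow /inner (partition_big type xpredT) //=; apply: eq_bigr => e _.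
rewrite (eq_bigr (fun=> mon w e * Num.conj (mon w' e))); last first.
  by move=> I /eqP <-; rewrite !tpow_mon.
by rewrite sumr_const -[LHS]mulr_natl; congr (_%:R * _); apply: eq_card => I; rewrite !inE.
Qed.

(* The numbers [inner (w a) (w b) ^+ j] form a Gram matrix of trace [size r] and of
   rank at most [j.+1 ^ #|X|], the number of monomials; this bounds its
   Hilbert-Schmidt norm from below. *)
Lemma gram_lower (T : eqType) (r : seq T) (w : T -> X -> C) :
  (forall a, a \in r -> sqnorm (w a) = 1) ->
  (size r)%:R ^+ 2 <= (j.+1 ^ #|X|)%:R *
    \sum_(a <- r) \sum_(b <- r) normc (inner (w a) (w b)) ^+ (2 * j) :> R.
Proof.
move=> w1; pose S e e' := \sum_(a <- r) mon (w a) e * Num.conj (mon (w a) e').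
pose t e := \sum_(a <- r) normc (mon (w a) e) ^+ 2.
have SE e : S e e = (t e)%:C.
  by rewrite /t rmorph_sum; apply: eq_bigr => a _; rewrite [RHS]normc_sqr.
have t0 e : 0 <= t e.
  by apply: sumr_ge0 => a _; rewrite exprn_ge0 ?normc_ge0.
(* Up to weights and conjugation, the Gram matrix is a rectangular matrix times its adjoint, and [S]
   is the product in the other order; their Hilbert-Schmidt norms agree. *)
have -> : \sum_(a <- r) \sum_(b <- r) normc (inner (w a) (w b)) ^+ (2 * j) =
    \sum_e \sum_e' (mult e * mult e')%:R * normc (S e e') ^+ 2.
  have toC x y n : ((n%:R * normc x ^+ 2)%:C = y) ->
    (n%:R * (x * Num.conj x) = y :> C).
    by move=> <-; rewrite rmorphM rmorph_nat -normc_sqr.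
  apply: complexI; rewrite rmorph_sum [RHS]rmorph_sum.
  transitivity (\sum_(a <- r) \sum_(b <- r) \sum_e \sum_e'
    (mult e * mult e')%:R * (mon (w a) e * Num.conj (mon (w b) e) *
       (Num.conj (mon (w a) e') * mon (w b) e'))).
    apply: eq_bigr => a _; rewrite [LHS]rmorph_sum; apply: eq_bigr => b _.
    have -> : normc (inner (w a) (w b)) ^+ (2 * j) = normc (inner (w a) (w b) ^+ j) ^+ 2.
      by rewrite normcX -exprM mulnC.
    rewrite [LHS]normc_sqr ipX rmorph_sum mulr_suml; apply: eq_bigr => e _.
    rewrite mulr_sumr; apply: eq_bigr => e' _.
    by rewrite !rmorphM /= conjC_nat conjCK mulrACA.
  transitivity (\sum_e \sum_e' \sum_(a <- r) \sum_(b <- r)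
    (mult e * mult e')%:R * (mon (w a) e * Num.conj (mon (w b) e) *
       (Num.conj (mon (w a) e') * mon (w b) e'))).
    under eq_bigr do rewrite exchange_big; rewrite exchange_big /=.
    apply: eq_bigr => e _; under eq_bigr do rewrite exchange_big.
    by rewrite exchange_big.
  apply: eq_bigr => e _; rewrite [RHS]rmorph_sum; apply: eq_bigr => e' _.
  rewrite [RHS]rmorphM rmorph_nat [X in _ = _ * X]normc_sqr /S rmorph_sum.
  rewrite mulr_suml mulr_sumr; apply: eq_bigr => a _.
  rewrite mulr_sumr mulr_sumr; apply: eq_bigr => b _.
  congr (_ * _); rewrite rmorphM /= conjCK; ring.
have -> : (size r)%:R = \sum_e (mult e)%:R * t e.
  apply: complexI; rewrite rmorph_nat rmorph_sum /=.
  transitivity (\sum_(a <- r) inner (w a) (w a) ^+ j).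
    rewrite (eq_big_seq (fun=> 1)); last by move=> a /w1 h; rewrite -sqnormE h expr1n.
    by rewrite big_const_seq count_predT iter_addr_0.
  rewrite (eq_bigr (fun a => \sum_e (mult e)%:R *
    (mon (w a) e * Num.conj (mon (w a) e)))); last by move=> a _; exact: ipX.
  rewrite exchange_big /=; apply: eq_bigr => e _.
  by rewrite [RHS]rmorphM rmorph_nat [X in _ = _ * X](esym (SE e)) mulr_sumr.
have -> : (j.+1 ^ #|X|)%N = #|{ffun X -> 'I_j.+1}|%N by rewrite card_ffun card_ord.
(* Cauchy-Schwarz over the types; only the diagonal entries of [S] are kept. *)
apply: le_trans (sum_sqr_le _) _; rewrite ler_wpM2l //; apply: ler_sum => e _.
rewrite (bigD1 e) //= SE normc_real ger0_norm // exprMn natrM expr2 lerDl.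
by apply: sumr_ge0 => e' _; rewrite mulr_ge0 // exprn_ge0 ?normc_ge0.
Qed.

End PowerSums.

Section Convolution.
Variables (m d : nat) (v : {ffun 'I_m -> 'I_d} -> C).
Hypothesis v1 : sqnorm v = 1.

Definition matcoef (k : 'M[C]_d) : C := inner (act (tens k) v) v.

(** On unitary matrices the adjoint is the inverse, so a sum over [conv s] runs over pairs of points
    in the orbit of [v]. For powers of [matcoef] it gives the squared norm of an average, for even
    powers of its modulus that of a Gram matrix. *)
Definition conv (s : seq 'M[C]_d) := [seq l^t* *m k | k <- s, l <- s].

Lemma matcoef_adjM k l : matcoef (l^t* *m k) = inner (act (tens k) v) (act (tens l) v).
Proof.
rewrite /matcoef tensM act_kmul [LHS]inner_act kadj_tens.
by congr (inner _ (act (tens _) _)); exact: trmxCK.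
Qed.

Lemma sqnorm_unitary (k : 'M[C]_d) (x : {ffun 'I_m -> 'I_d} -> C) :
  k \is unitarymx -> sqnorm (act (tens k) x) = sqnorm x.
Proof.
move=> uk; apply: complexI; rewrite !sqnormE inner_act kadj_tens.
by rewrite -act_kmul -tensM unitary_adjK // tens1 act_kid.
Qed.

Lemma sum_conv_matcoefX N s : (0 < size s)%N ->
  \sum_(k <- conv s) matcoef k ^+ N =
  ((size s)%:R ^+ 2 * sqnorm (average s (tpow (N:=N) v)))%:C.
Proof.
move=> s0; rewrite big_allpairs_dep /=.
under eq_bigr do under eq_bigr do rewrite matcoef_adjM -inner_tpow.
have cn : Num.conj ((size s)%:R^-1 : C) = (size s)%:R^-1.
  by rewrite fmorphV /= conjC_nat.
rewrite rmorphM [X in _ = _ * X]sqnormE /average innerZl innerZr cn rmorphXn rmorph_nat.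
have n0 : ((size s)%:R : C) != 0 by rewrite pnatr_eq0 -lt0n.
rewrite !mulrA expr2 mulfK // mulfV // mul1r inner_suml; apply: eq_bigr => k _.
rewrite inner_sumr; apply: eq_bigr => l _.
by rewrite !act_kron_tpow.
Qed.

Lemma sum_conv_normc j s : all (mem (SU d)) s ->
  (size s)%:R ^+ 2 <= (j.+1 ^ #|{ffun 'I_m -> 'I_d}|)%:R *
    \sum_(k <- conv s) normc (matcoef k) ^+ (2 * j).
Proof.
move=> sS; rewrite big_allpairs_dep /=.
under eq_bigr do under eq_bigr do rewrite matcoef_adjM.
by apply: gram_lower => k /(allP sS) /andP[uk _]; rewrite sqnorm_unitary.
Qed.

Lemma conv_SU s : all (mem (SU d)) s -> all (mem (SU d)) (conv s).
Proof.
move=> sS; apply/allP => _ /allpairsP [[k l] /= [/(allP sS) ks /(allP sS) ls ->]].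
by apply: SU_mul => //; exact: SU_adj.
Qed.

End Convolution.
End Gram.

(** * Matrix coefficients of modulus close to one *)

Section Angles.
Context {R : realType}.
Local Notation C := R[i].
Local Notation normc := Normc.normc.
Local Open Scope complex_scope.
Implicit Types (x y : R).

Lemma sin_mvt y : exists2 c, `|c| <= `|y| & sin y = cos c * y.
Proof.
wlog y0 : y / 0 <= y => [H|].
  have [/H//|y0] := leP 0 y.
  have [|c h1 h2] := H (- y); first by lra.
  exists c; first by rewrite -[X in _ <= X]normrN.
  by move: h2; rewrite sinN => h; apply: oppr_inj; rewrite h; ring.
have [|c] := @MVT_segment R sin cos 0 y y0.
  by apply: continuous_subspaceT => x; exact: continuous_sin.
rewrite in_itv /= => /andP[c0 cy]; rewrite sin0 !subr0 => h.
by exists c; rewrite // !ger0_norm.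
Qed.

Lemma abs_sin_le y : `|sin y| <= `|y|.
Proof.
have [c _ ->] := sin_mvt y; rewrite normrM ler_piMl //.
by rewrite ler_norml cos_geN1 cos_le1.
Qed.

Lemma one_sub_cos y : 1 - cos y = 2 * sin (y / 2) ^+ 2.
Proof.
have -> : y = y / 2 + y / 2 by field.
rewrite cosD; have -> : (y / 2 + y / 2) / 2 = y / 2 by field.
have := cos2Dsin2 (y / 2); nra.
Qed.

Lemma one_sub_cos_le y : 1 - cos y <= y ^+ 2 / 2.
Proof.
rewrite one_sub_cos.
have := abs_sin_le (y / 2); rewrite -(@ler_pXn2r _ 2) ?nnegrE //.
rewrite !real_normK ?num_real // expr_div_n; lra.
Qed.

Lemma sin_sub_le y : `|sin y - y| <= `|y| * y ^+ 2 / 2.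
Proof.
have [c cy ->] := sin_mvt y.
rewrite -{2}(mul1r y) -mulrBl normrM mulrC -mulrA ler_wpM2l //.
have := one_sub_cos_le c; have := cos_le1 c; have : c ^+ 2 <= y ^+ 2.
  by rewrite -[c ^+ 2]real_normK ?num_real // -[y ^+ 2]real_normK ?num_real // lerXn2r ?nnegrE.
move=> h1 h2 h3; rewrite ler_norml; apply/andP; split; nra.
Qed.

Lemma abs_sin_ge y : `|y| <= 1 -> `|y| / 2 <= `|sin y|.
Proof.
move=> y1; have [c cy ->] := sin_mvt y; rewrite normrM mulrC ler_wpM2r //.
have := one_sub_cos_le c.
have : c ^+ 2 <= 1.
  by rewrite -[c ^+ 2]real_normK ?num_real // expr_le1 // (le_trans cy).
move=> h1 h2; apply: le_trans (ler_norm _); lra.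
Qed.

Lemma one_sub_cos_ge y : `|y| <= 1 -> y ^+ 2 / 8 <= 1 - cos y.
Proof.
move=> y1; rewrite one_sub_cos.
have h : `|y / 2| <= 1 by rewrite normrM (@ger0_norm _ 2^-1) //; lra.
have := abs_sin_ge h; rewrite -(@ler_pXn2r _ 2) ?nnegrE ?divr_ge0 //.
rewrite real_normK ?num_real // expr_div_n real_normK ?num_real // expr_div_n; lra.
Qed.

Definition cis x : C := cos x +i* sin x.

Lemma cisD x y : cis (x + y) = cis x * cis y.
Proof.
apply/eqP; rewrite eq_complex /= cosD sinD eqxx /=.
by apply/eqP; ring.
Qed.

Lemma cis0 : cis 0 = 1. Proof. by rewrite /cis cos0 sin0. Qed.

Lemma cis_sum I (r : seq I) (f : I -> R) : cis (\sum_(i <- r) f i) = \prod_(i <- r) cis (f i).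
Proof. by elim: r => [|i r IH]; rewrite ?big_nil ?cis0 // !big_cons cisD IH. Qed.

(** Near 1 the angle is determined by the imaginary part: the intermediate value theorem applies to
    the sine between -1 and 1, as [sin 1 >= 1/2]. *)
Lemma angle (z : C) : normc z = 1 -> normc (z - 1) <= 2^-1 ->
  exists2 x, `|x| <= 2 * normc (z - 1) & z = cis x.
Proof.
case: z => a b z1 h.
have hb : `|b| <= normc ((a +i* b) - 1).
  by have := normc_Im ((a +i* b) - 1); rewrite /= subr0.
have ha : `|a - 1| <= normc ((a +i* b) - 1).
  by have := normc_Re ((a +i* b) - 1).
have ab1 : a ^+ 2 + b ^+ 2 = 1 by have := normc2E (a +i* b); rewrite z1 expr1n.
have b2 : `|b| <= 2^-1 by exact: le_trans hb h.
have s1 : 2^-1 <= sin (1 : R).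
  have := @abs_sin_ge 1; rewrite normr1 mul1r => /(_ (lexx _)).
  rewrite ger0_norm // sin_ge0_pi //.
  by rewrite ler01 /=; have := pi_ge2 R; lra.
have [|||x] := @IVT R sin (-1) 1 b.
- by lra.
- by apply: continuous_subspaceT => x; exact: continuous_sin.
- rewrite sinN; move: b2; rewrite ler_norml ge_min le_max => /andP[? ?].
  by apply/andP; split; apply/orP; [left|right]; lra.
rewrite in_itv /= => x1 sx; have {}x1 : `|x| <= 1 by rewrite ler_norml.
have xb : `|x| <= 2 * `|b| by have := abs_sin_ge x1; rewrite sx; lra.
exists x; first by apply: le_trans xb _; rewrite ler_pM2l.
rewrite /cis sx; congr (_ +i* _).
have c0 : 2^-1 <= cos x.
  have := one_sub_cos_le x; have : x ^+ 2 <= 1.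
    by rewrite -[x ^+ 2]real_normK ?num_real // expr_le1.
  lra.
have a0 : 0 <= a by move: (le_trans ha h); rewrite ler_norml => /andP[]; lra.
have := cos2Dsin2 x; rewrite sx => h2.
by apply/eqP; rewrite -(@eqrXn2 _ 2) //; [apply/eqP; lra | lra].
Qed.

(* As the first moment vanishes, the imaginary part of [z] is of third order in
   [y], whereas [1 - normc z] is of second order. *)
Lemma cis_mean (I : finType) (p y : I -> R) (e : R) :
  0 < e -> e <= 8^-1 ->
  (forall i, 0 <= p i) -> \sum_i p i = 1 -> \sum_i p i * y i = 0 ->
  (forall i, `|y i| <= e) ->
  forall z, z = \sum_i (p i)%:C * cis (y i) ->
  normc (z - (normc z)%:C) <= 16 * e * (1 - normc z).
Proof.
move=> e0 e1 p0 p1 py ye z zE.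
have y1 i : `|y i| <= 1 by apply: le_trans (ye i) _; lra.
have zR : complex.Re z = \sum_i p i * cos (y i).
  rewrite zE raddf_sum; apply: eq_bigr => i _ /=; ring.
have zI : complex.Im z = \sum_i p i * sin (y i).
  rewrite zE raddf_sum; apply: eq_bigr => i _ /=; ring.
pose W := \sum_i p i * y i ^+ 2.
have W0 : 0 <= W by apply: sumr_ge0 => i _; rewrite mulr_ge0 // sqr_ge0.
have hR : W / 8 <= 1 - complex.Re z.
  rewrite zR -[X in _ <= X - _]p1 -sumrB /W mulr_suml; apply: ler_sum => i _.
  by rewrite -mulrA -[X in _ <= X - _]mulr1 -mulrBr ler_wpM2l // one_sub_cos_ge.
have hI : `|complex.Im z| <= e * W / 2.
  have -> : complex.Im z = \sum_i p i * (sin (y i) - y i).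
    by rewrite zI; under [RHS]eq_bigr do rewrite mulrBr; rewrite sumrB py subr0.
  apply: le_trans (ler_norm_sum _ _ _) _.
  rewrite /W mulr_sumr mulr_suml; apply: ler_sum => i _.
  rewrite normrM (ger0_norm (p0 i)).
  rewrite mulrCA -mulrA -mulrA ler_wpM2l //.
  apply: le_trans (sin_sub_le _) _; rewrite -mulrA ler_wpM2r ?ye //.
  by rewrite divr_ge0 // sqr_ge0.
have R0 : 0 <= complex.Re z.
  rewrite zR; apply: sumr_ge0 => i _; rewrite mulr_ge0 //.
  have := one_sub_cos_le (y i); have : y i ^+ 2 <= 1.
    by rewrite -[y i ^+ 2]real_normK ?num_real // expr_le1.
  lra.
have h1 := normc_le z; rewrite (ger0_norm R0) in h1.
have h2 := normc_Re z; rewrite (ger0_norm R0) in h2.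
(* As [normc z <= Re z + |Im z|], the left side is at most [2 |Im z| <= e * W], while [1 - normc z
   >= W / 8 - e * W / 2 >= W / 16]. This is the origin of the 16. *)
have h3 := normc_le (z - (normc z)%:C).
apply: le_trans h3 _.
rewrite [complex.Re _]raddfB [complex.Im _]raddfB /= subr0.
rewrite ler0_norm ?subr_le0 //.
have : 0 <= e * W by rewrite mulr_ge0 // ltW.
have : e * (W / 16) <= e * (1 - normc z).
  rewrite ler_wpM2l ?(ltW e0) //; nra.
nra.
Qed.

End Angles.

(** * The moment map at a minimal vector *)

Section MinimalVector.
Context {R : realType}.
Local Notation C := R[i].
Local Notation normc := Normc.normc.
Local Open Scope complex_scope.
Variables (m d : nat) (v : {ffun 'I_m -> 'I_d} -> C).
Hypothesis v1 : sqnorm v = 1.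
Hypothesis vmin : forall g : 'M[C]_d, \det g = 1 -> 1 <= sqnorm (act (tens g) v).
Local Notation z := (matcoef v).

(** From [expR (- x) >= 1 - x], which bounds [expR x] by the inverse of [1 - x]. *)
Lemma expR_le_quad (x : R) : `|x| <= 2^-1 -> expR x <= 1 + x + 2 * x ^+ 2.
Proof.
rewrite ler_norml => /andP[x1 x2].
have := expR_ge1Dx (- x); rewrite expRN => h.
have e0 := expR_gt0 x.
have h2 : (1 - x) * expR x <= 1 by rewrite -ler_pdivlMr // div1r.
have : 1 <= (1 + x + 2 * x ^+ 2) * (1 - x) by nra.
have : 0 < 1 - x by lra.
move=> h3 h4; rewrite -(ler_pM2l h3); apply: le_trans h2 _.
by rewrite mulrC.
Qed.

(** The first-order condition at the minimum [s = 0], tested at a single small [s] of sign opposite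
    to the first moment instead of by differentiation. *)
Lemma moment_zero (I : finType) (p y : I -> R) :
  (forall i, 0 <= p i) -> \sum_i p i = 1 ->
  (forall s : R, 1 <= \sum_i p i * expR (s * y i)) -> \sum_i p i * y i = 0.
Proof.
move=> p0 p1 h; set A := \sum_i _; set Q := \sum_i p i * y i ^+ 2.
pose B := \sum_i `|y i|.
have Q0 : 0 <= Q by apply: sumr_ge0 => i _; rewrite mulr_ge0 // sqr_ge0.
have B0 : 0 <= B by apply: sumr_ge0.
have yB i : `|y i| <= B.
  by rewrite /B (bigD1 i) //= lerDl; apply: sumr_ge0.
apply/eqP; rewrite -sqrf_eq0 eq_le sqr_ge0 andbT.
(* The first summand makes the quadratic term at most half of the linear one, the second keeps all
   [s * y i] within the range of [expR_le_quad]. *)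
pose K := 4 * (Q + 1) + 2 * `|A| * (B + 1).
have K0 : 0 < K.
  apply: ltr_wpDr; last by rewrite mulr_gt0 //; lra.
  by rewrite !mulr_ge0 //; lra.
pose s := - A / K.
have sy i : `|s * y i| <= 2^-1.
  rewrite /s !normrM normrN normfV (gtr0_norm K0) mulrAC ler_pdivrMr //.
  have : `|A| * `|y i| <= `|A| * B by rewrite ler_wpM2l.
  have := normr_ge0 A; rewrite /K; nra.
have : 1 <= \sum_i p i * (1 + s * y i + 2 * (s * y i) ^+ 2).
  apply: le_trans (h s) _; apply: ler_sum => i _.
  by rewrite ler_wpM2l // expR_le_quad.
have -> : \sum_i p i * (1 + s * y i + 2 * (s * y i) ^+ 2) =
    1 + s * A + 2 * s ^+ 2 * Q.
  rewrite -[X in _ = X + _ + _]p1 /A /Q !mulr_sumr -!big_split /=; apply: eq_bigr => i _; ring.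
move=> h1.
have {h1} : 0 <= s * A + 2 * s ^+ 2 * Q by lra.
have -> : s * A + 2 * s ^+ 2 * Q = (A ^+ 2 / K) * (2 * Q / K - 1).
  by rewrite /s; field; rewrite gt_eqF.
move=> h2.
have hK : 2 * Q / K - 1 <= - 2^-1.
  rewrite lerBlDr ler_pdivrMr // /K; have := normr_ge0 A; nra.
have A2 : 0 <= A ^+ 2 / K by rewrite divr_ge0 ?sqr_ge0 // ltW.
have : A ^+ 2 / K <= 0 by nra.
by rewrite ler_pdivrMr // mul0r.
Qed.

Lemma tens_diag_act (s : 'rV[C]_d) (x : {ffun 'I_m -> 'I_d} -> C) :
  act (tens (diag_mx s)) x = fun I => (\prod_k s ord0 (I k)) * x I.
Proof. by apply: act_diag => I J; exact: tens_diag. Qed.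

(** The moment map vanishes at [v] in the direction of the Hermitian matrix with eigenvalues [th] in
    the basis [P]. Minimality is tested on exponentials of its multiples, with a factor [1/2]
    because the norm is squared. *)
Lemma moment_torus (P : 'M[C]_d) (th : 'I_d -> R) :
  P \is unitarymx -> \sum_j th j = 0 ->
  \sum_I normc (act (tens P) v I) ^+ 2 * \sum_a th (I a) = 0.
Proof.
move=> uP th0; apply: moment_zero => [I||s].
- by rewrite exprn_ge0 ?normc_ge0.
- by rewrite -[LHS]/(sqnorm _) sqnorm_unitary.
pose D : 'rV[C]_d := \row_j (expR (s / 2 * th j))%:C.
have expR_sum I (r : seq I) (f : I -> R) :
    expR (\sum_(i <- r) f i) = \prod_(i <- r) expR (f i).
  by elim: r => [|i r IH]; rewrite ?big_nil ?expR0 // !big_cons expRD IH.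
have detD : \det (P^t* *m diag_mx D *m P) = 1.
  rewrite !det_mulmx mulrAC -det_mulmx unitary_adjK // det1 mul1r det_diag.
  under eq_bigr do rewrite mxE; rewrite -rmorph_prod -expR_sum -mulr_sumr th0.
  by rewrite mulr0 expR0.
apply: le_trans (vmin detD) _; rewrite -mulmxA tensM act_kmul sqnorm_unitary; last first.
  by rewrite trmxC_unitary.
rewrite tensM act_kmul tens_diag_act; apply: ler_sum => I _.
rewrite Normc.normcM exprMn mulrC ler_wpM2l ?exprn_ge0 ?normc_ge0 //.
under eq_bigr do rewrite mxE.
rewrite -rmorph_prod normc_real -expR_sum ger0_norm ?expR_ge0 // -expRM_natl.
rewrite -mulr_sumr; set X := \sum_a th _.
by rewrite (_ : 2%:R * (s / 2 * X) = s * X) //; field.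
Qed.

Definition mx_close (e : R) (a b : 'M[C]_d) := forall i j, normc (a i j - b i j) <= e.

Lemma unitary_entry (k : 'M[C]_d) i j : k \is unitarymx -> normc (k i j) <= 1.
Proof.
move=> /unitarymxP /(congr1 (fun A : 'M_d => A i i)); rewrite !mxE eqxx => h.
have : \sum_l normc (k i l) ^+ 2 = 1.
  apply: complexI; rewrite rmorph_sum rmorph1 -[RHS]/(true%:R) -h; apply: eq_bigr => l _.
  by rewrite [LHS]normc_sqr !mxE.
rewrite (bigD1 j) //= => h1.
rewrite -(@expr_le1 _ 2) ?normc_ge0 // -h1 lerDl.
by apply: sumr_ge0 => l _; rewrite exprn_ge0 ?normc_ge0.
Qed.

Lemma normc_sum I (r : seq I) (f : I -> C) :
  normc (\sum_(i <- r) f i) <= \sum_(i <- r) normc (f i).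
Proof.
elim: r => [|i r IH]; first by rewrite !big_nil Normc.normc0.
by rewrite !big_cons; apply: le_trans (le_normcD _ _) _; rewrite lerD2l.
Qed.

Lemma mx_close_mulr (e : R) a b (k : 'M[C]_d) : k \is unitarymx ->
  mx_close e a b -> mx_close (d%:R * e) (a *m k) (b *m k).
Proof.
move=> uk ab i j; rewrite !mxE -sumrB.
apply: le_trans (normc_sum _ _) _.
rewrite -[d in leRHS]card_ord mulr_natl -sumr_const; apply: ler_sum => l _.
rewrite -mulrBl Normc.normcM -[X in _ <= X]mulr1.
by rewrite ler_pM ?normc_ge0 // unitary_entry.
Qed.

Lemma mx_close_mull (e : R) a b (k : 'M[C]_d) : k \is unitarymx ->
  mx_close e a b -> mx_close (d%:R * e) (k *m a) (k *m b).
Proof.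
move=> uk ab i j; rewrite !mxE -sumrB.
apply: le_trans (normc_sum _ _) _.
rewrite -[d in leRHS]card_ord mulr_natl -sumr_const; apply: ler_sum => l _.
rewrite -mulrBr Normc.normcM -[X in _ <= X]mul1r.
by rewrite ler_pM ?normc_ge0 // unitary_entry.
Qed.

(** Close to 1, the eigenvalues of [k] have small angles whose sum is exactly 0. In an eigenbasis
    [z k] is thus a mean of numbers [cis x] with small [x], whose first moment vanishes by
    [moment_torus], and [cis_mean] applies. *)
Lemma matcoef_near1 (e : R) : 0 < e -> exists2 h : R, 0 < h &
  forall k, k \in SU d -> mx_close h k 1%:M ->
  normc (z k - (normc (z k))%:C) <= e * (1 - normc (z k)).
Proof.
move=> e0; pose c := Num.min 8^-1 (e / 16).
have c0 : 0 < c by rewrite lt_min; apply/andP; split; lra.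
have c8 : c <= 8^-1 by rewrite ge_min lexx.
have ce : c <= e / 16 by rewrite ge_min lexx orbT.
(* Sums of [m] angles occur in the coefficient and sums of [d] angles in the determinant; [g] keeps
   both below [c]. The choice of [h] allows for the factor [d * d] lost in conjugating by [P]. *)
pose M : R := (m + d + 1)%:R.
have M0 : 1 <= M by rewrite /M addn1 ler1n.
pose g := c / (2 * M).
have g0 : 0 < g by rewrite divr_gt0 // mulr_gt0 //; lra.
have g2 : g <= 2^-1.
  rewrite ler_pdivrMr; last lra; lra.
pose h := g / ((d * d)%:R + 1).
have h0 : 0 < h by rewrite divr_gt0 // ltr_wpDl.
exists h => // k kSU kh.
have := kSU; rewrite inE => /andP[uk /eqP dk].
have nk : k \is normalmx.
  by apply/normalmxP; rewrite (unitarymxP uk) unitary_adjK.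
have /orthomx_spectralP := nk.
set P := spectralmx k; set L := spectral_diag k => kE.
have uP : P \is unitarymx by exact: spectral_unitarymx.
rewrite invmx_unitary // in kE.
have LE : diag_mx L = P *m k *m P^t*.
  by rewrite kE !mulmxA (unitarymxP uP) mul1mx -mulmxA (unitarymxP uP) mulmx1.
have uP' : P^t* \is unitarymx by rewrite trmxC_unitary.
have uL : diag_mx L \is unitarymx by rewrite LE !mul_unitarymx.
have L1 j : normc (L ord0 j) = 1.
  have /unitarymxP /(congr1 (fun A : 'M_d => A j j)) := uL.
  rewrite tr_diag_mx map_diag_mx mulmx_diag !mxE eqxx mulr1n -normc_sqr.
  move=> /(@complexI _ _ 1) /eqP; rewrite -{1}(expr1n _ 2) eqrXn2 ?normc_ge0 //.
  by move=> /eqP.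
have pL : \prod_j L ord0 j = 1.
  by rewrite -det_diag LE !det_mulmx mulrAC -det_mulmx (unitarymxP uP) det1 mul1r.
have Lg j : normc (L ord0 j - 1) <= g.
  have := mx_close_mulr uP' (mx_close_mull uP kh) j j.
  rewrite mulmx1 (unitarymxP uP) -LE !mxE eqxx !mulr1n.
  move=> H; apply: le_trans H _; rewrite mulrA -natrM /h mulrA ler_pdivrMr ?ltr_wpDl //.
  by rewrite mulrC ler_wpM2l ?(ltW g0) // lerDl.
have hth j : {x : R | `|x| <= 2 * g /\ L ord0 j = cis x}.
  apply: cid; have [|x xg ->] := @angle R (L ord0 j) (L1 j).
    exact: le_trans (Lg j) g2.
  by exists x; split=> //; apply: le_trans xg _; rewrite ler_pM2l.
pose th j := sval (hth j).
have thg j : `|th j| <= 2 * g by case: (svalP (hth j)).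
have thL j : L ord0 j = cis (th j) by case: (svalP (hth j)).
have sumg n (f : 'I_n -> 'I_d) : (n <= m + d + 1)%N -> `|\sum_a th (f a)| <= c.
  move=> nM; apply: le_trans (ler_norm_sum _ _ _) _.
  apply: (@le_trans _ _ (\sum_(a < n) 2 * g)); first by apply: ler_sum => a _.
  rewrite sumr_const card_ord -[_ *+ n]mulr_natl /g.
  have -> : n%:R * (2 * (c / (2 * M))) = c * (n%:R / M) by field; lra.
  rewrite ger_pMr // ler_pdivrMr ?mul1r; last lra.
  by rewrite ler_nat.
(* The determinant being 1, the sum is a zero of the sine; it is also at most [1/8] in absolute
   value. *)
have th0 : \sum_j th j = 0.
  have : cis (\sum_j th j) = 1.
    by rewrite cis_sum -[RHS]pL; apply: eq_bigr => j _; rewrite thL.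
  case=> _ s0; have := sumg d id; rewrite addn1 leqW ?leq_addl // => /(_ isT) sc.
  have := @abs_sin_ge R (\sum_j th j); rewrite s0 normr0 => /(_ _) H.
  by apply/eqP; rewrite -normr_le0; have := H ltac:(lra); lra.
have mom := moment_torus uP th0.
rewrite (_ : z k = \sum_I (normc (act (tens P) v I) ^+ 2)%:C * cis (\sum_a th (I a))); last first.
  rewrite /matcoef {1}kE -mulmxA tensM act_kmul inner_act kadj_tens.
  rewrite (_ : P^t*^t* = P); last exact: trmxCK.
  rewrite tensM act_kmul tens_diag_act /inner; apply: eq_bigr => I _.
  rewrite normc_sqr cis_sum -mulrA mulrC; congr (_ * _).
  by apply: eq_bigr => a _; rewrite thL.
set Z := \sum_I _.
have w0 I : 0 <= normc (act (tens P) v I) ^+ 2 by rewrite exprn_ge0 ?normc_ge0.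
have w1 := etrans (sqnorm_unitary v uP) v1.
have xc (I : {ffun 'I_m -> 'I_d}) : `|\sum_a th (I a)| <= c.
  by apply: sumg; rewrite -addnA leq_addr.
have H := @cis_mean R _ (fun I => normc (act (tens P) v I) ^+ 2)
  (fun I => \sum_a th (I a)) c c0 c8 w0 w1 mom xc Z erefl.
apply: (le_trans H); apply: ler_wpM2r; last lra.
have := normc_ge0 (Z - (normc Z)%:C); nra.
Qed.

End MinimalVector.

Section MatrixCoefficient.
Context {R : realType}.
Local Notation C := R[i].
Local Notation normc := Normc.normc.
Local Open Scope complex_scope.
Variables (m d : nat) (v : {ffun 'I_m -> 'I_d} -> C).
Hypothesis v1 : sqnorm v = 1.
Hypothesis vmin : forall g : 'M[C]_d, \det g = 1 -> 1 <= sqnorm (act (tens g) v).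
Local Notation z := (matcoef v).

Let SU_unitary (k : 'M[C]_d) : k \in SU d -> k \is unitarymx.
Proof. by rewrite inE => /andP[]. Qed.

(** Pythagoras: [z k] times [v] is the orthogonal projection of [act (tens k) v] to the line of [v].
    Both the bound on [z] and the case of equality follow. *)
Lemma sqnorm_sub_matcoef k : k \in SU d ->
  sqnorm (fun I => act (tens k) v I - z k * v I) = 1 - normc (z k) ^+ 2.
Proof.
move=> kS; apply: complexI.
have ipvv : inner v v = 1 by rewrite -sqnormE v1.
have ipkk : inner (act (tens k) v) (act (tens k) v) = 1.
  by rewrite -sqnormE (sqnorm_unitary _ (SU_unitary kS)) v1.
rewrite sqnormE rmorphB rmorph1 [X in _ = _ - X]normc_sqr.
transitivity (inner (act (tens k) v) (act (tens k) v) -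
  Num.conj (z k) * inner (act (tens k) v) v - z k * inner v (act (tens k) v)
  + z k * Num.conj (z k) * inner v v).
  rewrite /inner !mulr_sumr -!sumrN -!big_split /=; apply: eq_bigr => I _.
  by rewrite rmorphB rmorphM /=; ring.
have -> : inner v (act (tens k) v) = Num.conj (z k).
  rewrite /matcoef /inner rmorph_sum; apply: eq_bigr => I _.
  by rewrite rmorphM /= conjCK mulrC.
by rewrite ipvv ipkk -/(matcoef v k); ring.
Qed.

Lemma matcoef_le1 k : k \in SU d -> normc (z k) <= 1.
Proof.
move=> kS; have := sqnorm_ge0 (fun I => act (tens k) v I - z k * v I).
rewrite sqnorm_sub_matcoef // subr_ge0 expr_le1 ?normc_ge0 //.
Qed.

Lemma matcoef_eigen k : k \in SU d -> normc (z k) = 1 ->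
  act (tens k) v = fun I => z k * v I.
Proof.
move=> kS zk; have := sqnorm_sub_matcoef kS; rewrite zk expr1n subrr => /sqnorm_eq0 h.
apply/funext => I; apply/eqP; rewrite -subr_eq0; apply/eqP.
exact: (congr1 (fun f => f I) h).
Qed.

Lemma actZ (X : finType) (A : X -> X -> C) c (x : X -> C) :
  act A (fun i => c * x i) = fun i => c * act A x i.
Proof.
apply/funext => i; rewrite /act mulr_sumr; apply: eq_bigr => j _.
by rewrite mulrCA.
Qed.

Lemma matcoefM_eigen k l : k \in SU d -> normc (z k) = 1 ->
  z (l *m k) = z k * z l.
Proof.
by move=> kS zk; rewrite {1}/matcoef tensM act_kmul matcoef_eigen // actZ innerZl.
Qed.

Definition mxpow (k : 'M[C]_d) n := iter n (mulmx k) 1%:M.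

Lemma mxpowD k a b : mxpow k (a + b) = mxpow k a *m mxpow k b.
Proof.
elim: a => [|a IH]; first by rewrite mul1mx.
by rewrite addSn /= IH mulmxA.
Qed.

Lemma mxpow_SU k n : k \in SU d -> mxpow k n \in SU d.
Proof. by move=> kS; elim: n => [|n IH]; [exact: SU1 | exact: SU_mul]. Qed.

Lemma matcoef_pow k n : k \in SU d -> normc (z k) = 1 -> z (mxpow k n) = z k ^+ n.
Proof.
move=> kS zk; elim: n => [|n IH].
  by rewrite /matcoef tens1 act_kid -sqnormE v1 expr0.
have -> : mxpow k n.+1 = mxpow k n *m k.
  by rewrite -addn1 mxpowD /= mulmx1.
by rewrite matcoefM_eigen // IH exprS.
Qed.

(** The real and imaginary parts of the entries lie in a cube, which is cut into cells of side less
    than [h / 2]. The number of cells does not depend on the sequence; this uniformity is what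
    bounds the orders in [matcoef_torsion]. *)
Lemma mx_close_pigeonhole (h : R) : 0 < h -> exists n : nat, forall u : nat -> 'M[C]_d,
  (forall n, u n \is unitarymx) -> exists a b, [/\ (a < b <= n)%N & mx_close h (u a) (u b)].
Proof.
move=> h0; have h2 : 0 < h / 2 by lra.
have [L hL] := inv_small h2.
pose M := (2 * L.+1)%N.
pose T := {ffun 'I_d * 'I_d * bool -> 'I_M.+1}.
exists #|T| => u uu.
pose x n (p : 'I_d * 'I_d * bool) : R :=
  if p.2 then complex.Re (u n p.1.1 p.1.2) else complex.Im (u n p.1.1 p.1.2).
have x1 n p : `|x n p| <= 1.
  apply: le_trans (unitary_entry p.1.1 p.1.2 (uu n)); rewrite /x; case: ifP => _.
    exact: normc_Re.
  exact: normc_Im.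
have y0 n p : 0 <= (x n p + 1) * L.+1%:R.
  by rewrite mulr_ge0 //; have := x1 n p; rewrite ler_norml; lra.
pose c n : T := [ffun p => inord (Num.truncn ((x n p + 1) * L.+1%:R))].
have cE n p : c n p = Num.truncn ((x n p + 1) * L.+1%:R) :> nat.
  rewrite ffunE inordK // ltnS -(ler_nat R).
  have /andP[H _] := truncn_itv (y0 n p); apply: le_trans H _.
  rewrite /M natrM ler_wpM2r //; have := x1 n p; rewrite ler_norml; lra.
have close_c a b : c a = c b -> mx_close h (u a) (u b).
  move=> cab i j; apply: le_trans (normc_le _) _.
  have key p : `|x a p - x b p| <= h / 2.
    have := cE a p; rewrite cab cE => tE.
    have /andP[A1 A2] := truncn_itv (y0 a p).
    have /andP[B1 B2] := truncn_itv (y0 b p).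
    move: A1 A2 B1 B2; rewrite -tE; set t := Num.truncn _.
    rewrite -(@natr1 R t); set l := L.+1%:R => A1 A2 B1 B2.
    have l0 : 0 < l by rewrite ltr0n.
    have hl : 1 <= h / 2 * l by rewrite -ler_pdivrMr // div1r ltW.
    rewrite ler_norml; apply/andP; split; rewrite -(ler_pM2r l0); nra.
  have := key (i, j, true); have := key (i, j, false); rewrite /x /=.
  by rewrite [complex.Re (_ - _)]raddfB [complex.Im (_ - _)]raddfB /=; lra.
have [inj|] := boolP (injectiveb [ffun k : 'I_#|T|.+1 => c k]).
  have := leq_card _ (injectiveP _ inj); by rewrite card_ord ltnn.
move=> /injectivePn [a [b ab]]; rewrite !ffunE => cab.
have [lt|lt|/val_inj eq] := ltngtP a b; last by rewrite eq eqxx in ab.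
  by exists a, b; split; [rewrite lt -ltnS ltn_ord | exact: close_c].
by exists b, a; split; [rewrite lt -ltnS ltn_ord | exact: close_c].
Qed.

(** Two of the first powers of [k] are close, so a power with exponent at most [n] is close to 1.
    There [matcoef_near1] forces a coefficient of modulus 1 to equal 1; as [z] is multiplicative on
    the powers of [k], [z k] is a root of unity of order dividing the factorial of [n]. *)
Lemma matcoef_torsion : exists2 q, (0 < q)%N &
  forall k, k \in SU d -> normc (z k) = 1 -> z k ^+ q = 1.
Proof.
have [h h0 near] := matcoef_near1 v1 vmin (@ltr01 R).
have [|n hn] := mx_close_pigeonhole (_ : 0 < h / (d%:R + 1)).
  by rewrite divr_gt0 // ltr_wpDl.
exists n`!; first exact: fact_gt0.
move=> k kS zk.
have [a [b [/andP[ab bn] cl]]] := hn (mxpow k) (fun n => SU_unitary (mxpow_SU n kS)).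
have : z (mxpow k (b - a)) = 1.
  have kS' := mxpow_SU (b - a) kS.
  have zE := matcoef_pow (b - a) kS zk.
  have z1 : normc (z (mxpow k (b - a))) = 1 by rewrite zE normcX zk expr1n.
  have cl' : mx_close h (mxpow k (b - a)) 1%:M.
    have uA : (mxpow k a)^t* \is unitarymx.
      by rewrite trmxC_unitary; apply: SU_unitary; exact: mxpow_SU.
    have eb : mxpow k b = mxpow k a *m mxpow k (b - a) by rewrite -mxpowD subnKC // ltnW.
    have := mx_close_mull uA cl; rewrite eb mulmxA.
    rewrite unitary_adjK ?mul1mx; last by apply: SU_unitary; exact: mxpow_SU.
    move=> H i j; rewrite -opprB normcN; apply: le_trans (H i j) _.
    rewrite mulrCA ger_pMr // ler_pdivrMr ?ltr_wpDl // mul1r lerDl.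
    exact: ler01.
  have := near _ kS' cl'; rewrite z1 subrr mulr0 => H.
  apply/eqP; rewrite -subr_eq0; apply/eqP/Normc.eq0_normc/eqP.
  by rewrite eq_le H normc_ge0.
rewrite matcoef_pow // => zab.
have /dvdnP [e ->] : (b - a %| n`!)%N.
  by apply: dvdn_fact; rewrite subn_gt0 ab (leq_trans (leq_subr _ _) bn).
by rewrite mulnC exprM zab expr1n.
Qed.

Lemma normc_subX (x y : C) (r : R) N : normc x <= r -> normc y <= r ->
  normc (x ^+ N - y ^+ N) <= N%:R * r ^+ N.-1 * normc (x - y).
Proof.
move=> xr yr; have r0 : 0 <= r by apply: le_trans xr; exact: normc_ge0.
rewrite subrXX Normc.normcM mulrC ler_wpM2r ?normc_ge0 //.
apply: le_trans (normc_sum _ _) _.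
rewrite -[X in _ <= X%:R * _](card_ord N) mulr_natl -sumr_const.
apply: ler_sum => i _; rewrite Normc.normcM !normcX.
have -> : r ^+ N.-1 = r ^+ (N.-1 - i) * r ^+ i.
  by rewrite -exprD subnK // -ltnS (ltn_predK (ltn_ord i)).
by apply: ler_pM; rewrite ?exprn_ge0 ?normc_ge0 // ?lerXn2r ?nnegrE ?normc_ge0 //
  (_ : (N - i.+1 = N.-1 - i)%N) ?lerXn2r ?nnegrE ?normc_ge0 // -subn1 -subnDA.
Qed.

(* Multiplying [k] by an element of the stabiliser of the line of [v] changes
   [z k] by a root of unity of order [q], so [matcoef_near1] applies near every
   point where [normc (z k) = 1]. *)
Lemma matcoef_phase q : (0 < q)%N ->
  (forall k, k \in SU d -> normc (z k) = 1 -> z k ^+ q = 1) ->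
  forall e : R, 0 < e -> exists2 c : R, 0 < c &
  forall k N, k \in SU d -> 1 - c <= normc (z k) -> (q %| N)%N ->
  normc (z k ^+ N - (normc (z k))%:C ^+ N) <=
    e * (N%:R * normc (z k) ^+ N.-1 * (1 - normc (z k))).
Proof.
move=> q0 hq e e0; apply: contrapT => neg.
have [h h0 near] := matcoef_near1 v1 vmin e0.
(* Whenever [z k] factors through an element stabilising the line of [v] and one close to 1, the
   estimate holds ([G] below). Its failure for every [c] thus yields elements without such a
   factorisation whose coefficients have modulus tending to 1. *)
have bad n : {k | k \in SU d /\ 1 - n.+1%:R^-1 <= normc (z k) /\
   forall l k0, l \in SU d -> k0 \in SU d -> normc (z k0) = 1 ->
     z k = z k0 * z l -> ~ mx_close h l 1%:M }.
  apply: cid; apply: contrapT => no; apply: neg.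
  exists n.+1%:R^-1; first by rewrite invr_gt0.
  move=> k N kS zk qN; apply: contrapT => bad; apply: no.
  have G l k0 : l \in SU d -> k0 \in SU d -> normc (z k0) = 1 ->
     z k = z k0 * z l -> ~ mx_close h l 1%:M.
    move=> lS k0S z0 zE lh; apply: bad.
    have nE : normc (z k) = normc (z l) by rewrite zE Normc.normcM z0 mul1r.
    rewrite zE exprMn -zE.
    have -> : z k0 ^+ N = 1 by move/dvdnP: qN => [c ->]; rewrite mulnC exprM hq // expr1n.
    rewrite mul1r nE; apply: le_trans (normc_subX _ (lexx (normc (z l))) _) _.
      by rewrite normc_real ger0_norm ?normc_ge0.
    rewrite mulrCA; apply: ler_wpM2l; last exact: near.
    by rewrite mulr_ge0 ?exprn_ge0 ?normc_ge0.
  by exists k.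
pose k n := sval (bad n).
have kS n : k n \in SU d by case: (svalP (bad n)).
have kz n : 1 - n.+1%:R^-1 <= normc (z (k n)) by case: (svalP (bad n)) => _ [].
have kbad n l k0 : l \in SU d -> k0 \in SU d -> normc (z k0) = 1 ->
     z (k n) = z k0 * z l -> ~ mx_close h l 1%:M.
  by case: (svalP (bad n)) => _ [_]; exact.
have [|s sn [l hl]] := @compact_seqc _ _ (fun n (p : 'I_d * 'I_d) => k n p.1 p.2) 1.
  by move=> n p; apply: unitary_entry; exact: SU_unitary.
pose K : 'M[C]_d := \matrix_(i, j) l (i, j).
have hK i j : cvgs (fun n => k (s n) i j) (K i j) by rewrite mxE; exact: hl (i, j).
have KS : K \in SU d.
  rewrite inE; apply/andP; split.
    apply/unitarymxP/matrixP => i j.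
    have c1 : cvgs (fun n => (k (s n) *m (k (s n))^t* ) i j) ((K *m K^t* ) i j).
      rewrite (_ : (fun _ => _) = fun n => \sum_r k (s n) i r * Num.conj (k (s n) j r)).
        rewrite mxE; apply: cvgs_sum => r; apply: cvgsM => //.
        have -> : (K^t* ) r j = Num.conj (K j r) by rewrite !mxE.
        exact: cvgs_conj.
      by apply/funext => n; rewrite mxE; apply: eq_bigr => r _; rewrite !mxE.
    apply: cvgs_unique c1 _.
    rewrite (_ : (fun _ => _) = fun=> (1%:M : 'M[C]_d) i j); first exact: cvgs_cst.
    by apply/funext => n; rewrite (unitarymxP (SU_unitary (kS _))).
  have c1 : cvgs (fun n => \det (k (s n))) (\det K).
    apply: cvgs_sum => p; apply: cvgsM; first exact: cvgs_cst.
    exact: cvgs_prod.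
  apply/eqP; apply: cvgs_unique c1 _.
  rewrite (_ : (fun _ => _) = fun=> 1); first exact: cvgs_cst.
  by apply/funext => n; have := kS (s n); rewrite inE => /andP[_ /eqP].
have hz : cvgs (fun n => normc (z (k (s n)))) (normc (z K)).
  apply: cvgs_normc; apply: cvgs_inner; last by move=> I; exact: cvgs_cst.
  by apply: cvgs_act => [I J|I]; [apply: cvgs_prod | exact: cvgs_cst].
have zK : normc (z K) = 1.
  apply/eqP; rewrite eq_le matcoef_le1 //=.
  rewrite -subr_ge0 -(addr0 (normc _ - 1)).
  have c1 := cvgs_sub sn (@cvgs_inv R 1).
  apply: (@cvgs_ge _ (fun n => normc (z (k (s n))) - 1 + 1 / (s n).+1%:R)).
    by apply: cvgsD => //; apply: cvgsD => //; exact: cvgs_cst.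
  by move=> n /=; rewrite div1r addrAC subr_ge0 -lerBlDr; exact: kz.
have cl : exists n, mx_close (h / (d%:R + 1)) (k (s n)) K.
  have ex p : {N | forall n, (N <= n)%N -> normc (k (s n) p.1 p.2 - l p) < h / (d%:R + 1)}.
    apply: cid; have /cvgscP H := hl p.
    have [|N hN] := H (h / (d%:R + 1)); first by rewrite divr_gt0 // ltr_wpDl.
    by exists N => n /hN; rewrite subr0 ger0_norm ?normc_ge0.
  exists (\max_p sval (ex p)) => i j; rewrite mxE; apply: ltW.
  by apply: (svalP (ex (i, j))); exact: leq_bigmax.
case: cl => n cl.
have KS' := SU_adj KS; have KU := SU_unitary KS.
(* The limit [K] stabilises the line of [v], so that [K] and [K^t* *m k (s n)] form an excluded
   factorisation. *)
have kE : z (k (s n)) = z K * z (K^t* *m k (s n)).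
  have -> : z (K^t* *m k (s n)) = Num.conj (z K) * z (k (s n)).
    rewrite {1}/matcoef tensM act_kmul; set w := act (tens (k _)) v.
    rewrite [LHS]inner_act kadj_tens (_ : K^t*^t* = K); last exact: trmxCK.
    by rewrite matcoef_eigen // innerZr.
  by rewrite mulrA -normc_sqr zK expr1n mul1r.
apply: (kbad _ _ _ (SU_mul KS' (kS _)) KS zK kE).
have := mx_close_mull (SU_unitary KS') cl; rewrite unitary_adjK // => H i j.
apply: le_trans (H i j) _; rewrite mulrCA ger_pMr // ler_pdivrMr ?ltr_wpDl //.
by rewrite mul1r lerDl ler01.
Qed.

End MatrixCoefficient.

(** * Invariants of semistable tensors *)

Section Invariant.
Context {R : realType}.
Local Notation C := R[i].
Local Notation normc := Normc.normc.
Local Open Scope complex_scope.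

(** All [n] terms of the geometric sum are at least [x ^+ n.-1], and the sum times [1 - x] is
    [1 - x ^+ n]. *)
Lemma geometric_le (x : R) n : 0 <= x <= 1 -> n%:R * x ^+ n.-1 * (1 - x) <= 1.
Proof.
move=> /andP[x0 x1].
have H : (1 - x) * \sum_(i < n) x ^+ i <= 1.
  have := subrX1 x n; have := exprn_ge0 n x0; set s := \sum_(i < n) _; lra.
apply: le_trans H; rewrite mulrC ler_wpM2l ?subr_ge0 //.
rewrite -[n in n%:R]card_ord mulr_natl -sumr_const; apply: ler_sum => i _.
by apply: ler_wiXn2l => //; rewrite -ltnS (ltn_predK (ltn_ord i)).
Qed.

(* A polynomial lower bound on [Y] in the exponent [q * 2 ^ j] is incompatible
   with a faster geometric decay. *)
Lemma expn_doubling_contradiction (D q j0 : nat) (Y : nat -> R) :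
  (forall j, 1 <= (q * 2 ^ j).+1%:R ^+ D * Y j) -> (0 < q)%N ->
  Y j0 <= 1 ->
  ~ (forall j, (j0 <= j < j0 + (2 * q) ^ D * 2 ^ (D.+1 * j0))%N ->
       Y j.+1 <= (2 ^+ D.+1)^-1 * Y j).
Proof.
set M := (_ * 2 ^ _)%N => low q0 Y1 dec.
have up i : (i <= M)%N -> Y (j0 + i)%N * (2 ^+ D.+1) ^+ i <= 1.
  elim: i => [|i IH] iM; first by rewrite addn0 expr0 mulr1.
  apply: le_trans (IH (ltnW iM)); rewrite exprS mulrA ler_wpM2r ?exprn_ge0 //.
  have := dec (j0 + i)%N; rewrite leq_addr ltn_add2l iM => /(_ isT).
  by rewrite -ler_pdivlMr ?exprn_gt0 // addnS mulrC.
(* At [J] the two bounds leave [2 ^ M <= (2 * q) ^ D * 2 ^ (D * j0) <= M], which is absurd. *)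
have := up M (leqnn _); have := low (j0 + M)%N; set J := (j0 + M)%N => h1 h2.
have h3 : (2 ^+ D.+1) ^+ M <= (q * 2 ^ J).+1%:R ^+ D :> R.
  have p0 : 0 < (2 ^+ D.+1 : R) ^+ M by rewrite !exprn_gt0.
  have P0 : 0 < ((q * 2 ^ J).+1%:R : R) ^+ D by rewrite exprn_gt0.
  rewrite -[X in X <= _]mul1r; apply: le_trans (ler_wpM2r (ltW p0) h1) _.
  by rewrite -mulrA -[X in _ <= X]mulr1 ler_wpM2l // ltW.
have h4 : (q * 2 ^ J).+1%:R ^+ D <= ((2 * q * 2 ^ J) ^ D)%:R :> R.
  rewrite natrX lerXn2r ?nnegrE // ler_nat -mulnA mul2n -addnn -addn1 leq_add2l.
  by rewrite muln_gt0 q0 expn_gt0.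
have := le_trans h3 h4; rewrite -!exprM -natrX ler_nat leqNgt => /negP; apply.
rewrite expnMn -expnM /J mulnDl expnD mulnA.
rewrite (_ : D.+1 * M = M + M * D)%N; last by rewrite mulSn [(D * M)%N]mulnC.
rewrite expnD ltn_pmul2r ?expn_gt0 //.
apply: leq_ltn_trans (ltn_expl M (ltnSn 1)).
by rewrite /M leq_mul2l leq_exp2l // mulSn [(j0 * D)%N]mulnC leq_addl orbT.
Qed.

Section Unit.
Variables (m d : nat) (v : {ffun 'I_m -> 'I_d} -> C).
Hypothesis v1 : sqnorm v = 1.
Hypothesis vmin : forall g : 'M[C]_d, \det g = 1 -> 1 <= sqnorm (act (tens g) v).
Local Notation z := (matcoef v).

(** For modulus near 1 the phase estimate holds; half of the exponent is kept as the factor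
    [normc (z k) ^+ (2 * l)], and [geometric_le] absorbs the rest. Away from 1, that factor is
    itself at most [e]. *)
Lemma matcoef_doubling q (e c : R) k l : k \in SU d -> (0 < l)%N ->
  0 < e -> 0 < c ->
  (forall k N, k \in SU d -> 1 - c <= normc (z k) -> (q %| N)%N ->
    normc (z k ^+ N - (normc (z k))%:C ^+ N) <=
      e * (N%:R * normc (z k) ^+ N.-1 * (1 - normc (z k)))) ->
  (q %| 2 * (2 * l))%N -> (`|1 - c| ^+ (2 * l) <= e) ->
  normc (z k) ^+ (2 * (2 * l)) <=
    complex.Re (z k ^+ (2 * (2 * l))) + 2 * e * normc (z k) ^+ (2 * l).
Proof.
move=> kS l0 e0 c0 hc ql cl; set a := normc (z k); set N := (2 * (2 * l))%N.
have a0 : 0 <= a := normc_ge0 _.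
have a1 : a <= 1 := matcoef_le1 v1 kS.
suff H : normc (z k ^+ N - a%:C ^+ N) <= 2 * e * a ^+ (2 * l).
  have := le_trans (normc_Re _) H; rewrite ler_norml => /andP[+ _].
  rewrite [complex.Re (_ - _)]raddfB -rmorphXn /=; lra.
have [near|far] := leP (1 - c) a.
  apply: le_trans (hc _ _ kS near ql) _; rewrite [2 * e]mulrC -(mulrA e 2) ler_wpM2l ?(ltW e0) //.
  have := @geometric_le a (2 * l); rewrite a0 a1 => /(_ isT) G.
  have -> : N.-1 = (2 * l + (2 * l).-1)%N.
    have : (0 < 2 * l)%N by rewrite muln_gt0 l0.
    by rewrite /N; case: (2 * l)%N => // n _; rewrite mul2n -addnn addnS.
  rewrite /N natrM exprD.
  set A := a ^+ (2 * l); set B := a ^+ _; set n := (2 * l)%:R.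
  have A0 : 0 <= A by exact: exprn_ge0.
  have -> : 2 * n * (A * B) * (1 - a) = 2 * A * (n * B * (1 - a)) by ring.
  by rewrite -[X in _ <= X]mulr1 ler_wpM2l // mulr_ge0.
apply: le_trans (le_normcD _ _) _.
rewrite normcN -rmorphXn normc_real ger0_norm ?exprn_ge0 // normcX -/a.
have -> : a ^+ N = a ^+ (2 * l) * a ^+ (2 * l) by rewrite -exprD addnn -mul2n.
have : a ^+ (2 * l) <= e.
  apply: le_trans cl; rewrite lerXn2r ?nnegrE //.
  exact: le_trans (ltW far) (ler_norm _).
have := exprn_ge0 (2 * l) a0; set A := a ^+ _; nra.
Qed.

Lemma unit_invariant : exists N (u : {ffun 'I_N -> {ffun 'I_m -> 'I_d}} -> C),
  [/\ (0 < N)%N, forall k, k \in SU d -> act (tens2 k) u = u & inner (tpow v) u != 0].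
Proof.
apply: contrapT => none.
have {none} zero N u : (0 < N)%N -> (forall k, k \in SU d -> act (tens2 k) u = u) ->
    inner (tpow (N:=N) v) u = 0.
  by move=> N0 ufix; apply: contrapT => /eqP neq; apply: none; exists N, u.
have [q q0 hq] := matcoef_torsion v1 vmin.
pose D := #|{ffun 'I_m -> 'I_d}|.
(* The decay to be proved is by the factor [4 * e]: one half pays for the phase error, the other for
   the average of the powers of [z]. *)
pose e : R := (2 ^+ D.+1)^-1 / 4.
have e0 : 0 < e by rewrite divr_gt0 ?invr_gt0 ?exprn_gt0.
have [c1 c10 hc1] := matcoef_phase v1 vmin q0 hq e0.
pose c := Num.min c1 2^-1.
have c0 : 0 < c by rewrite lt_min c10 invr_gt0 /=.
have cle : c <= 2^-1 by rewrite ge_min lexx orbT.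
have hc k N : k \in SU d -> 1 - c <= normc (z k) -> (q %| N)%N ->
    normc (z k ^+ N - (normc (z k))%:C ^+ N) <=
      e * (N%:R * normc (z k) ^+ N.-1 * (1 - normc (z k))).
  move=> kS h; apply: hc1 => //; apply: le_trans h.
  by rewrite lerD2l lerN2 ge_min lexx.
have c1' : `|1 - c| < 1 by rewrite ger0_norm; lra.
have [j0 hj0] : exists j0, forall j, (j0 <= j)%N -> `|1 - c| ^+ (2 * (q * 2 ^ j)) <= e.
  have /cvgsP := @cvg_expr R (1 - c) c1'.
  move=> /(_ e e0) [M hM]; exists M => j Mj.
  have := hM (2 * (q * 2 ^ j))%N; rewrite subr0 normrX => /(_ _) H; apply: ltW; apply: H.
  apply: leq_trans Mj _; apply: leq_trans (ltnW (ltn_expl j (ltnSn 1))) _.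
  by rewrite mulnA leq_pmull // muln_gt0.
pose Y s j := (\sum_(k <- conv s) normc (z k) ^+ (2 * (q * 2 ^ j))) / (size s)%:R ^+ 2.
have Ylow s j : (0 < size s)%N -> all (mem (SU d)) s ->
    1 <= (q * 2 ^ j).+1%:R ^+ D * Y s j.
  move=> s0 sS; have := sum_conv_normc v1 (q * 2 ^ j) sS.
  rewrite natrX /Y mulrA => h; rewrite ler_pdivlMr ?mul1r //.
  by rewrite exprn_gt0 // ltr0n.
have Y1 s j : (0 < size s)%N -> all (mem (SU d)) s -> Y s j <= 1.
  move=> s0 sS; rewrite ler_pdivrMr ?exprn_gt0 ?ltr0n // mul1r.
  rewrite -natrX -mulnn.
  have <- : size (conv s) = (size s * size s)%N by rewrite size_allpairs.
  apply: (@le_trans _ _ (\sum_(k <- conv s) 1)).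
    rewrite big_seq [leRHS]big_seq; apply: ler_sum => k ks.
    have kS : k \in SU d := allP (conv_SU sS) k ks.
    by rewrite exprn_ile1 ?normc_ge0 // matcoef_le1.
  by rewrite big_const_seq count_predT iter_addr_0.
pose M := ((2 * q) ^ D * 2 ^ (D.+1 * j0))%N.
pose J := (j0 + M)%N.
(* Fixed before [s] is chosen: by [Ylow] it is at most [2 * e * Y s j] for all [j <= J], whichever
   [s] is taken. *)
pose eta : R := 2 * e / (q * 2 ^ J).+1%:R ^+ D.
have eta0 : 0 < eta by rewrite divr_gt0 ?exprn_gt0 // mulr_gt0.
have [s [s0 sS hs]] := mean_ergodic_upto (2 * (2 * (q * 2 ^ J)))%N zero eta0.
have n0 : 0 < (size s)%:R ^+ 2 :> R by rewrite exprn_gt0 // ltr0n.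
apply: (@expn_doubling_contradiction D q j0 (Y s)) => [j|//||j].
- exact: Ylow.
- exact: Y1.
rewrite -/M -/J => /andP[jj0 jJ].
pose l := (q * 2 ^ j)%N.
have l0 : (0 < l)%N by rewrite muln_gt0 q0 expn_gt0.
have lJ : (q * 2 ^ j <= q * 2 ^ J)%N by rewrite leq_mul2l leq_exp2l ?(ltnW jJ) ?orbT.
have step : Y s j.+1 <= eta + 2 * e * Y s j.
  have El : (q * 2 ^ j.+1 = 2 * l)%N by rewrite expnS mulnCA.
  rewrite /Y El -/l.
  rewrite -[eta](mulfK (lt0r_neq0 n0)) [2 * e * _]mulrA -mulrDl ler_pM2r ?invr_gt0 //.
  rewrite mulr_sumr.
  apply: (@le_trans _ _ (\sum_(k <- conv s) (complex.Re (z k ^+ (2 * (2 * l))) +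
     2 * e * normc (z k) ^+ (2 * l)))).
    rewrite big_seq [leRHS]big_seq; apply: ler_sum => k ks.
    apply: (@matcoef_doubling q e c) => //.
    - exact: (allP (conv_SU sS)).
    - by apply: dvdn_mull; apply: dvdn_mull; exact: dvdn_mulr.
    - exact: hj0.
  rewrite big_split /= lerD2r -(raddf_sum (@complex.Re R)) sum_conv_matcoefX //=.
  rewrite mulrC ler_pM2r //; apply/ltW/hs/andP; split; first by rewrite 2!muln_gt0 l0.
  by rewrite 2!leq_mul2l /=; exact: lJ.
apply: le_trans step _.
have -> : (2 ^+ D.+1)^-1 = 4 * e by rewrite /e mulrC divfK // pnatr_eq0.
suff : eta <= 2 * e * Y s j by lra.
have e2 : 0 < 2 * e by rewrite mulr_gt0.
rewrite /eta (ler_pM2l e2) -[X in X <= _]mul1r.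
rewrite ler_pdivrMr ?exprn_gt0 // mulrC.
apply: le_trans (Ylow s j s0 sS) _.
apply: ler_wpM2r.
  rewrite /Y divr_ge0 ?(ltW n0) // sumr_ge0 // => k _.
  by rewrite exprn_ge0 ?normc_ge0.
by rewrite lerXn2r ?nnegrE // ler_nat ltnS.
Qed.
End Unit.
End Invariant.

Section SemistableInvariant.
Context {R : realType}.
Local Notation C := R[i].
Local Notation normc := Normc.normc.
Local Open Scope complex_scope.
Variables (m d : nat).

Lemma tpowZ (X : finType) N (c : C) (x : X -> C) :
  tpow (N:=N) (fun i => c * x i) = fun I => c ^+ N * tpow x I.
Proof.
by apply/funext => I; rewrite /tpow big_split /= prodr_const card_ord.
Qed.

(** An invariant that does not vanish at the minimal vector [v], scaled to norm 1, is constant on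
    the orbit of [t] and continuous; as [v] is a limit of that orbit, the invariant takes the same
    value at [t] and at [v]. *)
Theorem semistable_invariant (t : {ffun 'I_m -> 'I_d} -> C) (e : R) : 0 < e ->
  (forall g : 'M[C]_d, \det g = 1 -> e <= sqnorm (act (tens g) t)) ->
  exists N (u : {ffun 'I_N -> {ffun 'I_m -> 'I_d}} -> C),
    [/\ (0 < N)%N, forall g, \det g = 1 -> act (tens2 g) u = u & inner (tpow t) u != 0].
Proof.
move=> e0 /(minimal_vector e0) [v [g [dg gv v0 vmin]]].
pose c : R := (Num.sqrt (sqnorm v))^-1.
have c0 : c != 0 by rewrite invr_eq0 sqrtr_eq0 -ltNge.
have cn x : sqnorm (fun I => c%:C * x I) = (sqnorm v)^-1 * sqnorm x :> R.
  by rewrite sqnormZ normc_real real_normK ?num_real // /c exprVn sqr_sqrtr // ltW.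
have w1 : sqnorm (fun I => c%:C * v I) = 1 by rewrite cn mulVf // gt_eqF.
have wmin (h : 'M[C]_d) : \det h = 1 -> 1 <= sqnorm (act (tens h) (fun I => c%:C * v I)).
  by move=> dh; rewrite actZ cn mulrC ler_pdivlMr // mul1r vmin.
have [N [u [N0 ufix]]] := unit_invariant w1 wmin.
rewrite tpowZ innerZl mulf_eq0 negb_or => /andP[_ uv].
have {}ufix := SU_fixed_SL_fixed ufix.
exists N, u; split=> //; apply: contraNneq uv => ut; apply/eqP.
have c1 : cvgs (fun n => inner (tpow (N:=N) (act (tens (g n)) t)) u) (inner (tpow v) u).
  apply: cvgs_inner => I; last exact: cvgs_cst.
  by apply: cvgs_prod => k; exact: gv.
apply: cvgs_unique c1 _.
rewrite (_ : (fun _ => _) = fun=> 0); first exact: cvgs_cst.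
apply/funext => n; rewrite -act_kron_tpow inner_act -/(tens2 (g n)) kadj_tens2 ufix //.
by rewrite det_adj dg rmorph1.
Qed.

(** The polar decomposition reduces the claim to a positive diagonal matrix of determinant 1. The
    logarithms of its entries sum to 0, so by the equidistribution of each index the linear term
    vanishes, and [expR x >= 1 + x] does the rest. *)
Lemma balanced_minimal (t : {ffun 'I_m -> 'I_d} -> C) :
  (forall (P : 'M[C]_d) a j, P \is unitarymx ->
     \sum_(I : {ffun 'I_m -> 'I_d} | I a == j) normc (act (tens P) t I) ^+ 2 = 1) ->
  forall g : 'M[C]_d, \det g = 1 -> sqnorm t <= sqnorm (act (tens g) t).
Proof.
move=> bal g /polar [k [P [s [kS uP s0 ps ->]]]].
rewrite tensM act_kmul sqnorm_unitary; last by case/andP: kS.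
rewrite -mulmxA tensM act_kmul.
rewrite sqnorm_unitary ?trmxC_unitary // tensM act_kmul tens_diag_act.
rewrite -(sqnorm_unitary t uP); set t' := act _ t.
pose r j := complex.Re (s ord0 j).
have sE j : s ord0 j = (r j)%:C by rewrite /r RRe_real // gtr0_real.
have r0 j : 0 < r j by rewrite -ltcR -sE.
have pr : \prod_j r j = 1.
  apply: complexI; rewrite rmorph_prod rmorph1 -[RHS]ps; apply: eq_bigr => j _.
  by rewrite sE.
have lnr : \sum_j ln (r j) = 0.
  by apply: expR_inj; rewrite expR_sum expR0 -[RHS]pr; apply: eq_bigr => j _; rewrite lnK // posrE.
have E : \sum_I normc (t' I) ^+ 2 * (\sum_a 2 * ln (r (I a))) = 0.
  under eq_bigr do rewrite mulr_sumr; rewrite exchange_big big1 //= => a _.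
  rewrite (partition_big (fun I : {ffun 'I_m -> 'I_d} => I a) xpredT) //=.
  rewrite (eq_bigr (fun j => 2 * ln (r j))); first by rewrite -mulr_sumr lnr mulr0.
  move=> j _; rewrite (eq_bigr (fun I => normc (t' I) ^+ 2 * (2 * ln (r j)))); last first.
    by move=> I /eqP ->.
  by rewrite -mulr_suml bal // mul1r.
rewrite -[leLHS]addr0 -[X in _ + X <= _]E /sqnorm -big_split /=; apply: ler_sum => I _.
rewrite Normc.normcM exprMn mulrC -[X in X + _]mulr1 mulrC -mulrDr mulrC.
apply: ler_wpM2r; first by rewrite exprn_ge0 ?normc_ge0.
apply: le_trans (expR_ge1Dx _) _; rewrite expR_sum.
under [X in _ <= normc X ^+ 2]eq_bigr do rewrite sE.
rewrite -rmorph_prod normc_real real_normK ?num_real // -prodrXl.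
by apply: ler_prod => a _; rewrite expR_ge0 expRM_natl lnK ?posrE //=.
Qed.

(** The symmetric tensor of the sum of the m-th powers of the variables. *)
Definition fermat (F : comNzRingType) : {ffun 'I_m -> 'I_d} -> F :=
  fun I => \sum_j tpow (fun i => (i == j)%:R) I.

Lemma fermat_balanced (P : 'M[C]_d) a j : (2 <= m)%N -> P \is unitarymx ->
  \sum_(I : {ffun 'I_m -> 'I_d} | I a == j) normc (act (tens P) (@fermat C) I) ^+ 2 = 1.
Proof.
move=> m2 uP; pose col p i := P i p.
have tE : act (tens P) (@fermat C) = fun I => \sum_p tpow (col p) I.
  apply/funext => I; rewrite /fermat {1}/act; under eq_bigr do rewrite mulr_sumr.
  rewrite exchange_big; apply: eq_bigr => p _ /=.
  rewrite -[LHS]/(act (kron P) (tpow (fun i => (i == p)%:R)) I) act_kron_tpow.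
  congr (tpow _ _); apply/funext => i; rewrite /act (bigD1 p) //= eqxx mulr1 big1 ?addr0 //.
  by move=> q /negPf ->; rewrite mulr0.
have orth p q : \sum_i col p i * Num.conj (col q i) = (p == q)%:R.
  have := unitary_adjK uP; move=> /(congr1 (fun A : 'M_d => A q p)).
  rewrite !mxE eq_sym => <-; apply: eq_bigr => i _; rewrite !mxE mulrC //.
have rown : \sum_p col p j * Num.conj (col p j) = 1.
  have := unitarymxP uP; move=> /(congr1 (fun A : 'M_d => A j j)).
  by rewrite !mxE eqxx => h; rewrite -[RHS]/(true%:R) -h; apply: eq_bigr => p _; rewrite !mxE.
apply: complexI; rewrite rmorph_sum rmorph1 tE.
transitivity (\sum_p \sum_q \sum_(I : {ffun 'I_m -> 'I_d} | I a == j)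
   tpow (col p) I * Num.conj (tpow (col q) I)).
  under [RHS]eq_bigr do rewrite exchange_big.
  rewrite exchange_big; apply: eq_bigr => I _; rewrite [LHS]normc_sqr rmorph_sum.
  by rewrite mulr_suml; apply: eq_bigr => p _; rewrite mulr_sumr.
rewrite -rown; apply: eq_bigr => p _.
rewrite (bigD1 p) //= [X in _ + X]big1 ?addr0 => [|q qp].
  transitivity (\prod_b \sum_i ((b == a) ==> (i == j))%:R * (col p i * Num.conj (col p i))).
    rewrite bigA_distr_bigA big_mkcond; apply: eq_bigr => I _ /=.
    rewrite big_split /= /tpow rmorph_prod -big_split /=; case: ifPn => Ia.
      by rewrite [X in X * _]big1 ?mul1r // => b _; case: eqVneq => [->|] //=; rewrite Ia.
    by rewrite (bigD1 a) //= eqxx (negPf Ia) !mul0r.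
  rewrite (bigD1 a) //= [X in _ * X]big1 ?mulr1 => [|b /negPf ba].
    rewrite (bigD1 j) //= !eqxx mul1r big1 ?addr0 // => i /negPf ij.
    by rewrite ij mul0r.
  by under eq_bigr do rewrite ba mul1r; rewrite orth eqxx.
transitivity (\prod_b \sum_i ((b == a) ==> (i == j))%:R * (col p i * Num.conj (col q i))).
  rewrite bigA_distr_bigA big_mkcond; apply: eq_bigr => I _ /=.
  rewrite big_split /= /tpow rmorph_prod -big_split /=; case: ifPn => Ia.
    by rewrite [X in X * _]big1 ?mul1r // => b _; case: eqVneq => [->|] //=; rewrite Ia.
  by rewrite (bigD1 a) //= eqxx (negPf Ia) !mul0r.
(* As [m >= 2] there is a second index, whose factor is the inner product of two distinct columns of
   [P], hence 0. *)
have [b ba] : exists b, b != a.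
  by case: (eqVneq (Ordinal (ltnW m2)) a) => [<-|]; [exists (Ordinal m2) | exists (Ordinal (ltnW m2))].
rewrite (bigD1 b) //= (negPf ba); under eq_bigr do rewrite mul1r.
by rewrite orth eq_sym (negPf qp) mul0r.
Qed.

Lemma fermat_semistable (g : 'M[C]_d) : (2 <= m)%N -> (1 <= d)%N -> \det g = 1 ->
  1 <= sqnorm (act (tens g) (@fermat C)).
Proof.
move=> m2 d1 dg.
apply: le_trans (balanced_minimal (fun P a j => @fermat_balanced P a j m2) dg).
pose j0 : 'I_d := Ordinal d1.
apply: le_trans (sqnorm_coord _ [ffun=> j0]).
have -> : @fermat C [ffun=> j0] = 1.
  rewrite /fermat (bigD1 j0) //= /tpow big1 => [|k _]; last by rewrite ffunE eqxx.
  rewrite big1 ?addr0 // => j jj0; rewrite (bigD1 (Ordinal (ltnW m2))) //= ffunE.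
  by rewrite eq_sym (negPf jj0) mul0r.
by rewrite Normc.normc1 expr1n.
Qed.

End SemistableInvariant.

(** * Forms as symmetric tensors *)

Section FormTensor.
Context {F : comNzRingType} {m d : nat}.
Local Notation T := {ffun 'I_m -> 'I_d}.
Implicit Types (I J : T) (t s : T -> F).

Definition monomial I : 'X_{1..d} := (\sum_k U_(I k))%MM.

Lemma mdeg_monomial I : mdeg (monomial I) = m.
Proof.
rewrite /monomial mdeg_sum (eq_bigr (fun=> 1%N)) => [|k _]; last by rewrite mdeg1.
by rewrite sum1_card card_ord.
Qed.

Lemma mpolyX_monomial (r : comNzRingType) I : 'X_[r, monomial I] = \prod_k 'X_(I k).
Proof. exact: (big_morph (fun a => (mpolyX r a : {mpoly r[d]})) (@mpolyXD d r) (@mpolyX0 d r)). Qed.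

Definition of_tens t : {mpoly F[d]} := \sum_I t I *: 'X_[monomial I].

Lemma mcoeff_of_tens t a : (of_tens t)@_a = \sum_(I | monomial I == a) t I.
Proof.
rewrite /of_tens raddf_sum [RHS]big_mkcond /=; apply: eq_bigr => I _.
by rewrite mcoeffZ mcoeffX; case: eqP; rewrite ?mulr1 ?mulr0.
Qed.

Lemma of_tens_homog t : of_tens t \is m.-homog.
Proof. by apply: rpred_sum => I _; apply: rpredZ; rewrite dhomogX; apply/eqP; exact: mdeg_monomial. Qed.

Definition monomial_card (a : 'X_{1..d}) := #|[set I : T | monomial I == a]|.

(** Symmetric tensors stay symmetric: the entry at [I] is a linear functional [L] of the polynomial
    obtained from ['X_[monomial I]] by the substitution [b], and this polynomial depends on [I] only
    through its monomial. *)
Lemma act_tens_monomial (b : 'M[F]_d) (s : 'X_{1..d} -> F) I J : monomial I = monomial J ->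
  act (tens b) (s \o monomial) I = act (tens b) (s \o monomial) J.
Proof.
pose row (i : 'I_d) : {mpoly F[d]} := \sum_j b i j *: 'X_j.
have E (I0 : T) : 'X_[monomial I0] \mPo [tuple row i | i < d] =
    \sum_J tens b I0 J *: 'X_[monomial J].
  rewrite mpolyX_monomial rmorph_prod /=.
  under eq_bigr do rewrite comp_mpolyXU -tnth_nth tnth_mktuple.
  rewrite bigA_distr_bigA; apply: eq_bigr => J0 _.
  by rewrite mpolyX_monomial scaler_prod.
pose L (p : {mpoly F[d]}) := \sum_(a : 'X_{1..d < m.+1}) p@_a * s a.
have EL (I0 : T) : L ('X_[monomial I0] \mPo [tuple row i | i < d]) = act (tens b) (s \o monomial) I0.
  rewrite E /L; under eq_bigr do rewrite raddf_sum mulr_suml.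
  rewrite exchange_big; apply: eq_bigr => J0 _ /=.
  have lt : (mdeg (monomial J0) < m.+1)%N by rewrite mdeg_monomial.
  rewrite (bigD1 (BMultinom lt)) //= mcoeffZ mcoeffX eqxx mulr1 big1 ?addr0 //.
  move=> a /negP aJ; rewrite mcoeffZ mcoeffX; case: eqP => [eq|]; last by rewrite mulr0 mul0r.
  by case: aJ; rewrite -val_eqE /= -eq.
by rewrite -!EL => ->.
Qed.

End FormTensor.

Lemma exists_monomial m d (a : 'X_{1..d}) : mdeg a = m ->
  exists I : {ffun 'I_m -> 'I_d}, monomial I = a.
Proof.
elim: m a => [|m IH] a.
  move=> /eqP; rewrite mdeg_eq0 => /eqP ->.
  exists (finfun (fun k : 'I_0 => False_rect 'I_d (notF (ltn_ord k)))).
  by rewrite /monomial big_ord0.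
move=> am; have [i ai] : exists i, (0 < a i)%N.
  apply/existsP; rewrite -[X in is_true X]negbK negb_exists; apply/negP => /forallP h.
  move: am; rewrite mdegE big1 // => i _; by have := h i; rewrite lt0n negbK => /eqP.
have le : (U_(i) <= a)%MM by rewrite lep1mP -lt0n.
have ma : mdeg (a - U_(i)) = m.
  by have := congr1 mdeg (submK le); rewrite mdegD mdeg1 am addn1 => -[].
have [I IE] := IH _ ma.
exists [ffun k => if unlift ord0 k is Some k' then I k' else i].
rewrite /monomial big_ord_recl ffunE unlift_none.
under eq_bigr do rewrite ffunE liftK.
by rewrite -/(monomial I) IE addmC submK.
Qed.

Lemma monomial_card_gt0 m d (a : 'X_{1..d}) : mdeg a = m -> (0 < monomial_card (m:=m) a)%N.
Proof.
by move=> /exists_monomial [I IE]; apply/card_gt0P; exists I; rewrite inE IE.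
Qed.

Section FormToTensor.
Context {F : numFieldType} {m d : nat}.
Local Notation T := {ffun 'I_m -> 'I_d}.
Implicit Types (I J : T) (t s : T -> F) (p : {mpoly F[d]}).

(** Each coefficient is shared equally among the index functions of its monomial, so that the tensor
    is symmetric. *)
Definition tensor_of p : T -> F := fun I => p@_(monomial I) / (monomial_card (m:=m) (monomial I))%:R.

Lemma monomial_card_neq0 I : (monomial_card (m:=m) (monomial I))%:R != 0 :> F.
Proof. by rewrite pnatr_eq0 -lt0n monomial_card_gt0 // mdeg_monomial. Qed.

Lemma of_tensK (s : 'X_{1..d} -> F) : tensor_of (of_tens (m:=m) (s \o monomial)) = s \o monomial.
Proof.
apply/funext => I; rewrite /tensor_of mcoeff_of_tens.
rewrite (eq_bigr (fun=> s (monomial I))); last by move=> J /eqP /= ->.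
rewrite sumr_const -[X in X / _]mulr_natr -mulrA (_ : #|_| = monomial_card (m:=m) (monomial I)).
  by rewrite mulfV ?mulr1 // monomial_card_neq0.
by apply: eq_card => J; rewrite !inE.
Qed.

Lemma tensor_ofK p : p \is m.-homog -> of_tens (tensor_of p) = p.
Proof.
move=> hp; apply/mpolyP => a; rewrite mcoeff_of_tens.
have [am|am] := eqVneq (mdeg a) m.
  rewrite (eq_bigr (fun=> p@_a / (monomial_card (m:=m) a)%:R)); last by move=> I /eqP <-.
  rewrite sumr_const -[LHS]mulr_natr -mulrA (_ : #|_| = monomial_card (m:=m) a).
    by rewrite mulVf ?mulr1 // pnatr_eq0 -lt0n monomial_card_gt0.
  by apply: eq_card => J; rewrite !inE.
rewrite (dhomog_nemf_coeff hp am) big1 // => I /eqP eq.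
by rewrite -eq mdeg_monomial eqxx in am.
Qed.

Lemma comp_of_tens t (phi : 'M[F]_d) :
  comp_linear (of_tens t) phi = of_tens (act (tens phi^T) t).
Proof.
rewrite /comp_linear /of_tens raddf_sum /=.
transitivity (\sum_I \sum_J (tens phi^T J I * t I) *: 'X_[monomial J] : {mpoly F[d]}).
  apply: eq_bigr => I _; rewrite comp_mpolyZ mpolyX_monomial rmorph_prod /=.
  under eq_bigr do rewrite comp_mpolyXU -tnth_nth tnth_mktuple.
  rewrite bigA_distr_bigA scaler_sumr; apply: eq_bigr => J _.
  rewrite mpolyX_monomial scaler_prod scalerA mulrC; congr (_ * _ *: _).
  by apply: eq_bigr => k _; rewrite mxE.
rewrite exchange_big; apply: eq_bigr => J _ /=.
by rewrite -scaler_suml.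
Qed.

Lemma comp_linear_homog p (phi : 'M[F]_d) : p \is m.-homog ->
  comp_linear p phi \is m.-homog.
Proof. by move=> /tensor_ofK <-; rewrite comp_of_tens of_tens_homog. Qed.

Lemma tensor_of_comp p (phi : 'M[F]_d) : p \is m.-homog ->
  tensor_of (comp_linear p phi) = act (tens phi^T) (tensor_of p).
Proof.
move=> hp; rewrite -{1}(tensor_ofK hp) comp_of_tens.
(* The value at a monomial is read off at a chosen index function; by [act_tens_monomial] the choice
   is immaterial. *)
pose s a : F := if pselect (exists I : T, monomial I = a) is left h
  then act (tens phi^T) (tensor_of p) (sval (cid h)) else 0.
suff -> : act (tens phi^T) (tensor_of p) = s \o monomial by exact: of_tensK.
apply/funext => I /=; rewrite /s; case: pselect => [h|[]]; last by exists I.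
case: cid => J JI /=.
exact: (@act_tens_monomial _ _ _ _ (fun a => p@_a / (monomial_card (m:=m) a)%:R)).
Qed.

Lemma tensor_ofZ c p : tensor_of (c *: p) = fun I => c * tensor_of p I.
Proof. by apply/funext => I; rewrite /tensor_of mcoeffZ mulrA. Qed.

End FormToTensor.

(** * Interpolation errors on simplices *)

Section MSize.
Context {F : fieldType} {n : nat}.
Implicit Types (p q : {mpoly F[n]}).

Lemma msizeP p k : reflect (forall a, (k <= mdeg a)%N -> p@_a = 0) (msize p <= k)%N.
Proof.
apply: (iffP idP) => [pk a ka|h].
  by apply/eqP; rewrite mcoeff_eq0 msize_mdeg_ge // (leq_trans pk).
rewrite msizeE; apply/bigmax_leqP_seq => a ap _; rewrite ltnNge.
by apply/negP => /h /eqP; rewrite mcoeff_eq0 ap.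
Qed.

Lemma msizeD_leq p q k : (msize p <= k)%N -> (msize q <= k)%N -> (msize (p + q) <= k)%N.
Proof. by move=> /msizeP hp /msizeP hq; apply/msizeP => a ka; rewrite mcoeffD hp ?hq ?addr0. Qed.

Lemma msizeB_leq p q k : (msize p <= k)%N -> (msize q <= k)%N -> (msize (p - q) <= k)%N.
Proof. by move=> /msizeP hp /msizeP hq; apply/msizeP => a ka; rewrite mcoeffB hp ?hq ?subr0. Qed.

Lemma msizeZ_leq c p k : (msize p <= k)%N -> (msize (c *: p) <= k)%N.
Proof. by move=> /msizeP hp; apply/msizeP => a ka; rewrite mcoeffZ hp ?mulr0. Qed.

Lemma msize_sum_leq I (r : seq I) (P : pred I) (f : I -> {mpoly F[n]}) k :
  (forall i, P i -> (msize (f i) <= k)%N) -> (msize (\sum_(i <- r | P i) f i) <= k)%N.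
Proof.
move=> h; apply: (big_ind (fun p => (msize p <= k)%N)) => //.
  by rewrite msize0.
by move=> p q; exact: msizeD_leq.
Qed.

Lemma msizeM_leq p q a b : (msize p <= a.+1)%N -> (msize q <= b.+1)%N ->
  (msize (p * q) <= (a + b).+1)%N.
Proof.
have [->|p0] := eqVneq p 0; first by rewrite mul0r msize0.
have [->|q0] := eqVneq q 0; first by rewrite mulr0 msize0.
move=> pa qb; rewrite msizeM //; have := leq_add pa qb.
by rewrite addSn addnS; case: (_ + _)%N.
Qed.

Lemma msizeC_leq (c : F) k : (msize (c%:MP : {mpoly F[n]}) <= k.+1)%N.
Proof. by apply: leq_trans (_ : 1 <= _)%N => //; rewrite msizeC; case: eqP. Qed.

Lemma msize_prod_leq I (r : seq I) (f : I -> {mpoly F[n]}) (e : I -> nat) :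
  (forall i, (msize (f i) <= (e i).+1)%N) ->
  (msize (\prod_(i <- r) f i) <= (\sum_(i <- r) e i).+1)%N.
Proof.
move=> h; elim: r => [|i r IH]; first by rewrite !big_nil msizeC_leq.
by rewrite !big_cons; apply: msizeM_leq.
Qed.

(** By telescoping: changing affine factors by constants leaves the top-degree part of their product
    unchanged. *)
Lemma msize_prod_shift I (r : seq I) (f g : I -> {mpoly F[n]}) :
  (forall i, (msize (f i) <= 2)%N) -> (forall i, (msize (g i - f i) <= 1)%N) ->
  (msize (\prod_(i <- r) g i - \prod_(i <- r) f i) <= size r)%N.
Proof.
move=> f2 gf; have g2 i : (msize (g i) <= 2)%N.
  by rewrite -(subrK (f i) (g i)); apply: msizeD_leq => //; apply: leq_trans (gf i) _.
elim: r => [|i r IH]; first by rewrite !big_nil subrr msize0.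
rewrite !big_cons /=.
have -> : g i * \prod_(j <- r) g j - f i * \prod_(j <- r) f j =
  (g i - f i) * \prod_(j <- r) g j + f i * (\prod_(j <- r) g j - \prod_(j <- r) f j) by ring.
have gr : (msize (\prod_(j <- r) g j) <= (size r).+1)%N.
  have := @msize_prod_leq _ r g (fun=> 1%N) g2; by rewrite sum1_size.
apply: msizeD_leq.
  by have := msizeM_leq (gf i) gr.
have [->|nz] := eqVneq (\prod_(j <- r) g j - \prod_(j <- r) f j) 0.
  by rewrite mulr0 msize0.
have : (0 < size r)%N by rewrite (leq_trans _ IH) // lt0n msize_poly_eq0.
case: (size r) IH => // k IH _.
by have := msizeM_leq (f2 i) IH.
Qed.

Definition affine_comp (b : 'rV[F]_n) (A : 'M[F]_n) p : {mpoly F[n]} :=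
  p \mPo [tuple (b ord0 j)%:MP + \sum_i A i j *: 'X_i | j < n].

Lemma msize_linear (c : 'I_n -> F) : (msize (\sum_i c i *: 'X_i : {mpoly F[n]}) <= 2)%N.
Proof. by apply: msize_sum_leq => i _; apply: msizeZ_leq; rewrite msizeX mdeg1. Qed.

Lemma compX_monomial m (I : {ffun 'I_m -> 'I_n}) (l : n.-tuple {mpoly F[n]}) :
  'X_[monomial I] \mPo l = \prod_k tnth l (I k).
Proof.
rewrite mpolyX_monomial rmorph_prod /=; apply: eq_bigr => k _.
by rewrite comp_mpolyXU -tnth_nth.
Qed.

Lemma msize_affine_comp b A p k : (msize p <= k)%N -> (msize (affine_comp b A p) <= k)%N.
Proof.
move=> pk; rewrite /affine_comp [p]mpolyE raddf_sum /= big_seq.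
apply: msize_sum_leq => a ap; rewrite comp_mpolyZ; apply: msizeZ_leq.
have [I <-] := exists_monomial (erefl (mdeg a)).
rewrite compX_monomial; apply: leq_trans (_ : (mdeg a).+1 <= _)%N; last first.
  by apply: leq_trans pk; exact: msize_mdeg_lt.
have := @msize_prod_leq _ (index_enum 'I_(mdeg a))
  (fun k => tnth [tuple (b ord0 j)%:MP + \sum_i A i j *: 'X_i | j < n] (I k)) (fun=> 1%N).
rewrite sum1_card card_ord; apply=> i; rewrite tnth_mktuple.
by apply: msizeD_leq; [exact: msizeC_leq | exact: msize_linear].
Qed.

End MSize.

Section Affine.
Context {R : realType} {d : nat}.

Lemma peval_affine_comp b (A : 'M[R]_d) p (y : 'rV[R]_d) :
  peval (affine_comp b A p) y = peval p (b + y *m A).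
Proof.
rewrite /peval /affine_comp comp_mpoly_meval; apply: meval_eq => j.
rewrite tnth_mktuple rmorphD rmorph_sum /= mevalC !mxE; congr (_ + _).
by apply: eq_bigr => i _; rewrite mevalZ mevalXU mulrC.
Qed.

(** The translation affects only terms of degree below [m], which interpolation reproduces. The
    transpose passes from row vectors to column vectors. *)
Lemma affine_comp_form m b (A : 'M[R]_d) p : p \is m.-homog -> (0 < m)%N ->
  (msize (affine_comp b A p - comp_linear p A^T) <= m)%N.
Proof.
move=> hp m0.
have E (l : d.-tuple {mpoly R[d]}) : p \mPo l = \sum_I tensor_of (m:=m) p I *: ('X_[monomial I] \mPo l).
  rewrite -{1}(tensor_ofK hp) /of_tens raddf_sum; apply: eq_bigr => I _.
  exact: comp_mpolyZ.
rewrite /affine_comp /comp_linear !E -sumrB.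
apply: msize_sum_leq => I _; rewrite -scalerBr; apply: msizeZ_leq.
rewrite !compX_monomial.
have := @msize_prod_shift _ d _ (index_enum 'I_m)
  (fun k => tnth [tuple \sum_j A^T i j *: 'X_j | i < d] (I k))
  (fun k => tnth [tuple (b ord0 j)%:MP + \sum_i A i j *: 'X_i | j < d] (I k)).
have -> : size (index_enum 'I_m) = m by rewrite -[RHS]card_ord cardE enumT.
apply=> k; rewrite !tnth_mktuple; first exact: msize_linear.
rewrite (_ : \sum_j A^T (I k) j *: 'X_j = \sum_i A i (I k) *: 'X_i).
  by rewrite addrK msizeC_leq.
by apply: eq_bigr => i _; rewrite mxE.
Qed.

End Affine.

(** * Lagrange interpolation at the lattice points of the reference simplex *)

Section Lattice.
Context {R : realType} {d : nat}.
Variable N : nat.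
Hypothesis N0 : (0 < N)%N.
Local Notation S := 'X_{1..d < N.+1}.

Definition node (a : 'X_{1..d}) : 'rV[R]_d := \row_i ((a i)%:R / N%:R).

(** The binomial coefficient of [u] over [k]: 1 where [u] equals [k], and 0 where [u] is a smaller
    natural number. *)
Let fac k (u : {mpoly R[d]}) := \prod_(j < k) ((k - j)%:R^-1 *: (u - (j%:R)%:MP)).

Let msize_fac k u : (msize u <= 2)%N -> (msize (fac k u) <= k.+1)%N.
Proof.
move=> u2; have := @msize_prod_leq _ d _ (index_enum 'I_k)
  (fun j => (k - j)%:R^-1 *: (u - (j%:R)%:MP)) (fun=> 1%N).
rewrite sum1_card card_ord; apply=> j; apply: msizeZ_leq; apply: msizeB_leq => //.
exact: msizeC_leq.
Qed.

Let eval_fac k u x b : peval u x = b%:R -> (b <= k)%N -> peval (fac k u) x = (b == k)%:R.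
Proof.
move=> ux bk; rewrite /peval /fac rmorph_prod /=.
have E (j : 'I_k) : ((k - j)%:R^-1 *: (u - (j%:R)%:MP)).@[fun i => x ord0 i] =
    (k - j)%:R^-1 * (b%:R - j%:R).
  by rewrite mevalZ rmorphB /= mevalC -/(peval u x) ux.
rewrite (eq_bigr _ (fun j _ => E j)).
have [->|neq] := eqVneq b k.
  rewrite big1 // => j _; rewrite -natrB ?(ltnW (ltn_ord j)) // mulVf // pnatr_eq0.
  by rewrite -lt0n subn_gt0.
have lt : (b < k)%N by rewrite ltn_neqAle neq.
by rewrite (bigD1 (Ordinal lt)) //= subrr mulr0 mul0r.
Qed.

Let eval_fac0 k u x b : peval u x = b%:R -> (b < k)%N -> peval (fac k u) x = 0.
Proof. by move=> ux bk; rewrite (eval_fac ux (ltnW bk)) ltn_eqF. Qed.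

(** One binomial coefficient for each barycentric coordinate, scaled by [N]. The scaled coordinates
    of every node sum to [N], so a node other than that of [a] has a coordinate smaller than that of
    [a], where a factor vanishes. *)
Definition lagrange_basis (a : 'X_{1..d}) : {mpoly R[d]} :=
  fac (N - mdeg a) (N%:R%:MP - N%:R *: \sum_i 'X_i) *
  \prod_i fac (a i) (N%:R *: 'X_i).

Lemma msize_lagrange_basis a : (mdeg a <= N)%N -> (msize (lagrange_basis a) <= N.+1)%N.
Proof.
move=> aN; have -> : N.+1 = (N - mdeg a + mdeg a).+1 by rewrite subnK.
apply: msizeM_leq.
  apply: msize_fac; apply: msizeB_leq; first exact: msizeC_leq.
  apply: msizeZ_leq; have := @msize_linear R d (fun=> 1).
  by under eq_bigr do rewrite scale1r.
rewrite mdegE; apply: msize_prod_leq => i; apply: msize_fac; apply: msizeZ_leq.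
by rewrite msizeX mdeg1.
Qed.

Lemma eval_lagrange_basis a b : (mdeg a <= N)%N -> (mdeg b <= N)%N ->
  peval (lagrange_basis a) (node b) = (a == b)%:R.
Proof.
move=> aN bN; have NN : N%:R != 0 :> R by rewrite pnatr_eq0 -lt0n.
have ui i : peval (N%:R *: 'X_i) (node b) = (b i)%:R.
  by rewrite /peval mevalZ mevalXU mxE mulrC divfK.
have u0 : peval (N%:R%:MP - N%:R *: \sum_i 'X_i) (node b) = (N - mdeg b)%:R.
  rewrite /peval rmorphB /= mevalC mevalZ rmorph_sum natrB //=; congr (_ - _).
  rewrite mdegE natr_sum mulr_sumr; apply: eq_bigr => i _.
  by rewrite mevalXU mxE mulrC divfK.
have pE : peval (lagrange_basis a) (node b) =
    peval (fac (N - mdeg a) (N%:R%:MP - N%:R *: \sum_i 'X_i)) (node b) *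
    \prod_i peval (fac (a i) (N%:R *: 'X_i)) (node b).
  by rewrite /peval /lagrange_basis mevalM; congr (_ * _); exact: rmorph_prod.
rewrite pE; have [ab|neq] := eqVneq a b.
  rewrite -ab in ui u0 *; rewrite (eval_fac u0) // eqxx mul1r big1 // => i _.
  by rewrite (eval_fac (ui i)) ?eqxx.
have [/existsP [i bi]|] := boolP [exists i, (b i < a i)%N].
  by rewrite [X in _ * X](bigD1 i) //= (eval_fac0 (ui i) bi) mul0r mulr0.
rewrite negb_exists => /forallP h; rewrite (eval_fac0 u0) ?mul0r //.
have ltab : (mdeg a < mdeg b)%N.
  rewrite ltn_neqAle !mdegE; apply/andP; split; last first.
    by apply: leq_sum => i _; rewrite leqNgt h.
  apply: contraNneq neq => eq; apply/eqP/mnmP => i; apply/eqP.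
  rewrite eqn_leq leqNgt h /=; rewrite leqNgt; apply/negP => lt.
  have : (\sum_j a j < \sum_j b j)%N.
    rewrite (bigD1 i) //= [X in (_ < X)%N](bigD1 i) //= -addSn leq_add //.
    by apply: leq_sum => j _; rewrite leqNgt h.
  by rewrite eq ltnn.
by rewrite ltn_sub2l // (leq_trans ltab).
Qed.

Let V (a c : S) : R := peval 'X_[c] (node a).
Let L (c a : S) : R := (lagrange_basis a)@_c.

Let leN (a : S) : (mdeg a <= N)%N. Proof. by rewrite -ltnS bmdeg. Qed.

(** Unisolvence. The values of the basis at the nodes give [V L = 1]; nodes and monomials are
    indexed by the same set, so the matrices are square and [L V = 1] as well. *)
Let LV (c c' : S) : \sum_a L c a * V a c' = (c == c')%:R.
Proof.
pose MV : 'M[R]_#|{: S}| := \matrix_(i, j) V (enum_val i) (enum_val j).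
pose ML : 'M[R]_#|{: S}| := \matrix_(i, j) L (enum_val i) (enum_val j).
have VL : MV *m ML = 1%:M.
  apply/matrixP => i j; rewrite !mxE.
  transitivity (peval (lagrange_basis (enum_val j)) (node (enum_val i))).
    rewrite /peval [X in _ = X.@[_]](mpolywE (k := N.+1)); last first.
      by rewrite msize_lagrange_basis // -ltnS bmdeg.
    rewrite rmorph_sum [RHS](reindex_onto enum_val enum_rank) /=; last by move=> x _; rewrite enum_rankK.
    rewrite [RHS](eq_bigl xpredT); last by move=> x; rewrite enum_valK eqxx.
    by apply: eq_bigr => k _; rewrite !mxE mevalZ mulrC.
  rewrite eval_lagrange_basis ?leN //.
  by rewrite eq_sym (inj_eq val_inj) (inj_eq enum_val_inj).
have := congr1 (fun A : 'M_#|{: S}| => A (enum_rank c) (enum_rank c')) (mulmx1C VL).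
rewrite !mxE (inj_eq enum_rank_inj) => <-.
rewrite [RHS](reindex_onto enum_rank enum_val) /=; last by move=> x _; rewrite enum_valK.
rewrite [RHS](eq_bigl xpredT); last by move=> x; rewrite enum_rankK eqxx.
by apply: eq_bigr => a _; rewrite !mxE !enum_rankK.
Qed.

Lemma lagrange_recover q : (msize q <= N.+1)%N ->
  q = \sum_(a : S) peval q (node a) *: lagrange_basis a.
Proof.
move=> qN; apply/mpolyP => c; rewrite raddf_sum /=.
have [cN|Nc] := ltnP (mdeg c) N.+1; last first.
  rewrite ((msizeP _ _ qN) c Nc) big1 // => a _.
  have aN : (mdeg a <= N)%N by rewrite -ltnS bmdeg.
  by rewrite mcoeffZ ((msizeP _ _ (msize_lagrange_basis aN)) c Nc) mulr0.
pose c0 : S := BMultinom cN.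
rewrite (_ : q@_c = \sum_(c' : S) (c0 == c')%:R * q@_c'); last first.
  rewrite (bigD1 c0) //= eqxx mul1r big1 ?addr0 // => c' /negPf.
  by rewrite eq_sym => ->; rewrite mul0r.
rewrite (eq_bigr (fun c' : S => \sum_(a : S) L c0 a * V a c' * q@_c')); last first.
  by move=> c' _; rewrite -mulr_suml LV.
rewrite exchange_big; apply: eq_bigr => a _ /=; rewrite mcoeffZ.
rewrite /peval {2}(mpolywE qN) rmorph_sum mulr_suml; apply: eq_bigr => c' _.
by rewrite /= mevalZ /V /L /peval; ring.
Qed.

End Lattice.

Section InterpError.
Context {R : realType} {m d : nat}.
Hypothesis m2 : (2 <= m)%N.
Local Notation N := m.-1.
Local Notation S := 'X_{1..d < N.+1}.
Local Open Scope classical_set_scope.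
Implicit Types (T : 'I_d.+1 -> 'rV[R]_d) (p q : {mpoly R[d]}) (y : 'rV[R]_d).

Let N0 : (0 < N)%N. Proof. by case: m m2 => [|[]]. Qed.
Let NE : N.+1 = m. Proof. by case: m m2. Qed.

Definition edges T : 'M[R]_d := \matrix_(i < d) (T (lift ord0 i) - T ord0).

Lemma barycentric_affine T l x : barycentric T l x <->
  \sum_i l i = 1 /\ x = T ord0 + (\row_i l (lift ord0 i)) *m edges T.
Proof.
have E : \sum_i l i = 1 -> \sum_i l i *: T i =
    T ord0 + (\row_i l (lift ord0 i)) *m edges T.
  move=> l1; rewrite mulmx_sum_row big_ord_recl.
  have -> : l ord0 = 1 - \sum_(i < d) l (lift ord0 i).
    by rewrite -[X in _ = X - _]l1 big_ord_recl addrK.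
  rewrite scalerBl scale1r -addrA scaler_suml; congr (_ + _).
  rewrite addrC -sumrB; apply: eq_bigr => i _.
  by rewrite mxE rowK scalerBr.
by split=> -[l1 ->]; split=> //; rewrite E.
Qed.

Definition interp q : {mpoly R[d]} :=
  \sum_(a : S) peval q (node N a) *: lagrange_basis N a.

Lemma msize_interp q : (msize (interp q) <= m)%N.
Proof.
rewrite -[X in (_ <= X)%N]NE; apply: msize_sum_leq => a _; apply: msizeZ_leq.
by apply: msize_lagrange_basis; rewrite -ltnS bmdeg.
Qed.

Lemma interp_id q : (msize q <= m)%N -> interp q = q.
Proof. by rewrite -[X in (_ <= X)%N -> _]NE => qN; rewrite [RHS](lagrange_recover N0 qN). Qed.

Lemma eval_interp q (a : 'X_{1..d}) : (mdeg a <= N)%N ->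
  peval (interp q) (node N a) = peval q (node N a).
Proof.
move=> aN; rewrite /interp /peval rmorph_sum /=.
have aS : (mdeg a < N.+1)%N by [].
rewrite (bigD1 (BMultinom aS)) //= mevalZ -/(peval (lagrange_basis _ _) _).
rewrite eval_lagrange_basis // eqxx mulr1 big1 ?addr0 // => b /negP ba.
rewrite mevalZ -/(peval (lagrange_basis _ _) _) eval_lagrange_basis //; last first.
  by rewrite -ltnS bmdeg.
by case: eqP => [eq|]; [case: ba; rewrite -val_eqE /= eq | rewrite mulr0].
Qed.

Lemma lagrange_nodesP T x : lagrange_nodes m T x <->
  exists2 a : 'X_{1..d}, (mdeg a <= N)%N & x = T ord0 + node N a *m edges T.
Proof.
have NR : N%:R != 0 :> R by rewrite pnatr_eq0 -lt0n.
split=> [[l /barycentric_affine [l1 ->] lk]|[a aN ->]].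
  have hk i : {k : nat | l i = k%:R / N%:R}.
    by apply: cid; have [k _ ->] := lk i; exists k.
  pose k i := sval (hk i); have kE i : l i = (k i)%:R / N%:R by case: (svalP (hk i)).
  have kN : (\sum_i k i = N)%N.
    apply/eqP; rewrite -(eqr_nat R) natr_sum -[X in _ == X]mul1r -[X in _ == X * _]l1 mulr_suml.
    by apply/eqP/eq_bigr => i _; rewrite kE divfK.
  exists [multinom k (lift ord0 i) | i < d].
    rewrite mdegE -kN big_ord_recl (eq_bigr (fun i => k (lift ord0 i))) ?leq_addl //.
    by move=> i _; rewrite mnmE.
  by congr (_ + _ *m _); apply/rowP => i; rewrite !mxE mnmE kE.
pose k (i : 'I_d.+1) : nat := if unlift ord0 i is Some j then a j else (N - mdeg a)%N.
have k0 : k ord0 = (N - mdeg a)%N by rewrite /k unlift_none.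
have kl i : k (lift ord0 i) = a i by rewrite /k liftK.
exists (fun i => (k i)%:R / N%:R).
  apply/barycentric_affine; split.
    rewrite -mulr_suml -natr_sum big_ord_recl k0; under eq_bigr do rewrite kl.
    by rewrite -mdegE subnK // mulfV.
  by congr (_ + _ *m _); apply/rowP => i; rewrite !mxE kl.
move=> i; exists (k i) => //; rewrite /k; case: unlift => [j|]; last exact: leq_subr.
by apply: leq_trans aN; rewrite mdegE (bigD1 j) //= leq_addr.
Qed.

Definition simplex0 : set 'rV[R]_d :=
  [set y | (forall i, 0 <= y ord0 i) /\ \sum_i y ord0 i <= 1].

Lemma simplex_setE T : simplex_set T =
  [set T ord0 + y *m edges T | y in simplex0].
Proof.
apply/seteqP; split=> x.
  move=> [l /barycentric_affine [l1 ->] l0].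
  exists (\row_i l (lift ord0 i)) => //; split=> [i|]; first by rewrite mxE.
  under eq_bigr do rewrite mxE.
  by rewrite -[X in _ <= X]l1 big_ord_recl lerDr.
move=> [y [y0 y1] <-].
pose l (i : 'I_d.+1) : R := if unlift ord0 i is Some j then y ord0 j else 1 - \sum_i y ord0 i.
have ll i : l (lift ord0 i) = y ord0 i by rewrite /l liftK.
exists l.
  apply/barycentric_affine; split.
    by rewrite big_ord_recl (eq_bigr _ (fun i _ => ll i)) /l unlift_none subrK.
  by congr (_ + _ *m _); apply/rowP => i; rewrite !mxE ll.
by move=> i; rewrite /l; case: unlift => // ; rewrite subr_ge0.
Qed.

(** Pulled back to the reference simplex, the interpolant of [p] is [interp] of the pullback of [p],
    which differs from [r] by terms of degree below [m]; these cancel in the error. *)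
Lemma interp_error_form T p : edges T \in unitmx -> p \is m.-homog ->
  let r := comp_linear p (edges T)^T in
  interp_error m T (peval p) = sup [set `|peval (r - interp r) y| | y in simplex0].
Proof.
move=> uA hp r; set A := edges T in uA r *; set b := T ord0.
set q := lagrange_interp m T (peval p).
(* An interpolant is exhibited, so that the default value in [lagrange_interp] does not occur. *)
have isq : is_interpolant m T (peval p) q.
  rewrite /q /lagrange_interp; apply: xgetPex.
  exists (affine_comp (- (b *m invmx A)) (invmx A) (interp (affine_comp b A p))); split.
    by apply: msize_affine_comp; exact: msize_interp.
  move=> _ /lagrange_nodesP [a aN ->]; rewrite peval_affine_comp -/A -/b.
  rewrite mulmxDl mulmxK // addrA addNr add0r eval_interp //.
  by rewrite peval_affine_comp.
have QE : affine_comp b A q = interp (affine_comp b A p).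
  rewrite -[LHS]interp_id; last by apply: msize_affine_comp; case: isq.
  apply: eq_bigr => a _; rewrite !peval_affine_comp isq.2 //.
  by apply/lagrange_nodesP; exists (val a) => //; rewrite -ltnS bmdeg.
have g : interp (affine_comp b A p - r) = affine_comp b A p - r.
  by apply: interp_id; apply: affine_comp_form => //; apply: ltnW.
have interpB u v : interp (u - v) = interp u - interp v.
  rewrite /interp -sumrB; apply: eq_bigr => a _.
  by rewrite -scalerBl /peval mevalB.
have key (a e u w : {mpoly R[d]}) : a - e = u - w -> u - a = w - e.
  move=> /eqP; rewrite subr_eq => /eqP ->.
  by rewrite opprD opprB addrA [u + _]addrC subrK.
have hE y : peval p (b + y *m A) - peval q (b + y *m A) = peval (r - interp r) y.
  have <- : affine_comp b A p - affine_comp b A q = r - interp r.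
    by rewrite QE; apply: key; rewrite -interpB.
  by rewrite {3}/peval mevalB -!/(peval _ _) !peval_affine_comp.
rewrite /interp_error /Linfty_norm simplex_setE -/A -/b; congr sup.
apply/seteqP; split=> z.
  by move=> [_ [y y0 <-] <-]; exists y => //; rewrite -hE.
by move=> [y y0 <-]; exists (b + y *m A); [exists y | rewrite hE].
Qed.

Definition tensor_norm p : R := \sum_I `|tensor_of (m:=m) p I|.

Lemma tensor_norm_ge0 p : 0 <= tensor_norm p.
Proof. exact: sumr_ge0. Qed.

Lemma simplex0_le1 y i : simplex0 y -> `|y ord0 i| <= 1.
Proof.
move=> [y0 y1]; rewrite ger0_norm //; apply: le_trans y1.
by rewrite (bigD1 i) //= lerDl; apply: sumr_ge0.
Qed.

Lemma tensor_of_le_norm p I : `|tensor_of (m:=m) p I| <= tensor_norm p.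
Proof. by rewrite /tensor_norm (bigD1 I) //= lerDl sumr_ge0. Qed.

Lemma peval_form_le p y : p \is m.-homog -> simplex0 y -> `|peval p y| <= tensor_norm p.
Proof.
move=> hp y0; rewrite -{1}(tensor_ofK hp) /of_tens /peval rmorph_sum.
apply: le_trans (ler_norm_sum _ _ _) _; apply: ler_sum => I _ /=.
rewrite mevalZ normrM ler_piMr // mpolyX_monomial rmorph_prod normr_prod.
apply: prodr_ile1 => k _; rewrite normr_ge0 /= mevalXU.
exact: simplex0_le1.
Qed.

Definition abs_coeffs q : R := \sum_(a <- msupp q) `|q@_a|.

Lemma peval_le q y : simplex0 y -> `|peval q y| <= abs_coeffs q.
Proof.
move=> y0; rewrite /peval mevalE; apply: le_trans (ler_norm_sum _ _ _) _.
apply: ler_sum => a _; rewrite normrM ler_piMr // normr_prod.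
apply: prodr_ile1 => k _; rewrite normr_ge0 /= normrX exprn_ile1 //.
exact: simplex0_le1.
Qed.

Lemma node_simplex0 M (a : 'X_{1..d}) : (0 < M)%N -> (mdeg a <= M)%N -> simplex0 (node M a).
Proof.
move=> M0 aM; split=> [i|]; first by rewrite mxE divr_ge0.
under eq_bigr do rewrite mxE; rewrite -mulr_suml -natr_sum -mdegE.
by rewrite ler_pdivrMr ?ltr0n // mul1r ler_nat.
Qed.

Definition error_upper : R := 1 + \sum_(a : S) abs_coeffs (lagrange_basis N a).

(** The nodes have order [m], one more than in the interpolation, so as to recover polynomials of
    degree [m]; the summand 1 makes the constant positive. *)
Definition error_lower : R :=
  1 + \sum_(I : {ffun 'I_m -> 'I_d}) \sum_(a : 'X_{1..d < m.+1}) `|(lagrange_basis (R:=R) m a)@_(monomial I)|.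

Lemma interp_error_le r y : r \is m.-homog -> simplex0 y ->
  `|peval (r - interp r) y| <= error_upper * tensor_norm r.
Proof.
move=> hr y0; rewrite /peval mevalB; apply: le_trans (ler_normB _ _) _.
rewrite /error_upper mulrDl mul1r; apply: lerD; first exact: peval_form_le.
rewrite /interp rmorph_sum mulr_suml; apply: le_trans (ler_norm_sum _ _ _) _.
apply: ler_sum => a _; rewrite /= mevalZ normrM mulrC.
apply: ler_pM => //; first exact: peval_le.
by apply: peval_form_le => //; apply: node_simplex0 => //; rewrite -ltnS bmdeg.
Qed.

(** The interpolant has degree below [m], so the error has the same coefficients of degree [m] as
    [r], and these are linear in its values at the nodes of order [m]. *)
Lemma interp_error_ge r (E : R) : r \is m.-homog -> 0 <= E ->
  (forall y, simplex0 y -> `|peval (r - interp r) y| <= E) ->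
  tensor_norm r <= error_lower * E.
Proof.
move=> hr E0 hE; have m0 : (0 < m)%N by exact: ltnW.
have hs : (msize (r - interp r) <= m.+1)%N.
  apply: msizeB_leq; last by apply: leq_trans (msize_interp r) _.
  by apply/msizeP => a ma; apply: (dhomog_nemf_coeff hr); rewrite gtn_eqF.
rewrite /error_lower mulrDl mul1r; apply: ler_wpDl => //.
rewrite /tensor_norm mulr_suml; apply: ler_sum => I _.
have -> : tensor_of r I = (r - interp r)@_(monomial I) / (monomial_card (m:=m) (monomial I))%:R.
  by rewrite /tensor_of mcoeffB ((msizeP _ _ (msize_interp r)) (monomial I)) ?mdeg_monomial // subr0.
rewrite normrM normfV normr_nat.
apply: (@le_trans _ _ `|(r - interp r)@_(monomial I)|).
  by rewrite ler_piMr // invf_le1 ?ltr0n ?ler1n monomial_card_gt0 // mdeg_monomial.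
rewrite {1}(lagrange_recover m0 hs) raddf_sum mulr_suml /=.
apply: le_trans (ler_norm_sum _ _ _) _; apply: ler_sum => a _.
rewrite mcoeffZ normrM mulrC; apply: ler_wpM2l => //.
by apply: hE; apply: node_simplex0 => //; rewrite -ltnS bmdeg.
Qed.

Lemma simplex0_nonempty : simplex0 !=set0.
Proof.
exists 0; split=> [i|]; first by rewrite mxE.
by rewrite big1 // => i _; rewrite mxE.
Qed.

Lemma interp_error_bounds T p : edges T \in unitmx -> p \is m.-homog ->
  let r := comp_linear p (edges T)^T in
  [/\ 0 <= interp_error m T (peval p),
      interp_error m T (peval p) <= error_upper * tensor_norm r &
      tensor_norm r <= error_lower * interp_error m T (peval p)].
Proof.
move=> uA hp r; have hr : r \is m.-homog by exact: comp_linear_homog.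
rewrite interp_error_form // -/r; set X := [set _ | _ in _].
have Xub : ubound X (error_upper * tensor_norm r).
  by move=> _ [y y0 <-]; exact: interp_error_le.
have Xne : X !=set0.
  by have [y y0] := simplex0_nonempty; exists `|peval (r - interp r) y|, y.
have Xle y : simplex0 y -> `|peval (r - interp r) y| <= sup X.
  by move=> y0; apply: ub_le_sup; [exists (error_upper * tensor_norm r) | exists y].
have X0 : 0 <= sup X.
  by have [y y0] := simplex0_nonempty; apply: le_trans (Xle y y0).
split=> //; first exact: ge_sup.
exact: interp_error_ge.
Qed.

End InterpError.

(** * The orbit norm *)

Section CompLinear.
Context {F : numFieldType} {m d : nat}.
Implicit Types (p : {mpoly F[d]}) (a b : 'M[F]_d).

Lemma comp_linearM p a b : p \is m.-homog ->
  comp_linear (comp_linear p a) b = comp_linear p (a *m b).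
Proof.
move=> hp; have ha := comp_linear_homog a hp.
rewrite -(tensor_ofK (comp_linear_homog b ha)) -(tensor_ofK (comp_linear_homog (a *m b) hp)).
by rewrite !(tensor_of_comp (m:=m)) // trmx_mul tensM act_kmul.
Qed.

Lemma comp_linear1 p : p \is m.-homog -> comp_linear p 1%:M = p.
Proof.
move=> hp; rewrite -(tensor_ofK (comp_linear_homog 1%:M hp)) (tensor_of_comp (m:=m)) //.
by rewrite trmx1 tens1 act_kid tensor_ofK.
Qed.

Lemma comp_linearZ c p a : comp_linear (c *: p) a = c *: comp_linear p a.
Proof. exact: comp_mpolyZ. Qed.

Lemma cvgs_norm0 (u : nat -> F) : cvgs u 0 -> cvgs (fun n => `|u n|) 0.
Proof. by move=> h e /h [M hM]; exists M => n /hM; rewrite !subr0 normr_id. Qed.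

Lemma cvg_to_zero_tensor_of (q : nat -> {mpoly F[d]}) : cvg_to_zero q ->
  forall I, cvgs (fun n => tensor_of (m:=m) (q n) I) 0.
Proof.
move=> h I; have /cvgsP c1 := h (monomial I).
rewrite -(mul0r ((monomial_card (m:=m) (monomial I))%:R^-1)); apply: cvgsM => //; exact: cvgs_cst.
Qed.

Lemma tensor_of_cvg_to_zero (q : nat -> {mpoly F[d]}) : (forall n, q n \is m.-homog) ->
  (forall I, cvgs (fun n => tensor_of (m:=m) (q n) I) 0) -> cvg_to_zero q.
Proof.
move=> hq h a; apply/cvgsP.
rewrite (_ : (fun _ => _) = fun n => \sum_(I : {ffun 'I_m -> 'I_d} | monomial I == a) tensor_of (m:=m) (q n) I); last first.
  by apply/funext => n; rewrite -{1}(tensor_ofK (hq n)) mcoeff_of_tens.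
have := @cvgs_sum F _ [seq I : {ffun 'I_m -> 'I_d} <- index_enum _ | monomial I == a]
  (fun I n => tensor_of (m:=m) (q n) I) (fun=> 0) h.
rewrite big1 // (_ : (fun _ => _) =
    fun n => \sum_(I : {ffun 'I_m -> 'I_d} | monomial I == a) tensor_of (m:=m) (q n) I) //.
by apply/funext => n; rewrite big_filter.
Qed.

End CompLinear.

Section OrbitNorm.
Context {R : realType} {m d : nat}.
Hypotheses (m2 : (2 <= m)%N) (d2 : (2 <= d)%N).
Local Open Scope classical_set_scope.
Implicit Types (p : {mpoly R[d]}).
Local Notation tnorm := (@tensor_norm R m d).

Lemma tensor_normZ c p : tnorm (c *: p) = `|c| * tnorm p.
Proof.
rewrite /tensor_norm mulr_sumr; apply: eq_bigr => I _.
by rewrite tensor_ofZ normrM.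
Qed.

Definition orbit_norm p : R :=
  inf [set tnorm (comp_linear p phi) | phi in [set phi : 'M[R]_d | \det phi = 1]].

Let orbit_inf p : has_inf [set tnorm (comp_linear p phi) | phi in [set phi : 'M[R]_d | \det phi = 1]].
Proof.
split; first by exists (tnorm (comp_linear p 1%:M)), 1%:M => //=; rewrite det1.
by exists 0 => _ [phi _ <-]; exact: tensor_norm_ge0.
Qed.

Lemma orbit_norm_le p phi : \det phi = 1 -> orbit_norm p <= tnorm (comp_linear p phi).
Proof. by move=> dphi; apply: ge_inf; [exact: (orbit_inf p).2 | exists phi]. Qed.

Lemma orbit_norm_adherent p e : 0 < e ->
  exists2 phi, \det phi = 1 & tnorm (comp_linear p phi) < orbit_norm p + e.
Proof.
move=> e0; have [_ [phi dphi <-] lt] := inf_adherent e0 (orbit_inf p).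
by exists phi.
Qed.

Lemma orbit_norm_lb p b : (forall phi, \det phi = 1 -> b <= tnorm (comp_linear p phi)) ->
  b <= orbit_norm p.
Proof. by move=> h; apply: lb_le_inf; [exact: (orbit_inf p).1 | move=> _ [phi dphi <-]; exact: h]. Qed.

Lemma orbit_norm_ge0 p : 0 <= orbit_norm p.
Proof. by apply: orbit_norm_lb => phi _; exact: tensor_norm_ge0. Qed.

Lemma orbit_norm_comp p phi : p \is m.-homog -> \det phi = 1 ->
  orbit_norm (comp_linear p phi) = orbit_norm p.
Proof.
move=> hp dphi; apply/eqP; rewrite eq_le; apply/andP; split; apply: orbit_norm_lb => psi dpsi.
  have uphi : phi \in unitmx by rewrite unitmxE dphi unitr1.
  have -> : comp_linear p psi = comp_linear (comp_linear p phi) (invmx phi *m psi).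
    by rewrite (comp_linearM _ _ hp) mulKVmx.
  by apply: orbit_norm_le; rewrite det_mulmx det_inv dphi dpsi invr1 mulr1.
by rewrite (comp_linearM _ _ hp); apply: orbit_norm_le; rewrite det_mulmx dphi dpsi mulr1.
Qed.

Lemma orbit_normZ c p : p \is m.-homog -> orbit_norm (c *: p) = `|c| * orbit_norm p.
Proof.
move=> hp; have [->|c0] := eqVneq c 0.
  rewrite normr0 mul0r; apply/eqP; rewrite eq_le orbit_norm_ge0 andbT.
  apply: le_trans (orbit_norm_le _ (det1 _ _)) _.
  by rewrite comp_linearZ tensor_normZ normr0 mul0r.
have cp : 0 < `|c| by rewrite normr_gt0.
apply/eqP; rewrite eq_le; apply/andP; split.
  rewrite -ler_pdivrMl //; apply: orbit_norm_lb => phi dphi; rewrite ler_pdivrMl //.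
  by rewrite -tensor_normZ -comp_linearZ orbit_norm_le.
apply: orbit_norm_lb => phi dphi; rewrite comp_linearZ tensor_normZ ler_pM2l //.
exact: orbit_norm_le.
Qed.

Let j0 : 'I_d := Ordinal (ltnW d2).
(** The edges of a simplex of volume 1 have determinant plus or minus the factorial of [d].
    Rescaling one coordinate corrects size and sign together, at the cost of a bounded factor in the
    norm. *)
Definition stretch (c : R) : 'M[R]_d := diag_mx (\row_j (if j == j0 then c else 1)).

Lemma det_stretch c : \det (stretch c) = c.
Proof.
rewrite det_diag (bigD1 j0) //= mxE eqxx big1 ?mulr1 // => j /negPf jj.
by rewrite mxE jj.
Qed.

Lemma tensor_norm_stretch p c b : p \is m.-homog -> `|c| <= b -> 1 <= b ->
  tnorm (comp_linear p (stretch c)) <= b ^+ m * tnorm p.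
Proof.
move=> hp cb b1; rewrite /tensor_norm mulr_sumr; apply: ler_sum => I _.
rewrite (tensor_of_comp (m:=m)) // tr_diag_mx.
rewrite (act_diag (c:=fun I : {ffun 'I_m -> 'I_d} =>
  \prod_k (\row_(j < d) (if j == j0 then c else 1)) ord0 (I k))); last first.
  by move=> I' J'; exact: tens_diag.
rewrite normrM ler_wpM2r // normr_prod -[m in _ ^+ m]card_ord -prodr_const.
apply: ler_prod => k _; rewrite normr_ge0 /= mxE; case: ifP => // _.
by rewrite normr1.
Qed.

Lemma exists_simplex (A : 'M[R]_d) : exists T : 'I_d.+1 -> 'rV[R]_d, edges T = A.
Proof.
exists (fun i => if unlift ord0 i is Some j then row j A else 0).
by apply/matrixP => i j; rewrite !mxE liftK unlift_none !mxE subr0.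
Qed.

Lemma simplex_volumeE (T : 'I_d.+1 -> 'rV[R]_d) :
  simplex_volume T = `|\det (edges T)| / d`!%:R.
Proof. by []. Qed.

Let fd : R := d`!%:R.
Let fd1 : 1 <= fd. Proof. by rewrite /fd ler1n fact_gt0. Qed.
Let fd0 : 0 < fd. Proof. exact: lt_le_trans ltr01 fd1. Qed.

Lemma volume1_det (T : 'I_d.+1 -> 'rV[R]_d) : simplex_volume T = 1 ->
  `|\det (edges T)| = fd.
Proof.
by rewrite simplex_volumeE => h; rewrite -[LHS](divfK (lt0r_neq0 fd0)) h mul1r.
Qed.

Lemma volume1_unit (T : 'I_d.+1 -> 'rV[R]_d) : simplex_volume T = 1 ->
  edges T \in unitmx.
Proof. by move/volume1_det => h; rewrite unitmxE unitfE -normr_gt0 h. Qed.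

Lemma shape_functionE (p : dhomog d R m) : has_inf
  [set interp_error m T (peval p) | T in [set T : 'I_d.+1 -> 'rV[R]_d | simplex_volume T = 1]].
Proof.
split.
  have [T TE] := exists_simplex (stretch fd).
  exists (interp_error m T (peval p)), T => //=.
  by rewrite simplex_volumeE TE det_stretch gtr0_norm // mulfV ?gt_eqF.
exists 0 => _ [T /= vT <-].
by have [] := interp_error_bounds m2 (volume1_unit vT) (dhomog_is_dhomog p).
Qed.

Lemma shape_orbit_norm : exists2 c : R, 0 < c & forall p : dhomog d R m,
  shape_function p <= c * orbit_norm p /\ orbit_norm p <= c * shape_function p.
Proof.
pose eU := @error_upper R m d; pose eL := @error_lower R m d.
have eU0 : 0 < eU.
  by apply: ltr_wpDr => //; apply: sumr_ge0 => a _; apply: sumr_ge0.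
have eL0 : 0 < eL.
  by apply: ltr_wpDr => //; apply: sumr_ge0 => a _; apply: sumr_ge0.
exists (eU * fd ^+ m + eL); first by rewrite addr_gt0 // mulr_gt0 // exprn_gt0.
move=> p; have hp : (p : {mpoly R[d]}) \is m.-homog by exact: dhomog_is_dhomog.
have S0 : 0 <= shape_function p.
  apply: lb_le_inf; first exact: (shape_functionE p).1.
  move=> _ [T /= vT <-].
  by have [] := interp_error_bounds m2 (volume1_unit vT) hp.
split.
  apply: (@le_trans _ _ (eU * fd ^+ m * orbit_norm p)); last first.
    by rewrite ler_wpM2r ?orbit_norm_ge0 // lerDl ltW.
  rewrite -ler_pdivrMl ?mulr_gt0 ?exprn_gt0 //; apply: orbit_norm_lb => phi dphi.
  rewrite ler_pdivrMl ?mulr_gt0 ?exprn_gt0 //.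
  have [T TE] := exists_simplex (phi *m stretch fd)^T.
  have vT : simplex_volume T = 1.
    rewrite simplex_volumeE TE det_tr det_mulmx dphi mul1r det_stretch.
    by rewrite gtr0_norm // mulfV ?gt_eqF.
  apply: le_trans (_ : interp_error m T (peval p) <= _).
    by apply: ge_inf; [exact: (shape_functionE p).2 | exists T].
  have [_ + _] := interp_error_bounds m2 (volume1_unit vT) hp.
  rewrite TE trmxK -(comp_linearM _ _ hp) => h; apply: le_trans h _.
  rewrite -mulrA ler_pM2l //; apply: tensor_norm_stretch => //; last by rewrite gtr0_norm.
  exact: comp_linear_homog.
apply: (@le_trans _ _ (eL * shape_function p)); last first.
  by rewrite ler_wpM2r // lerDr mulr_ge0 ?(ltW eU0) // exprn_ge0 // ltW.
rewrite -ler_pdivrMl //; apply/ler_addgt0Pr => e e0.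
have [_ [T /= vT <-] lt] := inf_adherent e0 (shape_functionE p).
apply: le_trans (ltW lt); rewrite ler_pdivrMl //.
have [_ _] := interp_error_bounds m2 (volume1_unit vT) hp.
move=> h; apply: le_trans h.
set B := (edges T)^T; have dB : `|\det B| = fd by rewrite det_tr volume1_det.
have dB0 : \det B != 0 by rewrite -normr_gt0 dB.
apply: (@le_trans _ _ (tnorm (comp_linear p (B *m stretch (\det B)^-1)))).
  by apply: orbit_norm_le; rewrite det_mulmx det_stretch mulfV.
rewrite -(comp_linearM _ _ hp) -[leRHS]mul1r -(expr1n _ m); apply: tensor_norm_stretch => //.
  exact: comp_linear_homog.
by rewrite normfV dB invf_le1.
Qed.

Lemma orbit_norm_gt0 p : p \is m.-homog -> ~ sl_degenerates p -> 0 < orbit_norm p.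
Proof.
move=> hp nd; rewrite lt_neqAle orbit_norm_ge0 andbT eq_sym; apply/negP => /eqP N0; apply: nd.
have hphi n : {phi : 'M[R]_d | \det phi = 1 /\ tnorm (comp_linear p phi) < n.+1%:R^-1}.
  apply: cid; have [|phi dphi] := @orbit_norm_adherent p n.+1%:R^-1; first by rewrite invr_gt0.
  by rewrite N0 add0r; exists phi.
exists (fun n => sval (hphi n)); first by move=> n; case: (svalP (hphi n)).
apply: (@tensor_of_cvg_to_zero _ m) => [n|I]; first exact: comp_linear_homog.
move=> e /inv_small [M hM]; exists M => n Mn; rewrite subr0.
apply: (le_lt_trans (tensor_of_le_norm _ _)).
case: (svalP (hphi n)) => _ lt; apply: lt_trans lt _; apply: le_lt_trans hM.
by rewrite lef_pV2 ?posrE ?ltr0n // ler_nat.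
Qed.

Lemma degenerates_orbit_norm p : sl_degenerates p -> orbit_norm p = 0.
Proof.
move=> [phi dphi c]; apply/eqP; rewrite eq_le orbit_norm_ge0 andbT.
have c1 : cvgs (fun n => tnorm (comp_linear p (phi n))) 0.
  have h I := cvgs_norm0 (@cvg_to_zero_tensor_of _ m _ _ c I).
  have := @cvgs_sum R _ (index_enum {ffun 'I_m -> 'I_d})
    (fun I n => `|tensor_of (m:=m) (comp_linear p (phi n)) I|) (fun=> 0) h.
  by rewrite big1.
by apply: (cvgs_ge c1) => n; exact: orbit_norm_le.
Qed.

End OrbitNorm.

Section ComplexSemistable.
Context {R : realType} {m d : nat}.
Local Notation C := R[i].

Lemma complex_nondegenerate (p : {mpoly C[d]}) : p \is m.-homog -> ~ sl_degenerates p ->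
  exists2 e : R, 0 < e &
    forall g : 'M[C]_d, \det g = 1 -> e <= sqnorm (act (tens g) (tensor_of (m:=m) p)).
Proof.
move=> hp nd; apply: contrapT => no; apply: nd.
have hphi n : {phi : 'M[C]_d | \det phi = 1 /\
    sqnorm (tensor_of (m:=m) (comp_linear p phi)) < n.+1%:R^-1 ^+ 2}.
  apply: cid; apply: contrapT => bad; apply: no.
  exists (n.+1%:R^-1 ^+ 2); first by rewrite exprn_gt0 // invr_gt0.
  move=> g dg; rewrite leNgt; apply/negP => lt; apply: bad.
  by exists g^T; rewrite det_tr (tensor_of_comp (m:=m)) // trmxK.
exists (fun n => sval (hphi n)); first by move=> n; case: (svalP (hphi n)).
apply: (@tensor_of_cvg_to_zero _ m) => [n|I]; first exact: comp_linear_homog.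
apply: (@cvgsc R _ (fun n => 1 / n.+1%:R)); last exact: cvgs_inv.
move=> n; rewrite subr0 div1r.
rewrite -(@ler_pXn2r _ 2) ?nnegrE ?invr_ge0 ?normc_ge0 //.
by case: (svalP (hphi n)) => _ /ltW; apply: le_trans; exact: sqnorm_coord.
Qed.

End ComplexSemistable.

(** * Invariant polynomials on forms *)

Section Invariants.
Context {R : realType} {m d : nat}.
Local Notation C := R[i].
Local Notation E := #|@exponent m d|.
Local Notation T := {ffun 'I_m -> 'I_d}.
Implicit Types (p : {mpoly R[d]}) (x : 'rV[R]_E) (Q : form_poly R m d).

Definition expo (k : 'I_E) : 'X_{1..d} := val (val (enum_val k)).

Lemma mdeg_expo k : mdeg (expo k) = m.
Proof. by apply/eqP; exact: (valP (enum_val k)). Qed.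

Lemma expo_inj : injective expo.
Proof. by move=> k l /val_inj /val_inj /enum_val_inj. Qed.

Lemma expo_surj a : mdeg a = m -> exists k, expo k = a.
Proof.
move=> am; have lt : (mdeg a < m.+1)%N by rewrite am.
have eqm : mdeg (BMultinom lt) == m by apply/eqP.
exists (enum_rank (exist _ (BMultinom lt) eqm : exponent)).
by rewrite /expo enum_rankK.
Qed.

Definition form_of x : {mpoly R[d]} := \sum_k x ord0 k *: 'X_[expo k].
Definition coords p : 'rV[R]_E := \row_k p@_(expo k).

Lemma form_homog x : form_of x \is m.-homog.
Proof. by apply: rpred_sum => k _; apply: rpredZ; rewrite dhomogX; apply/eqP; exact: mdeg_expo. Qed.

Lemma mcoeff_form x a : (form_of x)@_a = \sum_k x ord0 k * (expo k == a)%:R.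
Proof. by rewrite raddf_sum; apply: eq_bigr => k _; rewrite /= mcoeffZ mcoeffX. Qed.

Lemma form_ofK x : coords (form_of x) = x.
Proof.
apply/rowP => k; rewrite mxE mcoeff_form (bigD1 k) //= eqxx mulr1 big1 ?addr0 //.
by move=> l /negPf lk; rewrite (inj_eq expo_inj) lk mulr0.
Qed.

Lemma coordsK p : p \is m.-homog -> form_of (coords p) = p.
Proof.
move=> hp; apply/mpolyP => a; rewrite mcoeff_form.
have [am|am] := eqVneq (mdeg a) m; last first.
  rewrite (dhomog_nemf_coeff hp am) big1 // => k _.
  by case: eqP => [eq|]; [rewrite -eq mdeg_expo eqxx in am | rewrite mulr0].
have [k <-] := expo_surj am; rewrite (bigD1 k) //= eqxx mulr1 big1 ?addr0 ?mxE //.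
by move=> l /negPf lk; rewrite (inj_eq expo_inj) lk mulr0.
Qed.

Definition coef_eval Q x : R := Q.@[fun k => x ord0 k].

Lemma form_evalE Q (p : dhomog d R m) : form_eval Q p = coef_eval Q (coords p).
Proof. by apply: meval_eq => k; rewrite mxE. Qed.

Definition tensor_of_poly (I : T) : form_poly R m d :=
  \sum_k ((expo k == monomial I)%:R / (monomial_card (m:=m) (monomial I))%:R) *: 'X_k.

Lemma coef_eval_tensor_of_poly I x : coef_eval (tensor_of_poly I) x = tensor_of (form_of x) I.
Proof.
rewrite /coef_eval /tensor_of_poly rmorph_sum /tensor_of mcoeff_form mulr_suml; apply: eq_bigr => k _.
by rewrite /= mevalZ mevalXU; ring.
Qed.

Lemma tensor_of_poly_homog I : tensor_of_poly I \is 1.-homog.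
Proof. by apply: rpred_sum => k _; apply: rpredZ; rewrite dhomogX /= mdeg1. Qed.

Definition tensor_poly N (c : {ffun 'I_N -> T} -> R) : form_poly R m d :=
  \sum_J c J *: \prod_a tensor_of_poly (J a).

Lemma coef_eval_tensor_poly N (c : {ffun 'I_N -> T} -> R) x :
  coef_eval (tensor_poly c) x = \sum_J c J * tpow (tensor_of (form_of x)) J.
Proof.
rewrite /coef_eval /tensor_poly rmorph_sum; apply: eq_bigr => J _.
rewrite /= mevalZ rmorph_prod; congr (_ * _); apply: eq_bigr => a _.
exact: coef_eval_tensor_of_poly.
Qed.

Lemma tensor_poly_homog N (c : {ffun 'I_N -> T} -> R) : tensor_poly c \is N.-homog.
Proof.
apply: rpred_sum => J _; apply: rpredZ.
have H (r : seq 'I_N) : \prod_(a <- r) tensor_of_poly (J a) \is (size r).-homog.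
  elim: r => [|a r IH]; first by rewrite big_nil dhomog1.
  by rewrite big_cons -[(size (a :: r))]add1n; apply: dhomogM => //; exact: tensor_of_poly_homog.
by have := H (index_enum 'I_N); rewrite (_ : size _ = N) // -[RHS]card_ord cardE enumT.
Qed.

Definition sl_invariant Q := forall p (phi : 'M[R]_d), p \is m.-homog -> \det phi = 1 ->
  coef_eval Q (coords (comp_linear p phi)) = coef_eval Q (coords p).

Lemma tensor_of_map p : tensor_of (m:=m) (map_mpoly (real_complex R) p) = fun I => real_complex R (tensor_of p I).
Proof.
apply/funext => I; rewrite /tensor_of mcoeff_map_mpoly.
by rewrite rmorphM fmorphV rmorph_nat.
Qed.

Lemma map_homog p : p \is m.-homog -> map_mpoly (real_complex R) p \is m.-homog.
Proof.
move=> hp; apply/dhomogP => a; rewrite mcoeff_msupp mcoeff_map_mpoly.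
by apply: contraNeq => am; rewrite (dhomog_nemf_coeff hp am); apply/eqP.
Qed.

(** On real forms the complex invariant splits into real and imaginary parts. Both are polynomials
    with real coefficients, invariant under real matrices of determinant 1, and one of them is
    nonzero at [p]. *)
Lemma exists_invariant p : p \is m.-homog ->
  ~ sl_degenerates (map_mpoly (real_complex R) p : {mpoly C[d]}) ->
  exists N Q, [/\ (0 < N)%N, Q \is N.-homog, sl_invariant Q & coef_eval Q (coords p) != 0].
Proof.
move=> hp nd; have [e e0 he] := complex_nondegenerate (map_homog hp) nd.
have [N [u [N0 ufix uv]]] := semistable_invariant e0 he.
pose f (q : {mpoly R[d]}) := inner (tpow (N:=N) (fun I => real_complex R (tensor_of (m:=m) q I))) u.
have fE q : f q = \sum_J real_complex R (tpow (tensor_of (m:=m) q) J) * Num.conj (u J).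
  by apply: eq_bigr => J _; rewrite /tpow rmorph_prod.
have finv q (phi : 'M[R]_d) : q \is m.-homog -> \det phi = 1 -> f (comp_linear q phi) = f q.
  move=> hq dphi; pose g := map_mx (real_complex R) phi^T.
  have dg : \det g = 1 by rewrite det_map_mx det_tr dphi rmorph1.
  rewrite /f; have -> : (fun I => real_complex R (tensor_of (m:=m) (comp_linear q phi) I)) =
      act (tens g) (fun I => real_complex R (tensor_of (m:=m) q I)).
    apply/funext => I; rewrite (tensor_of_comp (m:=m)) // /act rmorph_sum.
    apply: eq_bigr => J _; rewrite rmorphM /tens /kron rmorph_prod; congr (_ * _).
    by apply: eq_bigr => k _; rewrite [in RHS]mxE.
  rewrite -act_kron_tpow inner_act -/(tens2 g) kadj_tens2 ufix //.
  by rewrite det_adj dg rmorph1.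
have reE q : complex.Re (f q) = \sum_J complex.Re (Num.conj (u J)) * tpow (tensor_of (m:=m) q) J.
  rewrite fE raddf_sum; apply: eq_bigr => J _.
  by case: (Num.conj (u J)) => a b /=; ring.
have imE q : complex.Im (f q) = \sum_J complex.Im (Num.conj (u J)) * tpow (tensor_of (m:=m) q) J.
  rewrite fE raddf_sum; apply: eq_bigr => J _.
  by case: (Num.conj (u J)) => a b /=; ring.
have fp : f p != 0 by rewrite /f -tensor_of_map.
pose Qr := tensor_poly (fun J => complex.Re (Num.conj (u J))).
pose Qi := tensor_poly (fun J => complex.Im (Num.conj (u J))).
have evr q : q \is m.-homog -> coef_eval Qr (coords q) = complex.Re (f q).
  by move=> hq; rewrite coef_eval_tensor_poly coordsK // reE.
have evi q : q \is m.-homog -> coef_eval Qi (coords q) = complex.Im (f q).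
  by move=> hq; rewrite coef_eval_tensor_poly coordsK // imE.
have [re0|re0] := eqVneq (complex.Re (f p)) 0.
  exists N, Qi; split=> //; first exact: tensor_poly_homog.
    move=> q phi hq dphi; rewrite !evi // ?finv //; exact: comp_linear_homog.
  rewrite evi //; apply: contra_neq fp => im0.
  by apply/eqP; rewrite eq_complex re0 im0 !eqxx.
exists N, Qr; split=> //; [exact: tensor_poly_homog | | by rewrite evr].
by move=> q phi hq dphi; rewrite !evr // ?finv //; exact: comp_linear_homog.
Qed.

Lemma continuous_sumr I (r : seq I) (T' : topologicalType) (f : I -> T' -> R) :
  (forall i, continuous (f i)) -> continuous (fun y => \sum_(i <- r) f i y).
Proof.
move=> h; elim: r => [|i r IH] x.
  rewrite (_ : (fun _ => _) = fun=> 0); first exact: cvg_cst.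
  by apply/funext => y; rewrite big_nil.
rewrite (_ : (fun _ => _) = fun y => f i y + \sum_(j <- r) f j y).
  by apply: cvgD; [exact: h | exact: IH].
by apply/funext => y; rewrite big_cons.
Qed.

Lemma continuous_prodr I (r : seq I) (T' : topologicalType) (f : I -> T' -> R) :
  (forall i, continuous (f i)) -> continuous (fun y => \prod_(i <- r) f i y).
Proof.
move=> h; elim: r => [|i r IH] x.
  rewrite (_ : (fun _ => _) = fun=> 1); first exact: cvg_cst.
  by apply/funext => y; rewrite big_nil.
rewrite (_ : (fun _ => _) = fun y => f i y * \prod_(j <- r) f j y).
  by apply: cvgM; [exact: h | exact: IH].
by apply/funext => y; rewrite big_cons.
Qed.

Lemma continuous_coef_eval Q : continuous (coef_eval Q).
Proof.
rewrite (_ : coef_eval Q = fun y : 'rV[R]_E => \sum_(a <- msupp Q) Q@_a * \prod_i y ord0 i ^+ a i); last first.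
  by apply/funext => y; rewrite /coef_eval mevalE.
apply: continuous_sumr => a x.
have c1 : continuous (fun y : 'rV[R]_E => \prod_i y ord0 i ^+ a i).
  apply: continuous_prodr => i.
  rewrite (_ : (fun _ => _) = fun y : 'rV[R]_E => \prod_(j < a i) y ord0 i).
    by apply: continuous_prodr => _; exact: coord_continuous.
  by apply/funext => y; rewrite prodr_const card_ord.
exact: cvgM (cvg_cst _) (c1 x).
Qed.

Lemma tensor_of_comp_coef_eval (phi : 'M[R]_d) x I : tensor_of (m:=m) (comp_linear (form_of x) phi) I =
  coef_eval (\sum_J tens phi^T I J *: tensor_of_poly J) x.
Proof.
rewrite (tensor_of_comp _ (form_homog x)) /coef_eval rmorph_sum; apply: eq_bigr => J _.
by rewrite /= mevalZ -coef_eval_tensor_of_poly.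
Qed.

Lemma continuous_tensor_norm_comp (phi : 'M[R]_d) :
  continuous (fun x : 'rV[R]_E => tensor_norm (m:=m) (comp_linear (form_of x) phi)).
Proof.
apply: continuous_sumr => I x.
rewrite (_ : (fun y : 'rV[R]_E => _) =
  fun y => `|coef_eval (\sum_J tens phi^T I J *: tensor_of_poly J) y|); last first.
  by apply/funext => y; rewrite tensor_of_comp_coef_eval.
exact: (cvg_norm (@continuous_coef_eval _ x)).
Qed.

End Invariants.

(** * From compatibility to a polynomial comparable to the shape function *)

Section Compatible.
Context {R : realType} {m d : nat}.
Hypotheses (m2 : (2 <= m)%N) (d2 : (2 <= d)%N).
Local Notation C := R[i].
Local Notation E := #|@exponent m d|.
Local Open Scope classical_set_scope.
Implicit Types (p : {mpoly R[d]}) (x : 'rV[R]_E) (Q : form_poly R m d).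

Lemma coef_eval_homogZ N Q c x : Q \is N.-homog -> coef_eval Q (c *: x) = c ^+ N * coef_eval Q x.
Proof.
move=> hQ; rewrite /coef_eval !mevalE mulr_sumr big_seq [RHS]big_seq; apply: eq_bigr => a aQ.
rewrite mulrCA; congr (_ * _).
have <- : mdeg a = N := dhomog_mf hQ aQ.
rewrite mdegE expr_sum -big_split; apply: eq_bigr => i _ /=.
by rewrite mxE exprMn.
Qed.

Lemma coordsZ c p : coords (m:=m) (c *: p) = c *: coords p.
Proof. by apply/rowP => k; rewrite !mxE mcoeffZ. Qed.

Lemma coord_le_tensor_norm x k : `|x ord0 k| <= tensor_norm (m:=m) (form_of x).
Proof.
have -> : x ord0 k = (form_of x)@_(expo k) by rewrite -{1}(form_ofK x) mxE.
rewrite -{1}(tensor_ofK (form_homog x)) mcoeff_of_tens.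
apply: le_trans (ler_norm_sum _ _ _) _; rewrite /tensor_norm big_mkcond /=.
by apply: ler_sum => I _; case: ifP.
Qed.

(** Up to scaling, every orbit of positive orbit norm meets this set; the bound 2 instead of 1
    leaves room for an infimum that is not attained. The lower bound on the orbit norm is written as
    an intersection of closed conditions. *)
Definition normalized_forms : set 'rV[R]_E :=
  [set x | tensor_norm (m:=m) (form_of x) <= 2] `&`
  \bigcap_(phi in [set phi : 'M[R]_d | \det phi = 1])
    [set x | 1 <= tensor_norm (m:=m) (comp_linear (form_of x) phi)].

Lemma compact_normalized_forms : compact normalized_forms.
Proof.
apply: (subclosed_compact _ (@rV_compact R E (fun=> `[- 2, 2]) (fun _ => @segment_compact _ _ _))).
  apply: closedI.
    have c := @continuous_tensor_norm_comp R m d 1%:M.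
    rewrite (_ : mkset _ = (fun x : 'rV[R]_E => tensor_norm (m:=m) (comp_linear (form_of x) 1%:M)) @^-1` [set y | y <= 2]).
      by move/continuous_closedP : c; apply; exact: closed_le.
    by apply/seteqP; split=> x /=; rewrite (comp_linear1 (form_homog x)).
  apply: closed_bigI => phi _.
  have c := @continuous_tensor_norm_comp R m d phi.
  by move/continuous_closedP : c => /(_ [set y | 1 <= y]); apply; exact: closed_ge.
move=> x [/= x2 _] k; rewrite /= in_itv /= -ler_norml.
exact: le_trans (coord_le_tensor_norm x k) x2.
Qed.

Lemma normalized_forms_orbit_norm x : normalized_forms x -> 1 <= orbit_norm (m:=m) (form_of x).
Proof. by move=> [_ h]; apply: orbit_norm_lb => phi dphi; exact: h. Qed.

Definition good_invariant Q := exists N, [/\ (0 < N)%N, Q \is N.-homog & sl_invariant Q].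

Lemma invariant_cover : compatible R m d ->
  exists2 D : {fset form_poly R m d}, (forall Q, Q \in D -> good_invariant Q) &
    forall x, normalized_forms x -> exists2 Q, Q \in D & coef_eval Q x != 0.
Proof.
move=> compat.
have := compact_normalized_forms; rewrite compact_cover => /(_ (form_poly R m d) good_invariant
  (fun Q => [set x | coef_eval Q x != 0])) [Q _||D hD cov].
- have := @open_comp _ _ (coef_eval Q) [set y : R | y != 0].
  by apply=> [x _|]; [exact: continuous_coef_eval | exact: open_neq].
- move=> x Xx; have hx := form_homog x.
  have nd : ~ sl_degenerates (map_mpoly (real_complex R) (form_of x) : {mpoly C[d]}).
    move=> /(compat (DHomog hx)) /degenerates_orbit_norm /= h.
    by have := normalized_forms_orbit_norm Xx; rewrite (h m) ler10.
  have [N [Q [N0 hQ iQ nz]]] := exists_invariant hx nd.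
  by exists Q; [exists N | rewrite /= form_ofK in nz *].
exists D => [Q /hD /set_mem //|x /cov [Q QD nz]].
by exists Q.
Qed.

Lemma dvdn_prod_seq (I : eqType) (s : seq I) (N : I -> nat) i :
  i \in s -> (N i %| \prod_(j <- s) N j)%N.
Proof. by move=> si; rewrite (big_rem i) //= dvdn_mulr. Qed.

Lemma separating_invariant : compatible R m d -> exists K r,
  [/\ (0 < r)%N, K \is r.-homog, sl_invariant K, forall x, 0 <= coef_eval K x &
      forall x, normalized_forms x -> 0 < coef_eval K x].
Proof.
move=> /invariant_cover [D hD cov].
have hN Q : {N | Q \in D -> [/\ (0 < N)%N, Q \is N.-homog & sl_invariant Q]}.
  apply: cid; have [/hD [N h]|nQ] := boolP (Q \in D); first by exists N.
  by exists 0.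
pose N Q := sval (hN Q).
pose r := (\prod_(Q <- D) N Q)%N.
have N0 Q : Q \in D -> (0 < N Q)%N by move=> /(svalP (hN Q)) [].
have r0 : (0 < r)%N by rewrite /r big_seq; apply: prodn_cond_gt0 => Q; exact: N0.
pose K : form_poly R m d := \sum_(Q <- D) Q ^+ (2 * (r %/ N Q)).
have evK x : coef_eval K x = \sum_(Q <- D) (coef_eval Q x ^+ (r %/ N Q)) ^+ 2.
  rewrite /coef_eval /K rmorph_sum; apply: eq_bigr => Q _.
  by rewrite /= rmorphXn -exprM mulnC.
have dv Q : Q \in D -> (N Q %| r)%N by move=> QD; exact: dvdn_prod_seq.
exists K, (2 * r)%N; split.
- by rewrite muln_gt0.
- rewrite /K big_seq; apply: rpred_sum => Q QD.
  have [_ hQ _] := svalP (hN Q) QD.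
  have := dhomogMn (2 * (r %/ N Q)) hQ.
  by rewrite mulnCA -/(N Q) [(N Q * _)%N]mulnC divnK // dv.
- move=> p phi hp dphi; rewrite !evK big_seq [RHS]big_seq; apply: eq_bigr => Q QD.
  by have [_ _ iQ] := svalP (hN Q) QD; rewrite iQ.
- by move=> x; rewrite evK; apply: sumr_ge0 => Q _; exact: sqr_ge0.
move=> x /cov [Q QD nz]; rewrite evK (big_rem Q) //=.
apply: ltr_pwDl; last by apply: sumr_ge0 => Q' _; exact: sqr_ge0.
by rewrite lt_def sqr_ge0 andbT !expf_neq0.
Qed.

(** Ensures that a normalised form exists, so that the invariant has extrema on such forms and is
    not the zero polynomial. *)
Lemma orbit_norm_fermat : exists2 p : {mpoly R[d]}, p \is m.-homog & 0 < orbit_norm (m:=m) p.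
Proof.
pose p : {mpoly R[d]} := of_tens (@fermat m d R).
have hp : p \is m.-homog := of_tens_homog _.
exists p => //; apply: orbit_norm_gt0 => //.
have mapt I : real_complex R (@fermat m d R I) = @fermat m d C I.
  rewrite /fermat rmorph_sum; apply: eq_bigr => j _; rewrite /tpow rmorph_prod.
  by apply: eq_bigr => k _; rewrite rmorph_nat.
have tenp : tensor_of (m:=m) p = @fermat m d R.
  pose s (a : 'X_{1..d}) : R := \sum_j (a == (U_(j) *+ m)%MM)%:R.
  suff sE : @fermat m d R = s \o monomial by rewrite /p sE of_tensK.
  apply/funext => I; apply: eq_bigr => j _; rewrite /tpow /=.
  have [tI|neq] := eqVneq (monomial I) (U_(j) *+ m)%MM.
    rewrite big1 // => k _; apply/eqP; rewrite pnatr_eq1 eqb1.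
    apply/negPn/negP => Ikj.
    have := congr1 (fun a : 'X_{1..d} => a (I k)) tI.
    rewrite mnm_sumE mulmnE mnm1E eq_sym (negPf Ikj) mul0n (bigD1 k) //= mnm1E eqxx.
    by [].
  have [k Ik] : exists k, I k != j.
    apply/existsP; rewrite -negb_forall; apply: contra neq => /forallP h.
    rewrite /monomial (eq_bigr (fun=> U_(j)%MM)); last by move=> k _; rewrite (eqP (h k)).
    by apply/eqP/mnmP => i; rewrite mnm_sumE mulmnE sum_nat_const card_ord mulnC.
  by rewrite (bigD1 k) //= (negPf Ik) mul0r.
move=> [phi dphi c].
have low n : 1 <= \sum_I `|tensor_of (m:=m) (comp_linear p (phi n)) I| ^+ 2.
  pose g := map_mx (real_complex R) (phi n)^T.
  have dg : \det g = 1 by rewrite det_map_mx det_tr dphi rmorph1.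
  have := fermat_semistable m2 (ltnW d2) dg; congr (_ <= _); apply: eq_bigr => I _.
  rewrite (tensor_of_comp (m:=m)) // tenp -normc_real; congr (Normc.normc _ ^+ 2).
  rewrite /act [in RHS]rmorph_sum; apply: eq_bigr => J _.
  rewrite [in RHS]rmorphM /= mapt; congr (_ * _); rewrite /tens /kron [in RHS]rmorph_prod.
  by apply: eq_bigr => k _; rewrite [in LHS]mxE.
have c1 : cvgs (fun n => \sum_I `|tensor_of (m:=m) (comp_linear p (phi n)) I| ^+ 2) 0.
  have h I : cvgs (fun n => `|tensor_of (m:=m) (comp_linear p (phi n)) I| ^+ 2) 0.
    have h1 := cvgs_norm0 (@cvg_to_zero_tensor_of _ m _ _ c I).
    by have := cvgsM h1 h1; rewrite mulr0.
  have := @cvgs_sum R _ (index_enum {ffun 'I_m -> 'I_d})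
    (fun I n => `|tensor_of (m:=m) (comp_linear p (phi n)) I| ^+ 2) (fun=> 0) h.
  by rewrite big1.
by have := cvgs_ge c1 low; rewrite ler10.
Qed.

End Compatible.

Section CompatibleEquivalent.
Context {R : realType} {m d : nat}.
Hypotheses (m2 : (2 <= m)%N) (d2 : (2 <= d)%N).
Local Notation E := #|@exponent m d|.
Local Open Scope classical_set_scope.
Implicit Types (p : {mpoly R[d]}) (K : form_poly R m d).
Local Notation N := (orbit_norm (R:=R) (m:=m) (d:=d)).

Lemma normalized_forms_scale p : p \is m.-homog -> 0 < N p ->
  exists2 phi : 'M[R]_d, \det phi = 1 &
    normalized_forms (coords (m:=m) ((N p)^-1 *: comp_linear p phi)).
Proof.
move=> hp N0; have [phi dphi lt] := @orbit_norm_adherent R m d p (N p) N0.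
exists phi => //; have hphi := comp_linear_homog phi hp.
have hq : (N p)^-1 *: comp_linear p phi \is m.-homog by exact: rpredZ.
split=> /=; rewrite ?coordsK //.
  rewrite tensor_normZ gtr0_norm ?invr_gt0 // ler_pdivrMl //; apply: le_trans (ltW lt) _.
  by rewrite mulr2n mulrDr mulr1.
move=> psi /= dpsi; rewrite coordsK //.
have := @orbit_norm_le R m d ((N p)^-1 *: comp_linear p phi) psi dpsi.
rewrite (orbit_normZ _ hphi).
rewrite (orbit_norm_comp hp dphi).
apply: le_trans.
by rewrite gtr0_norm ?invr_gt0 // mulVf // gt_eqF.
Qed.

Lemma invariant_orbit_norm K r : (0 < r)%N -> K \is r.-homog -> sl_invariant K ->
  (forall x, 0 <= coef_eval K x) -> (forall x, normalized_forms x -> 0 < coef_eval K x) ->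
  exists2 c : R, 0 < c & forall p, p \is m.-homog ->
    c * N p ^+ r <= coef_eval K (coords p) /\ c * coef_eval K (coords p) <= N p ^+ r.
Proof.
move=> r0 hK iK K0 Kpos.
have Xne : (@normalized_forms R m d !=set0)%classic.
  have [p hp N0] := @orbit_norm_fermat R m d m2 d2.
  by have [phi _ X] := normalized_forms_scale hp N0; eexists; exact: X.
have cts : {within @normalized_forms R m d, continuous (coef_eval K)}.
  by apply: continuous_subspaceT; exact: continuous_coef_eval.
have [x0 x0X hmin] := EVT_min_rV Xne compact_normalized_forms cts.
have [x1 _ hmax] := EVT_max_rV Xne compact_normalized_forms cts.
pose a := coef_eval K x0; pose b := coef_eval K x1 + 1.
have a0 : 0 < a by apply: Kpos; exact: set_mem.
have b0 : 0 < b by apply: ltr_wpDl.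
have scaleE p phi : p \is m.-homog -> \det phi = 1 -> 0 < N p ->
    coef_eval K (coords ((N p)^-1 *: comp_linear p phi)) = (N p)^-1 ^+ r * coef_eval K (coords p).
  by move=> hp dphi N0; rewrite coordsZ (coef_eval_homogZ _ _ hK) iK.
have lower p : p \is m.-homog -> a * N p ^+ r <= coef_eval K (coords p).
  move=> hp; have [->|Nn] := eqVneq (N p) 0; first by rewrite expr0n gtn_eqF // mulr0.
  have N0 : 0 < N p by rewrite lt_def Nn orbit_norm_ge0.
  have [phi dphi X] := normalized_forms_scale hp N0.
  have := hmin _ (mem_set X); rewrite scaleE // exprVn ler_pdivlMl ?exprn_gt0 //.
  by rewrite mulrC.
have upper_pos p : p \is m.-homog -> 0 < N p -> coef_eval K (coords p) <= b * N p ^+ r.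
  move=> hp N0; have [phi dphi X] := normalized_forms_scale hp N0.
  have := hmax _ (mem_set X); rewrite scaleE // exprVn ler_pdivrMl ?exprn_gt0 // => h.
  apply: le_trans h _; rewrite mulrC ler_wpM2r ?exprn_ge0 ?orbit_norm_ge0 //.
  by rewrite lerDl.
exists (Num.min a b^-1); first by rewrite lt_min a0 invr_gt0.
move=> p hp; split.
  apply: le_trans (lower p hp); rewrite ler_wpM2r ?exprn_ge0 ?orbit_norm_ge0 //.
  by rewrite ge_min lexx.
have [N0|N0] := ltP 0 (N p).
  apply: (@le_trans _ _ (b^-1 * coef_eval K (coords p))).
    by rewrite ler_wpM2r // ge_min lexx orbT.
  by rewrite ler_pdivrMl // upper_pos.
have N0' : N p = 0 by apply/eqP; rewrite eq_le N0 orbit_norm_ge0.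
rewrite N0' expr0n gtn_eqF //=; apply: mulr_ge0_le0; first by rewrite le_min ltW //= invr_ge0 ltW.
(* If the orbit norm is 0, no multiple of [p] is normalised. But [K] is constant on the orbit, where
   the coefficients become arbitrarily small, and it is homogeneous of positive degree. *)
pose S := \sum_(u <- msupp K) `|K@_u|.
have S0 : 0 <= S by apply: sumr_ge0.
have bound phi : \det phi = 1 ->
    coef_eval K (coords p) <= S * tensor_norm (m:=m) (comp_linear p phi) ^+ r.
  move=> dphi; rewrite -(iK _ phi hp dphi) /coef_eval mevalE mulr_suml.
  apply: le_trans (ler_norm _) _; apply: le_trans (ler_norm_sum _ _ _) _.
  rewrite big_seq [leRHS]big_seq; apply: ler_sum => u uK; rewrite normrM ler_wpM2l //.
  have <- : mdeg u = r := dhomog_mf hK uK.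
  rewrite mdegE expr_sum normr_prod; apply: ler_prod => i _; rewrite normr_ge0 normrX /=.
  rewrite lerXn2r ?nnegrE ?tensor_norm_ge0 //; apply: le_trans (coord_le_tensor_norm _ _) _.
  by rewrite coordsK //; exact: comp_linear_homog.
rewrite leNgt; apply/negP => kp.
pose e := Num.min 1 (coef_eval K (coords p) / (S + 1)).
have e0 : 0 < e by rewrite lt_min ltr01 divr_gt0 // ltr_wpDl.
have [phi dphi] := @orbit_norm_adherent R m d p e e0; rewrite N0' add0r => lt.
have le1 : tensor_norm (m:=m) (comp_linear p phi) <= 1.
  by apply: le_trans (ltW lt) _; rewrite ge_min lexx.
have := bound phi dphi; apply/negP; rewrite -ltNge.
apply: (@le_lt_trans _ _ (S * e)).
  rewrite ler_wpM2l //; apply: le_trans (ltW lt).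
  by rewrite -[leRHS]expr1; apply: ler_wiXn2l => //; exact: tensor_norm_ge0.
apply: (@le_lt_trans _ _ (S * (coef_eval K (coords p) / (S + 1)))).
  by rewrite ler_wpM2l // ge_min lexx orbT.
by rewrite mulrCA gtr_pMr // ltr_pdivrMr ?ltr_wpDl // mul1r ltrDl.
Qed.

Lemma compatible_equivalent : compatible R m d ->
  exists K : form_poly R m d, equivalent_to_shape K.
Proof.
move=> /separating_invariant [K [r [r0 hK iK K0 Kpos]]]; exists K.
have [c c0 hc] := invariant_orbit_norm r0 hK iK K0 Kpos.
(* The zero polynomial is homogeneous of every degree, so only for [K != 0] does homogeneity give
   the degree [r]. *)
have Kn0 : K != 0.
  have [p hp N0] := @orbit_norm_fermat R m d m2 d2.
  have [phi _ X] := normalized_forms_scale hp N0.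
  by apply: contraTneq (Kpos _ X) => ->; rewrite /coef_eval meval0 ltxx.
have degK : form_degree K = r.
  by apply: (dhomog_uniq Kn0 _ hK); exact: (dhomog_msize hK).
have [s s0 hs] := @shape_orbit_norm R m d m2 d2.
have rn0 : r%:R != 0 :> R by rewrite pnatr_eq0 -lt0n.
have root (x : R) : 0 <= x -> (x ^+ r) `^ r%:R^-1 = x.
  by move=> x0; rewrite -powR_mulrn // -powRrM mulfV // powRr1.
have ri0 : 0 <= r%:R^-1 :> R by rewrite invr_ge0.
pose C := c^-1 `^ r%:R^-1.
have C0 : 0 < C by rewrite powR_gt0 // invr_gt0.
rewrite /equivalent_to_shape degK; split=> //.
  by move=> p; rewrite form_evalE.
exists (s * C); first by rewrite mulr_gt0.
move=> p; have hp : (p : {mpoly R[d]}) \is m.-homog by exact: dhomog_is_dhomog.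
have [lo up] := hc _ hp; have [h1 h2] := hs p.
rewrite form_evalE; set k := coef_eval K _ in lo up *; set n := N p in lo up h1 h2.
have k0 : 0 <= k := K0 _; have n0 : 0 <= n := orbit_norm_ge0 _.
have ci0 : 0 <= c^-1 by rewrite invr_ge0 ltW.
have kC : k `^ r%:R^-1 <= C * n.
  rewrite -[n in C * n](root n n0) -powRM ?exprn_ge0 //.
  by apply: (ge0_ler_powR ri0); rewrite ?nnegrE ?mulr_ge0 ?exprn_ge0 // ler_pdivlMl.
have nC : n <= C * k `^ r%:R^-1.
  rewrite -[leLHS](root n n0) -powRM //.
  by apply: (ge0_ler_powR ri0); rewrite ?nnegrE ?mulr_ge0 ?exprn_ge0 // ler_pdivlMl.
split.
  rewrite ler_pdivrMl ?mulr_gt0 //; apply: le_trans kC _.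
  by rewrite [s * C]mulrC -mulrA ler_wpM2l // ltW.
by apply: le_trans h1 _; rewrite -mulrA ler_wpM2l // ltW.
Qed.

End CompatibleEquivalent.

(** * Boundedness on orbits forces invariance *)

Definition transvection {F : nzRingType} n (i j : 'I_n) (s : F) : 'M[F]_n :=
  1%:M + s *: delta_mx i j.

(** * Generation of the special linear group by transvections *)

Section Transvections.
Context {F : fieldType}.
Implicit Types (s : F).

Lemma transvectionE n (i j : 'I_n) s k l :
  transvection i j s k l = (k == l)%:R + s * ((k == i) && (l == j))%:R.
Proof. by rewrite !mxE. Qed.

Lemma mul_transvection n (i j : 'I_n) s (A : 'M[F]_n) k l :
  (transvection i j s *m A) k l = A k l + (k == i)%:R * s * A j l.
Proof.
rewrite mulmxDl mul1mx mxE; congr (_ + _).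
rewrite -scalemxAl mxE mxE (bigD1 j) //= big1 ?addr0 => [|j' /negPf jj].
  by rewrite mxE eqxx andbT mulrA [s * _]mulrC.
by rewrite mxE jj andbF mul0r.
Qed.

Lemma transvectionVK n (i j : 'I_n) s (A : 'M[F]_n) : i != j ->
  transvection i j (- s) *m (transvection i j s *m A) = A.
Proof.
move=> /negPf ij; apply/matrixP => k l; rewrite !mul_transvection [j == i]eq_sym ij mul0r.
by rewrite mul0r addr0 mulrN mulNr addrK.
Qed.

Lemma det_transvection n (i j : 'I_n) s : i != j -> \det (transvection i j s) = 1.
Proof.
have diag (i' j' : 'I_n) : i' != j' -> \prod_k transvection i' j' s k k = 1.
  move=> ij; apply: big1 => k _; rewrite transvectionE eqxx.
  case: (eqVneq k i') => [->|_] /=; last by rewrite mulr0 addr0.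
  by rewrite (negPf ij) mulr0 addr0.
have trig (i' j' : 'I_n) : (j' < i')%N -> \det (transvection i' j' s) = 1.
  move=> ji; rewrite det_trig; first by apply: diag; rewrite -val_eqE /= gtn_eqF.
  apply/is_trig_mxP => k l kl; rewrite transvectionE -val_eqE /= ltn_eqF // add0r.
  case: (eqVneq k i') => [ki|_] /=; last by rewrite mulr0.
  case: (eqVneq l j') => [lj|_] /=; last by rewrite mulr0.
  by move: kl; rewrite ki lj ltnNge ltnW.
rewrite neq_ltn => /orP[ij|ji]; last exact: trig.
rewrite -det_tr -(trig _ _ ij); congr (\det _).
by apply/matrixP => k l; rewrite mxE !transvectionE [l == k]eq_sym andbC.
Qed.

(** Row operations bring the corner entry to 1. The matrix is then a lower unipotent, a block
    diagonal and an upper unipotent factor; the unipotent ones are products of transvections, and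
    induction applies to the block. *)
Lemma sl_generated n (G : 'M[F]_n -> Prop) : G 1%:M ->
  (forall A B, G A -> G B -> G (A *m B)) ->
  (forall i j s, i != j -> G (transvection i j s)) ->
  forall A, \det A = 1 -> G A.
Proof.
elim: n G => [|n IH] G G1 GM Gt A dA; first by rewrite (_ : A = 1%:M) //; apply/matrixP; case.
have undo i j s (B : 'M[F]_n.+1) : i != j -> G (transvection i j s *m B) -> G B.
  by move=> ij h; rewrite -(transvectionVK s B ij); apply: GM => //; exact: Gt.
have trans_det i j s (B : 'M[F]_n.+1) : i != j -> \det B = 1 -> \det (transvection i j s *m B) = 1.
  by move=> ij dB; rewrite det_mulmx det_transvection // mul1r.
suff H1 (B : 'M[F]_n.+1) : \det B = 1 -> B ord0 ord0 = 1 -> G B.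
  case: n => [|n] in G G1 GM Gt A dA undo trans_det IH H1 *.
    by apply: H1 => //; rewrite -[RHS]dA det_mx11.
  have H2 (B : 'M[F]_n.+2) i : i != ord0 -> B i ord0 != 0 -> \det B = 1 -> G B.
    move=> i0 Bi dB; apply: (undo ord0 i ((1 - B ord0 ord0) / B i ord0)); first by rewrite eq_sym.
    apply: H1; first by apply: trans_det => //; rewrite eq_sym.
    by rewrite mul_transvection eqxx mul1r divfK // addrC subrK.
  have [/existsP [i /andP[i0 Ai]]|] := boolP [exists i, (i != ord0) && (A i ord0 != 0)].
    exact: H2 Ai dA.
  rewrite negb_exists => /forallP no.
  have A0 i : i != ord0 -> A i ord0 = 0.
    by move=> i0; have := no i; rewrite i0 /= negbK => /eqP.
  have A00 : A ord0 ord0 != 0.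
    apply: contra_eq_neq dA => A00; rewrite (expand_det_col _ ord0) big1 1?eq_sym ?oner_eq0 //.
    move=> i _; have [->|i0] := eqVneq i ord0; first by rewrite A00 mul0r.
    by rewrite A0 // mul0r.
  (* The corner is the only nonzero entry of the first column; adding the first row to the second
     makes [H2] applicable. *)
  pose i1 : 'I_n.+2 := lift ord0 ord0.
  apply: (undo i1 ord0 1) => //; apply: (H2 _ i1) => //; last exact: trans_det.
  by rewrite mul_transvection eqxx !mul1r A0 // add0r.
move=> dB B00; clear A dA undo trans_det; rewrite -[n.+1]/(1 + n)%N in G G1 GM Gt B dB B00 *.
have blockM (a : 'rV_n) (v : 'cV_n) (X : 'M_n) : block_mx 1%:M a v X =
    block_mx 1%:M 0 v 1%:M *m block_mx 1%:M 0 0 (X - v *m a) *m block_mx 1%:M a 0 1%:M.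
  rewrite !mulmx_block !mul0mx !mulmx0 !mul1mx !mulmx1 !addr0 !add0r.
  by rewrite mul1mx [v *m a + _]addrC subrK.
have deltaE (i j : 'I_n) : [/\
    transvection (lshift n ord0) (rshift 1 j) =1 (fun s => block_mx 1%:M (s *: delta_mx ord0 j) 0 1%:M),
    transvection (rshift 1 i) (lshift n ord0) =1 (fun s => block_mx 1%:M 0 (s *: delta_mx i ord0) 1%:M) &
    transvection (rshift 1 i) (rshift 1 j) =1
      (fun s => block_mx 1%:M 0 0 (transvection i j s) : 'M[F]_(1 + n))].
  split=> s; apply/matrixP => k l; rewrite transvectionE;
  case: (split_ordP k) => k' ->; case: (split_ordP l) => l' ->;
  rewrite ?block_mxEul ?block_mxEur ?block_mxEdl ?block_mxEdr !mxE
    ?eq_lshift ?eq_rshift ?eq_lrshift ?eq_rlshift ?ord1 ?andbF ?mulr0 ?addr0 ?add0r //.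
have Gu (a : 'rV[F]_n) : G (block_mx 1%:M a 0 1%:M).
  rewrite [a]row_sum_delta; apply: (big_ind (fun a : 'rV[F]_n => G (block_mx 1%:M a 0 1%:M))).
  - by rewrite -scalar_mx_block.
  - move=> x y hx hy; have := GM _ _ hx hy.
    by rewrite mulmx_block !mul0mx !mulmx0 !mul1mx !mulmx1 !addr0 !add0r addrC.
  by move=> j _; have [E _ _] := deltaE j j; rewrite -E; apply: Gt.
have Gl (v : 'cV[F]_n) : G (block_mx 1%:M 0 v 1%:M).
  have -> : v = \sum_i v i ord0 *: delta_mx i ord0.
    by rewrite {1}[v]matrix_sum_delta; apply: eq_bigr => i _; rewrite big_ord1.
  apply: (big_ind (fun v : 'cV[F]_n => G (block_mx 1%:M 0 v 1%:M))).
  - by rewrite -scalar_mx_block.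
  - move=> x y hx hy; have := GM _ _ hx hy.
    by rewrite mulmx_block !mul0mx !mulmx0 !mul1mx !mulmx1 !addr0 !add0r.
  by move=> i _; have [_ E _] := deltaE i i; rewrite -E; apply: Gt.
have ul1 : ulsubmx (B : 'M_(1 + n)) = 1%:M.
  apply/matrixP => i j; rewrite !ord1 !mxE eqxx; rewrite -[RHS]B00; congr (B _ _); exact: val_inj.
rewrite -[B]submxK ul1 blockM; apply: (GM); [apply: (GM) | exact: Gu]; first exact: Gl.
apply: (IH (fun X => G (block_mx 1%:M 0 0 X))).
- by rewrite -scalar_mx_block.
- move=> X Y hX hY; have := GM _ _ hX hY.
  by rewrite mulmx_block !mul0mx !mulmx0 !mul1mx !addr0 !add0r.
- move=> i j s ij; have [_ _ E] := deltaE i j; rewrite -E; apply: Gt.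
  by rewrite eq_rshift.
move: dB; rewrite -{1}[B]submxK ul1 blockM !det_mulmx !(det_ublock, det_lblock).
by rewrite !det1 !mul1r mulr1.
Qed.
End Transvections.

Section NotCompatible.
Context {R : realType} {m d : nat}.
Local Notation C := R[i].
Local Notation rc := (real_complex R).
Local Notation T := {ffun 'I_m -> 'I_d}.
Implicit Types (p : {mpoly R[d]}).

Lemma bounded_poly_const (P : {poly R}) (B : R) :
  (forall s, 0 <= P.[s] <= B) -> forall s, P.[s] = P.[0].
Proof.
move=> h; suff sP : (size P <= 1)%N by move=> s; rewrite (size1_polyC sP) !hornerC.
rewrite leqNgt; apply/negP => sP.
have P0 : P != 0 by rewrite -size_poly_gt0 ltnW.
have [l0|l0] := ltP 0 (lead_coef P).
  have [n hn] := poly_lim_infty (B + 1) l0 sP.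
  by have := hn n (lexx _); have /andP[_] := h n; lra.
have l1 : 0 < lead_coef (- P) by rewrite lead_coefN oppr_gt0 lt_neqAle lead_coef_eq0 P0.
have [|n hn] := poly_lim_infty 1 l1; first by rewrite size_polyN.
by have := hn n (lexx _); rewrite hornerN; have /andP[+ _] := h n; lra.
Qed.

Lemma poly_eq0_nat (Q : {poly C}) : (forall n : nat, Q.[n%:R] = 0) -> Q = 0.
Proof.
move=> h; apply/eqP; apply: contraT => Q0.
have := max_poly_roots Q0 (_ : all (root Q) [seq n%:R | n <- iota 0 (size Q)]) _.
rewrite size_map size_iota ltnn; apply.
  by apply/allP => _ /mapP [n _ ->]; apply/rootP.
rewrite map_inj_uniq ?iota_uniq // => a b /eqP; rewrite eqr_nat => /eqP //.
Qed.

Lemma act_tens_map (A B : comNzRingType) (g : {rmorphism A -> B}) (a : 'M[A]_d)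
    (t : T -> A) I : g (act (tens a) t I) = act (tens (map_mx g a)) (g \o t) I.
Proof.
rewrite /act rmorph_sum; apply: eq_bigr => J _; rewrite rmorphM /tens /kron rmorph_prod.
by congr (_ * _); apply: eq_bigr => k _; rewrite mxE.
Qed.

Lemma map_transvection (A B : comNzRingType) (g : {rmorphism A -> B}) (i j : 'I_d) (s : A) :
  map_mx g (transvection i j s) = transvection i j (g s).
Proof. by rewrite /transvection map_mxD map_mxZ map_mx1 map_delta_mx. Qed.

Section Fixed.
Variable K : form_poly R m d.

(** The value of [K] at a tensor over any commutative ring, its coefficients being carried over by
    [f]. Over a polynomial ring the parameter of a transvection can be an indeterminate. *)
Definition coef_eval_tens (A : comNzRingType) (f : R -> A) (t : T -> A) : A :=
  \sum_(a <- msupp K) f K@_a * \prod_k (\sum_(I | monomial I == expo k) t I) ^+ a k.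

Lemma coef_eval_tens_map (A B : comNzRingType) (f : R -> A) (g : {rmorphism A -> B}) (t : T -> A) :
  g (coef_eval_tens f t) = coef_eval_tens (g \o f) (g \o t).
Proof.
rewrite /coef_eval_tens rmorph_sum; apply: eq_bigr => a _; rewrite rmorphM rmorph_prod.
by congr (_ * _); apply: eq_bigr => k _; rewrite rmorphXn rmorph_sum.
Qed.

Lemma coef_eval_tensE (t : T -> R) : coef_eval_tens id t = coef_eval K (coords (of_tens t)).
Proof.
rewrite /coef_eval mevalE; apply: eq_bigr => a _; congr (_ * _); apply: eq_bigr => k _.
by rewrite mxE mcoeff_of_tens.
Qed.

Hypothesis Kbound : forall p, p \is m.-homog -> exists B : R, forall phi : 'M[R]_d,
  \det phi = 1 -> 0 <= coef_eval K (coords (comp_linear p phi)) <= B.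

Lemma real_transvection (i j : 'I_d) (s : R) (t : T -> R) : i != j ->
  coef_eval_tens id (act (tens (transvection i j s)) t) = coef_eval_tens id t.
Proof.
move=> ij.
pose P : {poly R} := coef_eval_tens polyC (act (tens (transvection i j 'X)) (polyC \o t)).
have PE u : P.[u] = coef_eval_tens id (act (tens (transvection i j u)) t).
  rewrite -[LHS]/(horner_eval u P) coef_eval_tens_map; congr coef_eval_tens.
    by apply/funext => x; rewrite /= /horner_eval hornerC.
  apply/funext => I; rewrite /= act_tens_map map_transvection /= /horner_eval hornerX.
  by congr (act _ _ I); apply/funext => J; rewrite /= hornerC.
have [B hB] := Kbound (of_tens_homog t).
have /bounded_poly_const h : forall u, 0 <= P.[u] <= B.
  move=> u; rewrite PE coef_eval_tensE.
  have := hB (transvection i j u)^T; rewrite comp_of_tens trmxK; apply.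
  by rewrite det_tr det_transvection.
rewrite -PE h PE; congr coef_eval_tens.
by rewrite /transvection scale0r addr0 tens1 act_kid.
Qed.

(** The polynomial [line z] takes the value [z] at the imaginary unit and real values at the natural
    numbers. With all data replaced by such polynomials, the identity holds at every natural number
    by the real case, hence identically, and therefore at the imaginary unit. *)
Lemma complex_transvection (i j : 'I_d) (s : C) (t : T -> C) : i != j ->
  coef_eval_tens rc (act (tens (transvection i j s)) t) = coef_eval_tens rc t.
Proof.
move=> ij.
pose line (z : C) : {poly C} := (rc (complex.Re z))%:P + rc (complex.Im z) *: 'X.
have lineE u z : (line z).[u] = rc (complex.Re z) + rc (complex.Im z) * u.
  by rewrite hornerD hornerC hornerZ hornerX.
pose Q1 : {poly C} := coef_eval_tens (polyC \o rc) (act (tens (transvection i j (line s))) (line \o t)).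
pose Q2 : {poly C} := coef_eval_tens (polyC \o rc) (line \o t).
have E u : horner_eval u \o (polyC \o rc) = rc.
  by apply/funext => x; rewrite /= /horner_eval hornerC.
have E1 u : Q1.[u] = coef_eval_tens rc (act (tens (transvection i j (line s).[u])) (fun I => (line (t I)).[u])).
  rewrite -[LHS]/(horner_eval u Q1) coef_eval_tens_map E; congr coef_eval_tens.
  apply/funext => I; rewrite /= act_tens_map map_transvection /= /horner_eval.
  by [].
have E2 u : Q2.[u] = coef_eval_tens rc (fun I => (line (t I)).[u]).
  by rewrite -[LHS]/(horner_eval u Q2) coef_eval_tens_map E.
have Q0 : Q1 - Q2 = 0.
  apply: poly_eq0_nat => n; rewrite hornerD hornerN E1 E2.
  pose tn I : R := complex.Re (t I) + complex.Im (t I) * n%:R.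
  have tE : (fun I => (line (t I)).[n%:R]) = rc \o tn.
    by apply/funext => I; rewrite lineE /tn /= rmorphD rmorphM rmorph_nat.
  have sE : (line s).[n%:R] = rc (complex.Re s + complex.Im s * n%:R).
    by rewrite lineE rmorphD rmorphM rmorph_nat.
  have rcE (x : T -> R) : coef_eval_tens rc (rc \o x) = rc (coef_eval_tens id x).
    by rewrite (coef_eval_tens_map id rc).
  have appE (x : T -> R) c : act (tens (transvection i j (rc c))) (rc \o x) =
      rc \o act (tens (transvection i j c)) x.
    by apply/funext => I /=; rewrite (act_tens_map rc) map_transvection.
  by rewrite tE sE appE !rcE real_transvection // subrr.
have lineI z : (line z).['i%C] = z by rewrite lineE mulrC -complexE.
have := congr1 (fun q : {poly C} => q.['i%C]) Q0.
rewrite hornerD hornerN horner0 E1 E2 lineI => /eqP; rewrite subr_eq0 => /eqP.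
by under eq_fun do rewrite lineI.
Qed.

Lemma complex_sl_invariant (g : 'M[C]_d) (t : T -> C) : \det g = 1 ->
  coef_eval_tens rc (act (tens g) t) = coef_eval_tens rc t.
Proof.
move=> dg; move: t.
apply: (@sl_generated _ _ (fun g : 'M[C]_d => forall t, coef_eval_tens rc (act (tens g) t) = coef_eval_tens rc t)) dg.
- by move=> t; rewrite tens1 act_kid.
- by move=> A B hA hB t; rewrite tensM act_kmul hA hB.
- by move=> i j s ij t; apply: complex_transvection.
Qed.

Lemma degenerate_value p : p \is m.-homog ->
  sl_degenerates (map_mpoly rc p : {mpoly C[d]}) -> coef_eval K (coords p) = coef_eval K (coords 0).
Proof.
move=> hp [phi dphi c]; have hmp := map_homog hp.
pose u n := tensor_of (m:=m) (comp_linear (map_mpoly rc p) (phi n)).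
have uE n : coef_eval_tens rc (u n) = rc (coef_eval K (coords p)).
  rewrite /u tensor_of_comp // complex_sl_invariant ?det_tr //.
  by rewrite tensor_of_map (_ : (fun I => _) = rc \o tensor_of p) // -(coef_eval_tens_map id rc) coef_eval_tensE tensor_ofK.
have h0 I : cvgs (u ^~ I) 0 := @cvg_to_zero_tensor_of _ m _ _ c I.
have c1 : cvgs (fun n => coef_eval_tens rc (u n)) (coef_eval_tens rc (fun=> 0)).
  apply: cvgs_sum => a; apply: cvgsM; first exact: cvgs_cst.
  apply: cvgs_prod => k.
  have c2 : cvgs (fun n => \sum_(I | monomial I == expo k) u n I) (\sum_(I : T | monomial I == expo k) (0 : C)).
    rewrite -big_filter (_ : (fun _ => _) =
      fun n => \sum_(I <- [seq I : T <- index_enum _ | monomial I == expo k]) u n I).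
      exact: cvgs_sum.
    by apply/funext => n; rewrite big_filter.
  elim: (a k) => [|e IH]; first by under eq_fun do rewrite expr0; exact: cvgs_cst.
  by under eq_fun do rewrite exprS; rewrite exprS; apply: cvgsM.
have uc : (fun n => coef_eval_tens rc (u n)) = fun=> rc (coef_eval K (coords p)) by apply/funext.
rewrite uc in c1; have := cvgs_unique (cvgs_cst _) c1.
have -> : (fun=> 0) = rc \o (fun=> 0) :> (T -> C) by [].
rewrite -(coef_eval_tens_map id rc) coef_eval_tensE => /complexI ->; congr (coef_eval K (coords _)).
by rewrite /of_tens big1 // => I _; rewrite scale0r.
Qed.

End Fixed.
End NotCompatible.

Lemma equivalent_compatible (R : realType) (m d : nat) (K : form_poly R m d) :
  (2 <= m)%N -> (2 <= d)%N -> equivalent_to_shape K -> compatible R m d.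
Proof.
move=> m2 d2 [r1 K0 [C C0 hC]] p cp; apply: contrapT => np.
have hp : (p : {mpoly R[d]}) \is m.-homog by exact: dhomog_is_dhomog.
have N0 := @orbit_norm_gt0 R m d _ hp np.
have [c c0 hc] := @shape_orbit_norm R m d m2 d2.
set r := form_degree K in r1 hC.
have rn0 : r%:R^-1 != 0 :> R by rewrite invr_eq0 pnatr_eq0 -lt0n.
have shape_le (q : dhomog d R m) : shape_function q <= c * orbit_norm (m:=m) (q : {mpoly R[d]}) by case: (hc q).
have Kbound (q : {mpoly R[d]}) : q \is m.-homog -> exists B : R, forall phi : 'M[R]_d,
    \det phi = 1 -> 0 <= coef_eval K (coords (comp_linear q phi)) <= B.
  move=> hq; exists ((C * (c * orbit_norm (m:=m) q)) ^+ r) => phi dphi.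
  pose q' : dhomog d R m := DHomog (comp_linear_homog phi hq).
  have := K0 q'; rewrite form_evalE => k0; rewrite k0 /=.
  have [h _] := hC q'; rewrite ler_pdivrMl // form_evalE in h.
  set k := coef_eval K _ in k0 h *.
  have -> : k = (k `^ r%:R^-1) ^+ r.
    by rewrite -powR_mulrn ?powR_ge0 // -powRrM mulVf ?powRr1 // pnatr_eq0 -lt0n.
  apply: lerXn2r; rewrite ?nnegrE ?powR_ge0 ?mulr_ge0 ?(ltW C0) ?(ltW c0) ?orbit_norm_ge0 //.
  apply: (le_trans h); rewrite (ler_pM2l C0); apply: (le_trans (shape_le q')).
  by rewrite (orbit_norm_comp hq dphi).
(* [K] is not assumed homogeneous, so its vanishing at 0 is drawn from the equivalence and the orbit
   norm of 0. *)
have K00 : coef_eval K (coords 0) = 0.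
  pose o : dhomog d R m := 0.
  have [h _] := hC o; have := shape_le o; have := K0 o.
  rewrite form_evalE in h *; rewrite -[val o]/(0 : {mpoly R[d]}) in h * => k0 s0.
  apply/eqP; rewrite eq_le k0 andbT leNgt; apply/negP => kp.
  have : 0 < C^-1 * coef_eval K (coords 0) `^ r%:R^-1 by rewrite mulr_gt0 ?invr_gt0 ?powR_gt0.
  apply/negP; rewrite -leNgt; apply: le_trans h _; apply: le_trans s0 _.
  have : orbit_norm (m:=m) (0 : {mpoly R[d]}) = 0.
    have h0 : (0 : {mpoly R[d]}) \is m.-homog by exact: rpred0.
    by have := orbit_normZ 0 h0; rewrite scale0r normr0 mul0r.
  by move=> ->; rewrite mulr0.
have kp : form_eval K p = 0 by rewrite form_evalE (degenerate_value Kbound hp cp) K00.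
have [_ h] := hC p; rewrite kp powR0 // mulr0 in h.
have [_ h2] := hc p.
by move: N0; apply/negP; rewrite -leNgt; apply: le_trans h2 _; rewrite pmulr_rle0.
Qed.

Theorem theorem6p1 (R : realType) (m d : nat) (hm : (2 <= m)%N) (hd : (2 <= d)%N) :
  (compatible R m d ->
     exists K : form_poly R m d, equivalent_to_shape K) /\
  (~ compatible R m d ->
     ~ exists K : form_poly R m d, equivalent_to_shape K).
Proof.
split; first exact: compatible_equivalent.
by move=> nc [K /(equivalent_compatible hm hd)].
Qed.
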